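(* Let $n\ge 3$ be an integer and let $t,q$ be nonzero complex numbers. Assume that $q$ is not a $k$-th root of unity for every integer $k$ with $1\le k\le n$, i.e. $q^k\neq 1$ for $1\le k\le n$. Consider the Lawrence--Krammer representation of degree $\frac{n(n-1)}{2}$ with parameters $t,q$ (realized as in the context). ''Proper invariant subspace'' means an invariant subspace different from $\{0\}$ and from the whole space. (1) Assume that it is not the case that both $t=-1$ and $q^n=-1$. If the Lawrence--Krammer representation is reducible, then it has a unique proper invariant subspace, and this subspace is isomorphic (as a module over the Iwahori--Hecke algebra of $Sym(n)$) to one of the Specht modules $S^{(n)}$, $S^{(n-1,1)}$, $S^{(n-2,2)}$ (the latter only for $n\ge 4$), $S^{(n-2,1,1)}$. These cases arise respectively if and only if $$t=\frac{1}{q^n},\qquad t\in\Big\{\frac{1}{\sqrt{q}^{\,n}},-\frac{1}{\sqrt{q}^{\,n}}\Big\},\qquad t=\frac1q\ (n\ge 4),\qquad t=-1 .$$ (2) If $t=-1$ and $q^n=-1$, then there are exactly three proper invariant subspaces of the Lawrence--Krammer space, and they are respectively isomorphic to $S^{(n)}$, $S^{(n-2,1,1)}$ and $S^{(n)}\oplus S^{(n-2,1,1)}$.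
   Context: Realization of the representation. Given $t,q$, choose $r\in\mathbb{C}^*$ with $q=1/r^2$ and put $l=r^3/t$, $m=\frac1r-r$ and $F=\mathbb{Q}(l,r)\subseteq\mathbb{C}$. The Lawrence--Krammer space $\mathcal V^{(n)}$ is the $F$-vector space with basis $(w_{s,t})_{1\le s<t\le n}$ (also written $w_{st}$). For $1\le i\le n-1$ the braid generator $g_i$ of the braid group on $n$ strands acts by the endomorphism $\nu_i$ defined by: - $\nu_i(w_{i,i+1})=\frac1l w_{i,i+1}$; - $\nu_i(w_{s,i})=w_{s,i+1}$ for $s\le i-1$; - $\nu_i(w_{i+1,k})=w_{i,k}+m\,r^{k-i-2}\,w_{i,i+1}-m\,w_{i+1,k}$ for $k\ge i+2$; - $\nu_i(w_{s,i+1})=w_{s,i}+\frac{m}{l\,r^{i-s-1}}\,w_{i,i+1}-m\,w_{s,i+1}$ for $s\le i-1$; - $\nu_i(w_{i,k})=w_{i+1,k}$ for $k\ge i+2$; - $\nu_i(w_{s,k})=r\,w_{s,k}$ in all remaining cases (i.e. $\{s,k\}\cap\{i,i+1\}=\emptyset$). Up to rescaling of the generators, this is the Lawrence--Krammer representation with parameters $t,q$. A subspace is invariant if it is stable under all $\nu_i$. Hecke algebra and Specht modules. $\mathcal H_{F,r^2}(n)$ is the Iwahori--Hecke algebra of $Sym(n)$ with parameter $r^2$, presented (after rescaling generators) by $g_1,\dots,g_{n-1}$ with the braid relations and $g_i^2+m\,g_i=1$, i.e. $(g_i-r)(g_i+\frac1r)=0$. The hypothesis on $q$ (equivalently $r^{2k}\ne1$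 for $1\le k\le n$) makes it semisimple. It is a known fact that on every proper invariant subspace of $\mathcal V^{(n)}$ the $g_i$ act through $\mathcal H_{F,r^2}(n)$, so proper invariant subspaces are $\mathcal H_{F,r^2}(n)$-modules. For a partition $\lambda$ of $n$, $S^\lambda$ denotes the Specht module of $\mathcal H_{F,r^2}(n)$, with the labelling normalized so that on $S^{(n)}$ every $g_i$ acts as $r$, on $S^{(1^n)}$ every $g_i$ acts as $-\frac1r$, and the usual branching rule holds for restriction from $\mathcal H_{F,r^2}(n)$ to $\mathcal H_{F,r^2}(n-1)$. *)

(* Defs.v *)
(* The complex numbers are R[i], for an arbitrary R : realType.               *)
From HB Require Import structures.
From mathcomp Require Import all_boot all_order all_fingroup all_algebra.
From mathcomp Require Import boolp reals.
From mathcomp Require Export complex.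

Set Implicit Arguments.
Unset Strict Implicit.
Unset Printing Implicit Defensive.

Import GRing.Theory Num.Theory.

Local Open Scope ring_scope.

Section AdjoinRat.
Variables (C : numFieldType) (a b : C).

(* Q(a, b): the intersection of all subfields of C containing a and b.       *)
Definition adjoin_rat : {pred C} := fun z =>
  `[< forall S : {pred C}, divring_closed S -> a \in S -> b \in S -> z \in S >].

Fact adjoin_rat_divring_closed : divring_closed adjoin_rat.
Proof.
split.
- by apply/asboolP => S [].
- move=> x y /asboolP xF /asboolP yF; apply/asboolP => S clS aS bS.
  by case: (clS) => _ + _; apply; [apply: xF | apply: yF].
- move=> x y /asboolP xF /asboolP yF; apply/asboolP => S clS aS bS.
  by case: (clS) => _ _; apply; [apply: xF | apply: yF].
Qed.

HB.instance Definition _ :=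
  GRing.isDivringClosed.Build C adjoin_rat adjoin_rat_divring_closed.

Record adjoin_rat_type := AdjoinRat {
  adjoin_rat_val :> C;
  _ : adjoin_rat_val \in adjoin_rat
}.

HB.instance Definition _ := [isSub for adjoin_rat_val].
HB.instance Definition _ := [Choice of adjoin_rat_type by <:].
HB.instance Definition _ := [SubChoice_isSubIntegralDomain of adjoin_rat_type by <:].
HB.instance Definition _ := [SubIntegralDomain_isSubField of adjoin_rat_type by <:].

Fact adjoin_rat_gen1 : a \in adjoin_rat. Proof. exact/asboolP. Qed.
Fact adjoin_rat_gen2 : b \in adjoin_rat. Proof. exact/asboolP. Qed.

Definition adjoin_gen1 : adjoin_rat_type := AdjoinRat adjoin_rat_gen1.
Definition adjoin_gen2 : adjoin_rat_type := AdjoinRat adjoin_rat_gen2.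

End AdjoinRat.

(* Indices are 0-based: strands are 0, ..., n - 1 and generators are indexed *)
(* by i : 'I_n.-1, the generator i involving the strands i and i + 1. All    *)
(* the exponents below are differences of indices, hence are not affected.   *)

Definition lk_index (n : nat) := {p : 'I_n * 'I_n | (p.1 < p.2)%N}.

Notation lk_space F n := {ffun lk_index n -> F^o}.

Section LawrenceKrammer.
Variables (F : fieldType) (n : nat) (l r : F).

Let m : F := r^-1 - r.

Local Notation V := (lk_space F n).

(* For s < k < n this is the basis vector w_{s,k}; it is 0 otherwise.        *)
Definition lk_w (s k : nat) : V :=
  [ffun p : lk_index n => (((val p).1 == s :> nat) && ((val p).2 == k :> nat))%:R].

Definition lk_nu_w (i s k : nat) : V :=
  if (s == i) && (k == i.+1) then l^-1 *: lk_w i i.+1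
  else if k == i then lk_w s i.+1
  else if s == i.+1 then
    lk_w i k + (m * r ^+ (k - i - 2)) *: lk_w i i.+1 - m *: lk_w i.+1 k
  else if k == i.+1 then
    lk_w s i + (m / (l * r ^+ (i - s - 1))) *: lk_w i i.+1 - m *: lk_w s i.+1
  else if s == i then lk_w i.+1 k
  else r *: lk_w s k.

Definition lk_nu_fun (i : nat) (v : V) : V :=
  \sum_(p : lk_index n) v p *: lk_nu_w i (val p).1 (val p).2.

Fact lk_nu_fun_is_linear i : linear (lk_nu_fun i).
Proof.
move=> c u v; rewrite /lk_nu_fun scaler_sumr -big_split /=.
by apply: eq_bigr => p _; rewrite !ffunE scalerDl scalerA.
Qed.

HB.instance Definition _ (i : nat) :=
  GRing.isLinear.Build F V V _ (lk_nu_fun i)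
    (lk_nu_fun_is_linear i).

Definition lk_nu (i : 'I_n.-1) : 'End(V) := linfun (lk_nu_fun i).

Fact lk_nuE (i : 'I_n.-1) (p : lk_index n) :
  lk_nu i (lk_w (val p).1 (val p).2) = lk_nu_w i (val p).1 (val p).2.
Proof.
rewrite lfunE /= /lk_nu_fun (bigD1 p) //= big1 ?addr0 => [|p' p'p].
  by rewrite !ffunE !eqxx scale1r.
suff /negPf neq: ~~ (((val p').1 == (val p).1 :> nat) &&
                     ((val p').2 == (val p).2 :> nat)).
  by rewrite ffunE neq scale0r.
apply: contra p'p => /andP[/eqP e1 /eqP e2]; apply/eqP/val_inj.
by case: (val p') (val p) e1 e2 => [? ?] [? ?] /= /val_inj-> /val_inj->.
Qed.

Definition lk_invariant (U : {vspace V}) : Prop :=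
  forall i : 'I_n.-1, (lk_nu i @: U <= U)%VS.

Definition lk_proper_invariant (U : {vspace V}) : Prop :=
  [/\ lk_invariant U, U != 0%VS & U != fullv].

Definition lk_reducible : Prop :=
  exists U : {vspace V}, lk_proper_invariant U.

End LawrenceKrammer.

(* Modules over the Iwahori-Hecke algebra H_{F,r^2}(n) are given through its *)
(* presentation, as subspaces U of a space V on which operators (rho i)      *)
(* are defined; the relations are only required to hold on U.                *)

Section HeckeModules.
Variables (F : fieldType) (n : nat) (r : F).

Let m : F := r^-1 - r.

Definition hecke_module (V : vectType F) (rho : 'I_n.-1 -> 'End(V))
    (U : {vspace V}) : Prop :=
  [/\ forall i : 'I_n.-1, (rho i @: U <= U)%VS,
      forall (i : 'I_n.-1) (u : V), u \in U ->
        rho i (rho i u) + m *: rho i u = u,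
      forall (i j : 'I_n.-1) (u : V), j = i.+1 :> nat -> u \in U ->
        rho i (rho j (rho i u)) = rho j (rho i (rho j u))
    & forall (i j : 'I_n.-1) (u : V), (i.+1 < j)%N -> u \in U ->
        rho i (rho j u) = rho j (rho i u)].

Definition hecke_iso (V1 V2 : vectType F)
    (rho1 : 'I_n.-1 -> 'End(V1)) (U1 : {vspace V1})
    (rho2 : 'I_n.-1 -> 'End(V2)) (U2 : {vspace V2}) : Prop :=
  [/\ hecke_module rho1 U1, hecke_module rho2 U2
    & exists f : 'Hom(V1, V2),
        [/\ {in U1 &, injective f}, (f @: U1)%VS = U2
          & forall (i : 'I_n.-1) (u : V1), u \in U1 ->
              f (rho1 i u) = rho2 i (f u)]].

(* The external direct sum of (V1, rho1, U1) and (V2, rho2, U2).             *)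
Definition dsum_fun (V1 V2 : vectType F) (f1 : 'End(V1)) (f2 : 'End(V2))
  (v : V1 * V2) : V1 * V2 := (f1 v.1, f2 v.2).

Fact dsum_fun_is_linear (V1 V2 : vectType F) (f1 : 'End(V1)) (f2 : 'End(V2)) :
  linear (dsum_fun f1 f2).
Proof. by move=> c u v; rewrite /dsum_fun /= !linearP. Qed.

HB.instance Definition _ (V1 V2 : vectType F) f1 f2 :=
  GRing.isLinear.Build F (V1 * V2)%type (V1 * V2)%type _ (dsum_fun f1 f2)
    (@dsum_fun_is_linear V1 V2 f1 f2).

Definition dsum_act (V1 V2 : vectType F)
    (rho1 : 'I_n.-1 -> 'End(V1)) (rho2 : 'I_n.-1 -> 'End(V2))
    (i : 'I_n.-1) : 'End((V1 * V2)%type) :=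
  linfun (dsum_fun (rho1 i) (rho2 i)).

Definition dsum_sub (V1 V2 : vectType F)
    (U1 : {vspace V1}) (U2 : {vspace V2}) : {vspace (V1 * V2)%type} :=
  (linfun fst @^-1: U1 :&: linfun snd @^-1: U2)%VS.

Fact mem_dsum_sub (V1 V2 : vectType F) (U1 : {vspace V1}) (U2 : {vspace V2})
    (v : V1 * V2) :
  (v \in dsum_sub U1 U2) = (v.1 \in U1) && (v.2 \in U2).
Proof. by rewrite memv_cap -!memv_preim !lfunE. Qed.

End HeckeModules.

(* Specht modules, following Dipper and James: S^lambda is the right ideal   *)
(* z_lambda H with z_lambda = x_lambda T_{w_lambda} y_{lambda'}. The Hecke   *)
(* algebra H is realized on its standard basis (g_w), w in Sym(n), in the    *)
(* normalization (g_i - r)(g_i + 1/r) = 0; the Dipper-James basis (for the   *)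
(* parameter r^2) is T_w = r^len(w) g_w. In MathComp (w * s) x = s (w x),    *)
(* as in their convention. Since the defining relations are invariant under  *)
(* reversal of words, a right H-module is also a left one, with the same     *)
(* operators g_i.                                                            *)

Section Specht.
Variables (F : fieldType) (n : nat) (r : F).

Let m : F := r^-1 - r.

Fact strand_lt (i : 'I_n.-1) : (i < n)%N.
Proof. by case: n i => [|n'] [k] //= /ltnW. Qed.

Fact strandS_lt (i : 'I_n.-1) : (i.+1 < n)%N.
Proof. by case: n i => [|n'] [k]. Qed.

Definition simple_refl (i : 'I_n.-1) : 'S_n :=
  tperm (Ordinal (strand_lt i)) (Ordinal (strandS_lt i)).

Definition perm_len (w : 'S_n) : nat :=
  #|[set p : 'I_n * 'I_n | (p.1 < p.2)%N && (w p.2 < w p.1)%N]|.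

Local Notation hecke_alg := {ffun 'S_n -> F^o}.

Definition hecke_g (w : 'S_n) : hecke_alg := [ffun w' => (w' == w)%:R].

(* g_w g_i = g_{w s_i} if the length goes up; otherwise g_w = g_{w s_i} g_i  *)
(* and g_i^2 = 1 - m g_i.                                                    *)
Definition hecke_rmul_g (i : 'I_n.-1) (w : 'S_n) : hecke_alg :=
  let ws := (w * simple_refl i)%g in
  if (perm_len w < perm_len ws)%N then hecke_g ws
  else hecke_g ws - m *: hecke_g w.

Definition hecke_rmul_fun (i : 'I_n.-1) (h : hecke_alg) : hecke_alg :=
  \sum_(w : 'S_n) h w *: hecke_rmul_g i w.

Fact hecke_rmul_fun_is_linear i : linear (hecke_rmul_fun i).
Proof.
move=> c u v; rewrite /hecke_rmul_fun scaler_sumr -big_split /=.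
by apply: eq_bigr => p _; rewrite !ffunE scalerDl scalerA.
Qed.

HB.instance Definition _ (i : 'I_n.-1) :=
  GRing.isLinear.Build F hecke_alg hecke_alg _ (hecke_rmul_fun i)
    (hecke_rmul_fun_is_linear i).

(* h |-> h g_i                                                               *)
Definition hecke_rmul (i : 'I_n.-1) : 'End(hecke_alg) :=
  linfun (hecke_rmul_fun i).

(* h g_w, computed along a reduced word of w; the first argument is the      *)
(* length of w.                                                              *)
Fixpoint hecke_rmul_word (k : nat) (w : 'S_n) (h : hecke_alg) : hecke_alg :=
  if k is k'.+1 then
    if [pick i : 'I_n.-1 | (perm_len (w * simple_refl i)%g < perm_len w)%N]
      is Some i
    then hecke_rmul i (hecke_rmul_word k' (w * simple_refl i)%g h)
    else h
  else h.

Definition hecke_mul (h h' : hecke_alg) : hecke_alg :=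
  \sum_(w : 'S_n) h' w *: hecke_rmul_word (perm_len w) w h.

Section Shape.
Variable lam : seq nat.

Definition conj_part : seq nat :=
  mkseq (fun j => count (fun x => j < x)%N lam) (head 0%N lam).

(* The Young subgroup: the row stabilizer of the tableau of shape lam filled *)
(* along its rows, in which the entry k lies in row (reshape_index lam k)    *)
(* and column (reshape_offset lam k).                                        *)
Definition young_subgroup : {set 'S_n} :=
  [set w : 'S_n |
    [forall k : 'I_n, reshape_index lam (w k) == reshape_index lam k]].

Definition specht_x : hecke_alg :=
  [ffun w => if w \in young_subgroup then r ^+ perm_len w else 0].

(* (- r^2)^{- len w} T_w = (- 1/r)^{len w} g_w                               *)
Definition specht_y : hecke_alg :=
  [ffun w => if w \in young_subgroup then (- r^-1) ^+ perm_len w else 0].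

End Shape.

(* w_lambda sends the entry of each cell in the tableau filled along the     *)
(* rows to its entry in the tableau filled along the columns. The default    *)
(* values in insubd are not used when lam is a partition of n.               *)
Definition specht_w_fun (lam : seq nat) : {ffun 'I_n -> 'I_n} :=
  [ffun k : 'I_n => insubd k
    (flatten_index (conj_part lam)
       (reshape_offset lam k) (reshape_index lam k))].

Definition specht_w (lam : seq nat) : 'S_n :=
  insubd (1%g : 'S_n) (specht_w_fun lam).

Definition specht_z (lam : seq nat) : hecke_alg :=
  hecke_mul (hecke_mul (specht_x lam) (hecke_g (specht_w lam)))
            (specht_y (conj_part lam)).

(* z_lambda H; the generators act on it by hecke_rmul.                       *)
Definition specht (lam : seq nat) : {vspace hecke_alg} :=
  <<[seq hecke_mul (specht_z lam) (hecke_g w) | w : 'S_n]>>%VS.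

End Specht.

Section LawrenceKrammerSpecht.
Variables (F : fieldType) (n : nat) (l r : F).

Definition lk_iso_specht (U : {vspace lk_space F n}) (lam : seq nat) : Prop :=
  hecke_iso r (@lk_nu F n l r) U (@hecke_rmul F n r) (specht n r lam).

Definition lk_iso_specht2 (U : {vspace lk_space F n})
    (lam mu : seq nat) : Prop :=
  hecke_iso r (@lk_nu F n l r) U
    (dsum_act (@hecke_rmul F n r) (@hecke_rmul F n r))
    (dsum_sub (specht n r lam) (specht n r mu)).

(* Some proper invariant subspace is isomorphic to S^lam.                    *)
Definition lk_contains_specht (lam : seq nat) : Prop :=
  exists U : {vspace lk_space F n},
    lk_proper_invariant l r U /\ lk_iso_specht U lam.

End LawrenceKrammerSpecht.

(* Main.v *)
(* Put w_i := w_{i,i+1}. On V the operator nu_i^2 + m nu_i - 1 sends v to a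
   multiple of w_i, whose coefficient is, up to a power of r, the linear form
     D v_{i,i+1} + (1 - r^2) (r R_i(v) + (t / r) R_{i+1}(v)),
   D = (t - r^2) (t + 1), where the R_j are n explicit linear forms (the rows).
   As w_i generates V, these forms vanish on every proper invariant subspace U.
   - If D != 0, then v in U is determined by its rows, which satisfy
     (t^2 - r^{2n}) R_j(v) = - r^{2j} t (1 - r^2) sum_k R_k(v). Hence U is a
     line (t = r^{2n}), or R_0 + ... + R_{n-1} = 0 on U and t^2 = r^{2n}.
   - If D = 0, then U lies in the common kernel K of the rows, unless t = -1 and
     q^n = -1, when it lies in the sum of K and the line above. On K the nu_i
     are self-adjoint for the standard bilinear form, and each nonzero invariant
     subspace of K contains an explicit non-isotropic vector p; its orthogonal
     in K is invariant and omits p, so it is 0, and K is irreducible.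
   To identify an irreducible module with S^lam, take a linear form theta on it
   which the generators of the Young subgroup of lam multiply by r, and map v to
   sum_w theta(g_{w^-1} v) g_w. A vector p on which those of the Young subgroup of
   lam' act by -1/r then goes to an element of H which is symmetric on the left
   and alternating on the right; by a minimal length argument, such elements are
   the multiples of z_lam.
   The four modules are told apart by common eigenvectors for -1/r. *)
Require Import Defs.
From HB Require Import structures.
From mathcomp Require Import all_boot all_order all_fingroup all_algebra.
From mathcomp Require Import boolp reals.
From mathcomp Require Import zify ring.

Set Implicit Arguments.
Unset Strict Implicit.
Unset Printing Implicit Defensive.

Import GRing.Theory Num.Theory.

Local Open Scope ring_scope.

(** * The Iwahori-Hecke algebra and its Specht modules *)

(** The Specht modules are only given as right ideals z_lam H, so their properties are read off
    models. For the given r, each of the four modules occurs in the Lawrence-Krammer space for some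
    t of its own, in general not the t under study; whether given generators have a common
    eigenvector for -1/r in S^lam is decided there and carried over by the isomorphism.

    The rows come from the terms in w_{i,i+1} of the formulas for nu_i: up to a change of the
    diagonal coefficient from t/r^3 to t/r, these terms add up to a multiple of R_{i+1}. Where the
    rows vanish, nu_i therefore acts on coordinates by a symmetric matrix; this is the source of the
    self-adjointness on K.

    The exceptional pair (t, q) comes from a linear dependence: for t = -1 one has sum_j r^{2j} R_j
    = 0 on all of V, while vanishing defects give R_j = r^{2j} R_0. Hence (sum_j r^{4j}) R_0 = 0 on
    a proper invariant subspace, and as r^4 and r^{2n} differ from 1 this factor is 0 exactly when
    r^{2n} = -1. *)

(* lia slows down badly on contexts which contain many field identities. *)
Ltac nat_lia := repeat match goal with H : ?T |- _ =>
    lazymatch T with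
    | is_true (leq _ _) => fail
    | is_true (andb (leq _ _) _) => fail
    | is_true (negb (leq _ _)) => fail
    | is_true (@eq_op ?A _ _) => tryif unify (Equality.sort A) nat then fail else clear H
    | is_true (negb (@eq_op ?A _ _)) => tryif unify (Equality.sort A) nat then fail else clear H
    | @eq ?A _ _ => tryif unify A nat then fail else (tryif unify A bool then fail else clear H)
    | ~ (@eq ?A _ _) => tryif unify A nat then fail else clear H
    | nat => fail
    | ordinal _ => fail
    | _ => clear H
    end end; lia.

(** * Lengths and descents of permutations *)

Section Descents.
Variable n : nat.
Implicit Types (w : 'S_n) (i j : 'I_n.-1).

Let lo i : 'I_n := Ordinal (strand_lt i).
Let hi i : 'I_n := Ordinal (strandS_lt i).

(** The position of the value k, total on [nat] so that i, i.+1 and i.+2 need no bounds. With the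
    value n outside the range, [inv_at_mulr] holds for every k. *)
Definition inv_at w k : nat := if insub k is Some a then val ((w^-1)%g a) else n.

Definition descent w i : bool := (inv_at w i.+1 < inv_at w i)%N.

Lemma inv_atE w (a : 'I_n) : inv_at w a = (w^-1)%g a.
Proof. by rewrite /inv_at valK. Qed.

Lemma inv_at_lo w i : inv_at w i = (w^-1)%g (lo i).
Proof. by rewrite -inv_atE. Qed.

Lemma inv_at_hi w i : inv_at w i.+1 = (w^-1)%g (hi i).
Proof. by rewrite -inv_atE. Qed.

Lemma inv_at_perm w (a : 'I_n) : inv_at w (w a) = a.
Proof. by rewrite inv_atE permK. Qed.

Lemma inv_at_inj w a b : (a < n)%N -> (b < n)%N -> inv_at w a = inv_at w b -> a = b.
Proof.
move=> an bn; rewrite -[a]/(val (Ordinal an)) -[b]/(val (Ordinal bn)) !inv_atE.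
by move/val_inj/perm_inj=> ->.
Qed.

Lemma simple_refl_val i (a : 'I_n) :
  simple_refl i a = (if a == i :> nat then i.+1 else if a == i.+1 :> nat then nat_of_ord i else a) :> nat.
Proof.
rewrite /simple_refl; case: tpermP => [->|->|] /=.
- by rewrite eqxx.
- by rewrite eqxx; case: eqP => //; lia.
move=> /eqP; rewrite -val_eqE /= => /negPf-> /eqP; rewrite -val_eqE /=.
by move=> /negPf->.
Qed.

Lemma simple_reflK i : (simple_refl i * simple_refl i = 1)%g.
Proof. by rewrite /simple_refl tperm2. Qed.

Lemma mul_simple_reflK w i : (w * simple_refl i * simple_refl i = w)%g.
Proof. by rewrite -mulgA simple_reflK mulg1. Qed.

Lemma simple_reflV i : ((simple_refl i)^-1 = simple_refl i)%g.
Proof. exact: tpermV. Qed.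

Lemma simple_refl_commute i j : (i.+1 < j)%N ->
  (simple_refl i * simple_refl j = simple_refl j * simple_refl i)%g.
Proof.
move=> ij; apply/permP => a; apply: val_inj; rewrite !permM /= !simple_refl_val.
by do !case: eqP => //; lia.
Qed.

Lemma simple_refl_braid i j : j = i.+1 :> nat ->
  (simple_refl i * simple_refl j * simple_refl i =
   simple_refl j * simple_refl i * simple_refl j)%g.
Proof.
move=> ij; apply/permP => a; apply: val_inj; rewrite !permM /= !simple_refl_val ij.
by do !case: eqP => //; lia.
Qed.

Lemma inv_at_mulr w i (k : nat) :
  inv_at (w * simple_refl i)%g k =
  inv_at w (if k == i then i.+1 else if k == i.+1 then nat_of_ord i else k).
Proof.
have [kn|nk] := ltnP k n; last first.
  have := strandS_lt i => i1; rewrite !ifN_eq; try lia.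
  by rewrite /inv_at insubF //; apply/negbTE; rewrite -leqNgt.
rewrite -[in LHS](_ : val (Ordinal kn) = k) // inv_atE invMg simple_reflV permM.
by rewrite -inv_atE simple_refl_val.
Qed.

Lemma inv_at_mulr_lo w i : inv_at (w * simple_refl i)%g i = inv_at w i.+1.
Proof. by rewrite inv_at_mulr eqxx. Qed.

Lemma inv_at_mulr_hi w i : inv_at (w * simple_refl i)%g i.+1 = inv_at w i.
Proof. by rewrite inv_at_mulr eqxx; case: eqP => //; lia. Qed.

Lemma inv_at_mulr_out w i (k : nat) : k != i -> k != i.+1 ->
  inv_at (w * simple_refl i)%g k = inv_at w k.
Proof. by move=> /negPf h1 /negPf h2; rewrite inv_at_mulr h1 h2. Qed.

Lemma inv_at_mull w i k : (k < n)%N ->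
  inv_at (simple_refl i * w)%g k =
  (if inv_at w k == i then i.+1 else if inv_at w k == i.+1 then nat_of_ord i else inv_at w k).
Proof.
move=> kn; rewrite -[in LHS](_ : val (Ordinal kn) = k) // inv_atE invMg simple_reflV permM.
by rewrite simple_refl_val -inv_atE.
Qed.

Lemma inv_atV w (a : 'I_n) : inv_at (w^-1)%g a = w a.
Proof. by rewrite inv_atE invgK. Qed.

Lemma descent_mulr w i : descent (w * simple_refl i)%g i = ~~ descent w i.
Proof.
have := strandS_lt i; have := strand_lt i => h1 h2.
rewrite /descent inv_at_mulr_lo inv_at_mulr_hi.
have : inv_at w i <> inv_at w i.+1 by move/inv_at_inj => /(_ h1 h2); lia.
by lia.
Qed.

Lemma simple_refl_ltn i (a b : 'I_n) :
  (simple_refl i a < simple_refl i b)%N =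
  if (a == i :> nat) && (b == i.+1 :> nat) then false
  else if (a == i.+1 :> nat) && (b == i :> nat) then true else (a < b)%N.
Proof. by rewrite !simple_refl_val; do !case: eqP => //=; lia. Qed.

(** Composing with s_i exchanges the adjacent values i and i + 1, so the only pair whose order
    changes is the pair [e] of their positions. *)
Lemma perm_len_mulr w i :
  ~~ descent w i -> perm_len (w * simple_refl i)%g = (perm_len w).+1.
Proof.
rewrite /descent inv_at_lo inv_at_hi -leqNgt => dw.
rewrite /perm_len.
set X := [set p | _ & (w p.2 < w p.1)%N].
pose e := ((w^-1)%g (lo i), (w^-1)%g (hi i)).
have eX : e \notin X by rewrite inE /= !permKV /=; lia.
have -> : #|X|.+1 = #|e |: X| by rewrite cardsU1 eX.
apply: eq_card => -[a b].
rewrite !inE /= !permM simple_refl_ltn.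
have -> : ((a, b) == e) = (w a == i :> nat) && (w b == i.+1 :> nat).
  apply/eqP/andP => [[-> ->]|[/eqP wa /eqP wb]]; first by rewrite !permKV /=.
  by congr pair; apply: (@perm_inj _ w); rewrite permKV; apply: val_inj.
case: (boolP ((w b == i :> nat) && (w a == i.+1 :> nat))).
  move=> /andP[/eqP wb /eqP wa].
  have -> : a = (w^-1)%g (hi i) by apply: (@perm_inj _ w); rewrite permKV; apply: val_inj.
  have -> : b = (w^-1)%g (lo i) by apply: (@perm_inj _ w); rewrite permKV; apply: val_inj.
  by rewrite !permKV /=; lia.
move=> _.
case: (boolP ((w b == i.+1 :> nat) && (w a == i :> nat))).
  move=> /andP[/eqP wb /eqP wa].
  have -> : a = (w^-1)%g (lo i) by apply: (@perm_inj _ w); rewrite permKV; apply: val_inj.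
  have -> : b = (w^-1)%g (hi i) by apply: (@perm_inj _ w); rewrite permKV; apply: val_inj.
  rewrite !permKV /= !eqxx /= andbT.
  have : (w^-1)%g (lo i) != (w^-1)%g (hi i).
    by rewrite (inj_eq perm_inj) -val_eqE /=; lia.
  by rewrite -val_eqE /=; lia.
by rewrite andbC => /negPf->.
Qed.

Lemma perm_len_descent w i :
  descent w i -> perm_len w = (perm_len (w * simple_refl i)%g).+1.
Proof. by move=> dw; rewrite -(@perm_len_mulr _ i) ?mul_simple_reflK // descent_mulr dw. Qed.

Lemma perm_len_lt w i : (perm_len (w * simple_refl i)%g < perm_len w)%N = descent w i.
Proof.
by have [/perm_len_descent->|/perm_len_mulr->] := boolP (descent w i); lia.
Qed.

Lemma perm_len_gt w i : (perm_len w < perm_len (w * simple_refl i)%g)%N = ~~ descent w i.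
Proof.
by have [/perm_len_descent->|/perm_len_mulr->] := boolP (descent w i); lia.
Qed.

Lemma perm_lenV w : perm_len (w^-1)%g = perm_len w.
Proof.
pose g (p : 'I_n * 'I_n) := (w p.2, w p.1).
have gi : injective g by move=> [a b] [c d] [/perm_inj-> /perm_inj->].
rewrite /perm_len -[RHS](card_imset _ gi); apply: eq_card => -[a b].
rewrite inE /=; apply/andP/imsetP => [[ab wab]|[[c d]]].
  by exists ((w^-1)%g b, (w^-1)%g a); rewrite ?inE /g /= ?permKV ?wab.
by rewrite inE /= => /andP[cd wcd] [-> ->]; rewrite !permK.
Qed.

Lemma no_descent1 w : (forall i, ~~ descent w i) -> w = 1%g.
Proof.
move=> nd; have hom k : (k < n)%N -> (k <= inv_at w k)%N.
  elim: k => // k IH kn; have kn' : (k < n.-1)%N by lia.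
  have := nd (Ordinal kn'); rewrite /descent /= -leqNgt => h.
  have := IH (ltnW kn) => h1.
  have : inv_at w k <> inv_at w k.+1 by move/inv_at_inj => /(_ (ltnW kn) kn); lia.
  by lia.
have hom2 k (j : nat) : (j + k < n)%N -> (inv_at w j + k <= inv_at w (j + k))%N.
  elim: k => [|k IH] jkn; first by rewrite !addn0.
  have jk : (j + k < n.-1)%N by lia.
  have := nd (Ordinal jk); rewrite /descent /= -leqNgt => h.
  have h0 : (j + k < n)%N by lia.
  have h2 : ((j + k).+1 < n)%N by lia.
  have : inv_at w (j + k) <> inv_at w (j + k).+1 by move/inv_at_inj => /(_ h0 h2); lia.
  by have := IH h0; rewrite !addnS; lia.
apply: invg_inj; rewrite invg1; apply/permP => a; apply: val_inj; rewrite perm1 /= -inv_atE.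
have an := ltn_ord a; have := hom _ an.
have e : (a + (n.-1 - a) = n.-1)%N by lia.
have n1 : (n.-1 < n)%N by lia.
have := hom2 (n.-1 - a)%N a; rewrite e => /(_ n1).
have : (inv_at w n.-1 < n)%N by rewrite -[X in inv_at _ X](_ : val (Ordinal n1) = _) // inv_atE.
by rewrite /=; lia.
Qed.

Lemma perm_len1 : perm_len (1%g : 'S_n) = 0%N.
Proof.
apply: eq_card0 => -[a b]; rewrite !inE /= !perm1; apply/negbTE; lia.
Qed.

Lemma descentV w i : descent (w^-1)%g i = (w (hi i) < w (lo i))%N.
Proof. by rewrite /descent inv_at_hi inv_at_lo !invgK. Qed.

Lemma mull_simple w i : (simple_refl i * w = (w^-1 * simple_refl i)^-1)%g.
Proof. by rewrite invMg simple_reflV invgK. Qed.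

Lemma perm_len_mull w i :
  ~~ descent (w^-1)%g i -> perm_len (simple_refl i * w)%g = (perm_len w).+1.
Proof. by move=> /perm_len_mulr h; rewrite mull_simple perm_lenV h perm_lenV. Qed.

(** Left multiplication by s_j exchanges the adjacent positions j and j + 1. This reverses the order
    of the positions of i and i + 1 only if they are these very two, that is if s_j w = w s_i. *)
Lemma descent_mull w i j : (simple_refl j * w != w * simple_refl i)%g ->
  descent (simple_refl j * w)%g i = descent w i.
Proof.
move=> ne; have i1 := strand_lt i; have i2 := strandS_lt i.
have [nc1 nc2] : (inv_at w i = j -> inv_at w i.+1 = j.+1 -> False) *
             (inv_at w i = j.+1 -> inv_at w i.+1 = j -> False).
  split=> h1 h2; apply/negP: ne; rewrite negbK; apply/eqP;
  apply: invg_inj; rewrite !invMg !simple_reflV; apply/permP => a;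
  apply: val_inj; rewrite !permM /= simple_refl_val -!inv_atE !simple_refl_val;
  have := @inv_at_inj w i a i1 (ltn_ord a);
  have := @inv_at_inj w i.+1 a i2 (ltn_ord a);
  rewrite h1 h2 => e1 e2.
  - have [ai|ai] := eqVneq (nat_of_ord a) i; first by rewrite ai h1 eqxx.
    have [ai1|ai1] := eqVneq (nat_of_ord a) i.+1.
      by rewrite ai1 h2 eqxx; case: eqP => //; lia.
    rewrite ifN_eq; last by apply/eqP => h; have := e2 (esym h); lia.
    by rewrite ifN_eq //; apply/eqP => h; have := e1 (esym h); lia.
  - have [ai|ai] := eqVneq (nat_of_ord a) i.
      by rewrite ai h1 eqxx h2; case: eqP => //; lia.
    have [ai1|ai1] := eqVneq (nat_of_ord a) i.+1.
      by rewrite ai1 h2 eqxx h1.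
    rewrite ifN_eq; last by apply/eqP => h; have := e1 (esym h); lia.
    by rewrite ifN_eq //; apply/eqP => h; have := e2 (esym h); lia.
have := @inv_at_inj w i i.+1 i1 i2.
by rewrite /descent !inv_at_mull //; do !case: eqP; lia.
Qed.

End Descents.

(** * The operators g_w on a Hecke module *)

Section HeckeOperators.
Variables (F : fieldType) (n : nat) (r : F) (V : vectType F).
Variables (rho : 'I_n.-1 -> 'End(V)) (U : {vspace V}).
Implicit Types (w : 'S_n) (i j : 'I_n.-1) (u : V).

(** Makes the same choice of reduced word as [hecke_rmul_word]. The last letter acts last, so this
    is a right action. *)
Fixpoint hecke_op_rec k w : 'End(V) :=
  if k is k'.+1 then
    if [pick i | (perm_len (w * simple_refl i)%g < perm_len w)%N] is Some i
    then (rho i \o hecke_op_rec k' (w * simple_refl i)%g)%VF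
    else \1%VF
  else \1%VF.

Definition hecke_op w := hecke_op_rec (perm_len w) w.

Lemma hecke_op1 u : hecke_op 1%g u = u.
Proof. by rewrite /hecke_op perm_len1 /= lfunE. Qed.

Hypothesis modU : hecke_module r rho U.

Let m : F := r^-1 - r.

Lemma hecke_rho_mem i u : u \in U -> rho i u \in U.
Proof. by case: modU => inv _ _ _ uU; apply: (subvP (inv i)); apply: memv_img. Qed.

Lemma hecke_op_mem w u : u \in U -> hecke_op w u \in U.
Proof.
move=> uU; rewrite /hecke_op; move: (perm_len w) => k.
elim: k w => [|k IH] w /=; first by rewrite lfunE.
by case: pickP => [i _|_]; rewrite lfunE //= hecke_rho_mem.
Qed.

(** Matsumoto's theorem: the operator does not depend on the descent that [pick] chooses. For two
    descents a < b, induction on the length lets both words start from w times the longest element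
    of the subgroup generated by s_a and s_b; a braid or commutation relation compares the
    endings. *)
Lemma hecke_op_descent w i u : u \in U -> descent w i ->
  hecke_op w u = rho i (hecke_op (w * simple_refl i)%g u).
Proof.
case: modU => inv _ braid comm uU.
have [k] := ubnP (perm_len w); elim: k w i => // k IH w i wk di.
suff main a b : descent w a -> descent w b -> (a <= b)%N ->
    rho a (hecke_op (w * simple_refl a)%g u) = rho b (hecke_op (w * simple_refl b)%g u).
  have [j dj ->] : exists2 j, descent w j & hecke_op w u = rho j (hecke_op (w * simple_refl j)%g u).
    rewrite {1}/hecke_op (perm_len_descent di) /=.
    case: pickP => [j|/(_ i)]; last by rewrite perm_len_lt di.
    rewrite perm_len_lt => dj; exists j => //; rewrite lfunE /= /hecke_op.
    by have := perm_len_descent dj; rewrite (perm_len_descent di) => -[->].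
  by have [?|?] := leqP i j; [apply/esym/main | apply: main => //; apply: ltnW].
move=> da db; have := strand_lt a; have := strandS_lt a; have := strand_lt b; have := strandS_lt b.
move=> b1 b2 a1 a2.
have la := perm_len_descent da; have lb := perm_len_descent db.
rewrite leq_eqVlt => /orP[/eqP/val_inj-> //|].
rewrite leq_eqVlt => /orP[/eqP ab|ab].
  have bE : nat_of_ord b = a.+1 by lia.
  have loB v : inv_at (v * simple_refl b)%g a.+1 = inv_at v a.+2.
    by have := inv_at_mulr_lo v b; rewrite bE.
  have hiB v : inv_at (v * simple_refl b)%g a.+2 = inv_at v a.+1.
    by have := inv_at_mulr_hi v b; rewrite bE.
  have outB v : inv_at (v * simple_refl b)%g a = inv_at v a.
    by rewrite inv_at_mulr_out ?bE //; lia.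
  have outA v : inv_at (v * simple_refl a)%g a.+2 = inv_at v a.+2.
    by rewrite inv_at_mulr_out //; lia.
  have E := (loB, hiB, outB, outA, inv_at_mulr_lo, inv_at_mulr_hi).
  have d1 : descent (w * simple_refl a)%g b.
    by move: da db; rewrite /descent bE !E; lia.
  have d2 : descent (w * simple_refl b)%g a.
    by move: da db; rewrite /descent bE !E; lia.
  have d3 : descent (w * simple_refl a * simple_refl b)%g a.
    by move: da db; rewrite /descent bE !E; lia.
  have d4 : descent (w * simple_refl b * simple_refl a)%g b.
    by move: da db; rewrite /descent bE !E; lia.
  have l1 := perm_len_descent d1; have l2 := perm_len_descent d2.
  rewrite (IH _ _ _ d1) ?(IH _ _ _ d3) ?(IH _ _ _ d2) ?(IH _ _ _ d4); try lia.
  have e : (w * simple_refl a * simple_refl b * simple_refl a =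
     w * simple_refl b * simple_refl a * simple_refl b)%g.
    by rewrite -!mulgA; congr mulg; rewrite !mulgA; apply: simple_refl_braid.
  by rewrite e braid ?hecke_op_mem.
have E1 v : inv_at (v * simple_refl b)%g a = inv_at v a by rewrite inv_at_mulr_out; lia.
have E2 v : inv_at (v * simple_refl b)%g a.+1 = inv_at v a.+1 by rewrite inv_at_mulr_out; lia.
have E3 v : inv_at (v * simple_refl a)%g b = inv_at v b by rewrite inv_at_mulr_out; lia.
have E4 v : inv_at (v * simple_refl a)%g b.+1 = inv_at v b.+1 by rewrite inv_at_mulr_out; lia.
have d1 : descent (w * simple_refl a)%g b by rewrite /descent E3 E4.
have d2 : descent (w * simple_refl b)%g a by rewrite /descent E1 E2.
rewrite (IH _ _ _ d1) ?(IH _ _ _ d2); try lia.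
by rewrite comm ?hecke_op_mem // -!mulgA (simple_refl_commute ab).
Qed.

Lemma hecke_op_mulr w i u : u \in U ->
  rho i (hecke_op w u) =
  if descent w i then hecke_op (w * simple_refl i)%g u - m *: hecke_op w u
  else hecke_op (w * simple_refl i)%g u.
Proof.
move=> uU; case: ifPn => dw.
  rewrite (hecke_op_descent uU dw); set x := hecke_op _ u.
  have xU : x \in U by apply: hecke_op_mem.
  by case: modU => _ quad _ _; apply: (canRL (addrK _)); apply: quad.
rewrite [RHS](@hecke_op_descent _ i) ?descent_mulr //.
by rewrite mul_simple_reflK.
Qed.

(** The recursion strips letters at the other end. A last letter s_j of w = v s_j is removed from
    both sides; counting lengths shows that s_i still lengthens v on the left and that s_j lengthens
    s_i v on the right. *)
Lemma hecke_op_mull w i u : u \in U -> ~~ descent (w^-1)%g i ->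
  hecke_op (simple_refl i * w)%g u = hecke_op w (rho i u).
Proof.
move=> uU; have [k] := ubnP (perm_len w); elim: k w => // k IH w wk dw.
have [j dj|nd] := pickP (descent w).
  have [v wv lv] : exists2 v : 'S_n, w = (v * simple_refl j)%g & perm_len w = (perm_len v).+1.
    by exists (w * simple_refl j)%g; [rewrite mul_simple_reflK | apply: perm_len_descent].
  have lw := perm_len_mull dw.
  have dv : ~~ descent (v^-1)%g i.
    apply/negP => h; have := perm_len_descent h.
    rewrite perm_lenV -(perm_lenV (_ * _)) -mull_simple => h1.
    have := perm_len_mulr (w := (simple_refl i * v)%g) (i := j).
    have := perm_len_descent (w := (simple_refl i * v)%g) (i := j).
    rewrite -mulgA -wv.
    case: descent => [/(_ isT) h2 _|_ /(_ isT) h2].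
      by move: h1; rewrite h2 lw lv; move: (perm_len v) => x; lia.
    by move: lw; rewrite h2 lv h1; move: (perm_len _) => x; lia.
  have dsv : ~~ descent (simple_refl i * v)%g j.
    apply/negP => h; have := perm_len_descent h.
    by rewrite -mulgA -wv lw (perm_len_mull dv); lia.
  rewrite {1}wv mulgA -[LHS](_ : rho j (hecke_op (simple_refl i * v)%g u) = _); last first.
    by rewrite hecke_op_mulr // (negPf dsv).
  rewrite IH //; last by lia.
  by rewrite (hecke_op_descent (hecke_rho_mem i uU) dj) wv mul_simple_reflK.
have -> : w = 1%g by apply: no_descent1 => i'; rewrite nd.
rewrite mulg1 hecke_op1 -{2}[u]hecke_op1 hecke_op_mulr //.
rewrite ifN ?mul1g //; move: dw; suff -> : w = 1%g by rewrite invg1.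
by apply: no_descent1 => i'; rewrite nd.
Qed.

End HeckeOperators.

(** * The regular module in coordinates *)

Section HeckeAlgebra.
Variables (F : fieldType) (n : nat) (r : F).
Hypothesis r0 : r != 0.
Implicit Types (w : 'S_n) (i j : 'I_n.-1).

Let m : F := r^-1 - r.

Local Notation H := {ffun 'S_n -> F^o}.
Local Notation R := (hecke_rmul (F := F) (n := n) r).
Implicit Type h : H.

(** In this form the Hecke relations become pointwise identities between values of h on a coset. *)
Lemma hecke_rmulE i h w :
  R i h w = h (w * simple_refl i)%g - m * (descent w i)%:R * h w.
Proof.
rewrite lfunE /= /hecke_rmul_fun sum_ffunE (bigD1 (w * simple_refl i)%g) //=.
have nws : w != (w * simple_refl i)%g.
  by apply/eqP => e; have := descent_mulr w i; rewrite -e; case: descent.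
rewrite (bigD1 w) //= big1 ?addr0; last first.
  move=> v /andP[vws vw]; rewrite ffunE /hecke_rmul_g.
  have e1 : (w == v * simple_refl i)%g = false.
    by apply/negbTE; apply: contraNneq vws => ->; rewrite mul_simple_reflK.
  have e2 : (w == v) = false by rewrite eq_sym (negPf vw).
  by case: ifP => _; rewrite !ffunE e1 ?e2 /GRing.scale /=; ring.
rewrite !ffunE /hecke_rmul_g !perm_len_gt descent_mulr mul_simple_reflK negbK.
by case: (descent w i) => /=; rewrite !ffunE ?eqxx /= ?(negPf nws) /=
  /GRing.scale /= /m; ring.
Qed.

Lemma hecke_rmul_module : hecke_module r R fullv.
Proof.
split=> [i|i h _|i j h ij _|i j h ij _]; first exact: subvf.
- apply/ffunP => w; rewrite !ffunE !hecke_rmulE mul_simple_reflK descent_mulr.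
  by case: descent => /=; rewrite /GRing.scale /= /m; field.
- apply/ffunP => w; rewrite !hecke_rmulE.
  have e1 := mul_simple_reflK; rewrite !e1.
  rewrite -[(w * simple_refl j * simple_refl i * simple_refl j)%g]mulgA.
  have -> : (w * simple_refl j * (simple_refl i * simple_refl j) =
     w * simple_refl i * simple_refl j * simple_refl i)%g.
    by rewrite -!mulgA; congr mulg; rewrite !mulgA -simple_refl_braid.
  have b1 := strand_lt i; have b2 := strandS_lt i; have b3 := strandS_lt j.
  (* All coefficients depend only on the relative order of the three positions x, y, z, which leaves
     six cases. *)
  have [x Hx] : exists x, x = inv_at w i by eexists.
  have [y Hy] : exists y, y = inv_at w i.+1 by eexists.
  have [z Hz] : exists z, z = inv_at w i.+2 by eexists.
  have [xy yz xz] : [/\ x <> y, y <> z & x <> z].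
    by rewrite Hx Hy Hz; split=> /inv_at_inj H; (have : _ = _ := H _ _); lia.
  have loB v : inv_at (v * simple_refl j)%g i.+1 = inv_at v i.+2.
    by have := inv_at_mulr_lo v j; rewrite ij.
  have hiB v : inv_at (v * simple_refl j)%g i.+2 = inv_at v i.+1.
    by have := inv_at_mulr_hi v j; rewrite ij.
  have outB v : inv_at (v * simple_refl j)%g i = inv_at v i.
    by rewrite inv_at_mulr_out ?ij //; lia.
  have outA v : inv_at (v * simple_refl i)%g i.+2 = inv_at v i.+2.
    by rewrite inv_at_mulr_out //; lia.
  have E := (loB, hiB, outB, outA, inv_at_mulr_lo, inv_at_mulr_hi).
  rewrite /descent ij !E.
  rewrite -Hx -Hy -Hz.
  case: (ltngtP x y) xy => // xy _; case: (ltngtP y z) yz => // yz _;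
  case: (ltngtP x z) xz => // xz _; try lia;
  rewrite /=; ring.
- apply/ffunP => w; rewrite !hecke_rmulE.
  rewrite -!mulgA -(simple_refl_commute ij) !mulgA.
  have b1 := strand_lt i; have b2 := strandS_lt i; have b3 := strandS_lt j.
  have b4 := strand_lt j.
  have E1 v : inv_at (v * simple_refl j)%g i = inv_at v i by rewrite inv_at_mulr_out; lia.
  have E2 v : inv_at (v * simple_refl j)%g i.+1 = inv_at v i.+1 by rewrite inv_at_mulr_out; lia.
  have E3 v : inv_at (v * simple_refl i)%g j = inv_at v j by rewrite inv_at_mulr_out; lia.
  have E4 v : inv_at (v * simple_refl i)%g j.+1 = inv_at v j.+1 by rewrite inv_at_mulr_out; lia.
  rewrite /descent !E1 !E2 !E3 !E4.
  ring.
Qed.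

Lemma hecke_rmul_wordE k w h : hecke_rmul_word r k w h = hecke_op_rec R k w h.
Proof.
elim: k w h => [|k IH] w h /=; first by rewrite id_lfunE.
by case: pickP => [i _|_]; rewrite ?id_lfunE // comp_lfunE IH.
Qed.

Lemma hecke_mulE h h' : hecke_mul r h h' = \sum_w h' w *: hecke_op R w h.
Proof.
by rewrite /hecke_mul; apply: eq_bigr => w _; rewrite hecke_rmul_wordE.
Qed.

Lemma hecke_mul_g h w : hecke_mul r h (hecke_g F w) = hecke_op R w h.
Proof.
rewrite hecke_mulE (bigD1 w) //= big1 ?addr0 ?ffunE ?eqxx ?scale1r // => v vw.
by rewrite ffunE (negPf vw) scale0r.
Qed.

End HeckeAlgebra.

Section RowIncreasing.
Variables (n : nat) (row f : nat -> nat).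
Hypothesis row_homo : {homo row : a b / (a <= b)%N}.
Hypothesis f_incr : forall k, (k.+1 < n)%N -> row k = row k.+1 -> (f k < f k.+1)%N.

Lemma row_increasing a b : (a < b < n)%N -> row a = row b -> (f a < f b)%N.
Proof.
move=> /andP[ab bn] rab; have [d eb] : exists d, b = (a + d).+1 by exists (b - a.+1)%N; lia.
elim: d b ab bn rab eb => [|d IH] b ab bn rab eb.
  by move: rab bn; rewrite eb addn0 => rab bn; apply: f_incr.
have eb' : b = (a + d).+2 by lia.
have h1 : (row a <= row (a + d).+1)%N by apply: row_homo; lia.
have h2 : (row (a + d).+1 <= row b)%N by apply: row_homo; lia.
have : (f a < f (a + d).+1)%N by apply: (IH _ _ _ _ (erefl _)); lia.
have : (f (a + d).+1 < f (a + d).+2)%N by apply: f_incr; rewrite -?eb' //; lia.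
by rewrite eb'; lia.
Qed.

End RowIncreasing.

(** * Elements symmetric on the left and alternating on the right *)

Section Sandwich.
Variables (F : fieldType) (n : nat) (r : F).
Hypothesis r0 : r != 0.
Implicit Types (w : 'S_n) (i j : 'I_n.-1).

Let m : F := r^-1 - r.

Local Notation H := {ffun 'S_n -> F^o}.
Local Notation R := (hecke_rmul (F := F) (n := n) r).
Local Notation T w := (hecke_op R w).
Implicit Type h : H.

(** The coefficients of g_i h = r h, for i and i + 1 in one row; written this way it takes no
    operators of left multiplication. *)
Definition left_symmetric (row : nat -> nat) h :=
  forall i w, row i = row i.+1 -> ~~ descent (w^-1)%g i ->
    h (simple_refl i * w)%g = r * h w.

Definition right_alternating (col : nat -> nat) h :=
  forall i w, col i = col i.+1 -> ~~ descent w i ->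
    h (w * simple_refl i)%g = - r^-1 * h w.

(** Left and right multiplication commute. In coordinates they interact only if s_j w = w s_i, and
    then w goes up on both sides. *)
Lemma left_symmetric_rmul row h i : left_symmetric row h -> left_symmetric row (R i h).
Proof.
move=> sh j w rj dj; rewrite !hecke_rmulE.
have [e|ne] := eqVneq (simple_refl j * w)%g (w * simple_refl i)%g.
  have di : ~~ descent w i by rewrite -perm_len_gt -e perm_len_mull.
  rewrite -e -mulgA -e mulgA simple_reflK mul1g e descent_mulr di (negPf di) -e sh //= /m.
  by field.
rewrite descent_mull // -mulgA !sh // ?mulrBr; first by ring.
by rewrite invMg simple_reflV descent_mull //; apply: contra_neq ne => e;
  apply: invg_inj; rewrite !invMg !simple_reflV -e.
Qed.

Lemma left_symmetric_op row h w : left_symmetric row h -> left_symmetric row (T w h).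
Proof.
move=> sh; rewrite /hecke_op; move: (perm_len w) => k.
elim: k w => [|k IH] w /=; first by rewrite id_lfunE.
by case: pickP => [i _|_]; rewrite ?id_lfunE ?comp_lfunE //; apply: left_symmetric_rmul.
Qed.

Lemma left_symmetric_sum row (I : finType) (c : I -> F) (g : I -> H) :
  (forall a, left_symmetric row (g a)) -> left_symmetric row (\sum_a c a *: g a).
Proof.
move=> sg i w ri di; rewrite !sum_ffunE mulr_sumr; apply: eq_bigr => a _.
by rewrite !ffunE sg //= /GRing.scale /=; ring.
Qed.

Lemma left_symmetric_mul row h h' : left_symmetric row h -> left_symmetric row (hecke_mul r h h').
Proof.
by move=> sh; rewrite hecke_mulE; apply: left_symmetric_sum => w; apply: left_symmetric_op.
Qed.

(** Associativity (h h') g_i = h (h' g_i), which passes right alternation from y to z. *)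
Lemma rmul_hecke_mul i h h' : R i (hecke_mul r h h') = hecke_mul r h (R i h').
Proof.
rewrite !hecke_mulE linear_sum /=.
under eq_bigr do rewrite linearZ /= (hecke_op_mulr (hecke_rmul_module n r0)) ?memvf //.
transitivity (\sum_w (h' w *: T (w * simple_refl i)%g h -
                      (m * (descent w i)%:R * h' w) *: T w h)).
  apply: eq_bigr => w _; case: ifP => _; rewrite ?mulr1 ?mulr0 ?mul0r ?scale0r ?subr0 //.
  by rewrite scalerBr scalerA [h' w * _]mulrC.
rewrite sumrB (reindex_inj (mulIg (simple_refl i))) -sumrB /=.
by apply: eq_bigr => w _; rewrite hecke_rmulE mul_simple_reflK scalerBl.
Qed.

Lemma right_alternatingP col h :
  right_alternating col h <->
  (forall i, col i = col i.+1 -> R i h = - r^-1 *: h).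
Proof.
split=> [ah i ci|ah i w ci di].
  apply/ffunP => w; rewrite hecke_rmulE !ffunE.
  have [di|di] := boolP (descent w i); last by rewrite ah //= mulr0 mul0r subr0.
  have := ah i (w * simple_refl i)%g ci; rewrite descent_mulr di mul_simple_reflK.
  by move=> /(_ isT)->; rewrite /m /GRing.scale /=; field.
have := congr1 (fun h : H => h w) (ah i ci); rewrite /= hecke_rmulE !ffunE (negPf di) /=.
by rewrite mulr0 mul0r subr0.
Qed.

End Sandwich.

(** * Permutations transverse to rows and columns *)

Section Shapes.
Variables (n : nat) (row col : nat -> nat).
Implicit Types (w : 'S_n) (i j : 'I_n.-1).

(* For the row and column indices of lam, the shortest element of the double
   coset which carries z_lam; it is the only one satisfying these conditions. *)
Definition transverse w :=
  [/\ forall i, row i = row i.+1 -> ~~ descent (w^-1)%g i,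
      forall i, col i = col i.+1 -> ~~ descent w i
    & forall a b : 'I_n, row a = row b -> col (w a) = col (w b) -> a = b].

Lemma inv_lt w i : ~~ descent w i -> (inv_at w i < inv_at w i.+1)%N.
Proof.
have := @inv_at_inj n w i i.+1 (strand_lt i) (strandS_lt i).
by rewrite /descent; lia.
Qed.

Hypothesis row_homo : {homo row : a b / (a <= b)%N}.
Hypothesis col_homo : {homo col : a b / (a <= b)%N}.

Lemma row_mono w : (forall i, row i = row i.+1 -> ~~ descent (w^-1)%g i) ->
  forall a b : 'I_n, (a < b)%N -> row a = row b -> (w a < w b)%N.
Proof.
move=> hw a b ab rab; rewrite -!inv_atV.
apply: (@row_increasing n row (inv_at (w^-1)%g)) => //; last by rewrite ab /=.
move=> k kn rk; have kn' : (k < n.-1)%N by lia.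
by have := inv_lt (hw (Ordinal kn') rk).
Qed.

Lemma col_mono w : (forall i, col i = col i.+1 -> ~~ descent w i) ->
  forall a b, (a < b < n)%N -> col a = col b -> (inv_at w a < inv_at w b)%N.
Proof.
move=> hw a b ab cab; apply: (@row_increasing n col (inv_at w)) => // k kn rk.
have kn' : (k < n.-1)%N by lia.
by have := inv_lt (hw (Ordinal kn') rk).
Qed.

(** If a < b share a row while w a and w b share a column, monotonicity yields adjacent entries: a
    and a + 1 share a row and go to adjacent values in one column, so s_a w = w s_{w a}. The third
    condition is thus only to be tested on simple reflections. *)
Lemma transverse_adj w :
  (forall i, row i = row i.+1 -> ~~ descent (w^-1)%g i) ->
  (forall i, col i = col i.+1 -> ~~ descent w i) ->
  (forall i j, row i = row i.+1 -> col j = col j.+1 ->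
     (simple_refl i * w != w * simple_refl j)%g) ->
  transverse w.
Proof.
move=> rw cw sw; split=> //.
suff main (a b : 'I_n) : (a < b)%N -> row a = row b -> col (w a) <> col (w b).
  move=> a b rab cab; apply: val_inj; case: (ltngtP a b) => // [/main|/main]; first by move/(_ rab).
  by move/(_ (esym rab)); rewrite cab.
move=> ab rab cab.
have an : (a < n.-1)%N by have := ltn_ord b; lia.
have a1n : (a.+1 < n)%N by lia.
pose a1 := Ordinal a1n.
have ra : row a = row a.+1.
  have h1 : (row a <= row a.+1)%N by apply: row_homo.
  have h2 : (row a.+1 <= row b)%N by apply: row_homo.
  by lia.
have wa : (w a < w a1)%N by apply: row_mono.
have wb : (w a1 <= w b)%N.
  have [e|ne] := eqVneq a1 b; first by rewrite e.
  by apply/ltnW/row_mono; rewrite -?ra //=; move: ne; rewrite -val_eqE /=; lia.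
have wn : (w a < n.-1)%N by have := ltn_ord (w a1); lia.
have ca k : (w a <= k <= w a1)%N -> col k = col (w a).
  move=> /andP[k1 k2]; have h1 := col_homo k1; have h2 := col_homo (leq_trans k2 wb); lia.
have e : (w a).+1 = w a1.
  apply/eqP; rewrite eqn_leq wa leqNgt; apply/negP => lt.
  have h1 := @col_mono w cw (w a) (w a).+1; have h2 := @col_mono w cw (w a).+1 (w a1).
  move: h1 h2; rewrite !inv_at_perm !ca ?lt; try lia.
  have := ltn_ord (w a1).
  move=> h3 /(_ _ (erefl _)) h1 /(_ _ (erefl _)) h2.
  have : (a < inv_at w (w a).+1)%N by apply: h1; lia.
  have : (inv_at w (w a).+1 < a1)%N by apply: h2; lia.
  by rewrite /=; lia.
have := sw (Ordinal an) (Ordinal wn); rewrite /= -ra => /(_ erefl).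
rewrite e !ca ?leqnn ?andbT //; try lia.
move=> /(_ erefl)/eqP; apply; rewrite conjgC tpermJ; congr (_ * tperm _ _)%g.
  by apply: val_inj => /=; congr (nat_of_ord (w _)); apply: val_inj.
by apply: val_inj; rewrite /= e; congr (nat_of_ord (w _)); apply: val_inj.
Qed.

Variables (F : fieldType) (r : F).
Hypotheses (r0 : r != 0) (r2 : r ^+ 2 != -1).

Local Notation H := {ffun 'S_n -> F^o}.
Implicit Type h : H.

(** A shortest w in the support has no descent along rows or columns, since the shorter element
    would also be in the support. If s_i w = w s_j, the value of h there is both r and -1/r times h
    w, against r^2 <> -1. So w is transverse, hence equal to [wl]. *)
Lemma sandwich_eq0 wl h : (forall w, transverse w -> w = wl) ->
  left_symmetric r row h -> right_alternating r col h -> h wl = 0 -> h = 0.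
Proof.
move=> uniq_wl sh ah hwl; apply/ffunP => w0; rewrite ffunE; apply: contraTeq isT => hw0.
pose P w := h w != 0.
have [w hw min_w] := @arg_minnP _ w0 P (@perm_len n) hw0.
suff /uniq_wl e : transverse w by move: hw; rewrite /P e hwl eqxx.
have rw i : row i = row i.+1 -> ~~ descent (w^-1)%g i.
  move=> ri; apply/negP => di; pose v := (simple_refl i * w)%g.
  have dv : ~~ descent (v^-1)%g i by rewrite /v invMg simple_reflV descent_mulr di.
  have wE : w = (simple_refl i * v)%g by rewrite /v mulgA simple_reflK mul1g.
  have : P v by move: hw; rewrite /P wE sh // mulf_eq0 negb_or => /andP[].
  by move=> /min_w; rewrite {1}wE perm_len_mull // ltnn.
have cw i : col i = col i.+1 -> ~~ descent w i.
  move=> ci; apply/negP => di; pose v := (w * simple_refl i)%g.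
  have dv : ~~ descent v i by rewrite /v descent_mulr di.
  have wE : w = (v * simple_refl i)%g by rewrite /v mul_simple_reflK.
  have : P v by move: hw; rewrite /P wE ah // mulf_eq0 negb_or => /andP[].
  by move=> /min_w; rewrite {1}wE perm_len_mulr // ltnn.
apply: transverse_adj => // i j ri cj; apply/eqP => e.
have := sh i w ri (rw _ ri); rewrite e (ah j w cj (cw _ cj)) => /eqP.
rewrite -subr_eq0 -mulrBl mulf_eq0 (negPf hw) orbF => /eqP h0.
case/eqP: r2; have -> : r ^+ 2 = - r * (- r^-1 - r) - 1 by field.
by rewrite h0; ring.
Qed.

End Shapes.

Lemma reshape_index_cons a s k :
  reshape_index (a :: s) k = if (k < a)%N then 0%N else (reshape_index s (k - a)).+1.
Proof.
rewrite /reshape_index /= subn_eq0; case: ltnP => // ak.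
by rewrite subSn.
Qed.

Lemma reshape_index_homo s : {homo reshape_index s : a b / (a <= b)%N}.
Proof.
elim: s => // a s IH x y xy; rewrite !reshape_index_cons.
by case: (ltnP x a) => // ax; rewrite ifN; [rewrite ltnS IH //; lia | lia].
Qed.

(** * The coefficient of z_lam at w_lam *)

Section SpechtGenerator.
Variables (F : fieldType) (n : nat) (r : F) (lam : seq nat).
Hypotheses (r0 : r != 0) (r2 : r ^+ 2 != -1).
Implicit Types (w : 'S_n) (i j : 'I_n.-1).

Let row := reshape_index lam.
Let col := reshape_index (conj_part lam).
Let row_homo : {homo row : a b / (a <= b)%N} := @reshape_index_homo lam.
Let col_homo : {homo col : a b / (a <= b)%N} := @reshape_index_homo (conj_part lam).

Local Notation H := {ffun 'S_n -> F^o}.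
Local Notation R := (hecke_rmul (F := F) (n := n) r).
Local Notation T w := (hecke_op R w).
Local Notation x := (@specht_x F n r lam).
Local Notation y := (@specht_y F n r (conj_part lam)).
Local Notation z := (@specht_z F n r lam).
Local Notation wl := (@specht_w n lam).
Implicit Type h : H.

Lemma young_mull mu i w : reshape_index mu i = reshape_index mu i.+1 ->
  ((simple_refl i * w)%g \in young_subgroup n mu) = (w \in young_subgroup n mu).
Proof.
move=> ri; rewrite !inE; have e (a : 'I_n) : reshape_index mu (simple_refl i a) = reshape_index mu a.
  by rewrite simple_refl_val; case: eqP => [->//|_]; case: eqP => [->|].
have ss a : simple_refl i (simple_refl i a) = a by apply: tpermK.
apply/forallP/forallP => hw a; have := hw (simple_refl i a).
  by rewrite permM ss e.
by rewrite permM e.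
Qed.

Lemma young_V mu w : (w^-1)%g \in young_subgroup n mu = (w \in young_subgroup n mu).
Proof.
suff main v : v \in young_subgroup n mu -> (v^-1)%g \in young_subgroup n mu.
  by apply/idP/idP => [/main|/main //]; rewrite invgK.
rewrite !inE => /forallP hv; apply/forallP => a.
by rewrite eq_sym -{1}[a](permKV v) hv.
Qed.

Lemma young_mulr mu i w : reshape_index mu i = reshape_index mu i.+1 ->
  ((w * simple_refl i)%g \in young_subgroup n mu) = (w \in young_subgroup n mu).
Proof. by move=> ri; rewrite -[LHS]young_V invMg simple_reflV young_mull // young_V. Qed.

Lemma specht_x_left : left_symmetric r row x.
Proof.
move=> i w ri di; rewrite !ffunE young_mull // perm_len_mull //.
by case: ifP; rewrite ?mulr0 // exprS.
Qed.

Lemma specht_y_right : right_alternating r col y.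
Proof.
move=> i w ri di; rewrite !ffunE young_mulr // perm_len_mulr //.
by case: ifP; rewrite ?mulr0 // exprS.
Qed.

Lemma specht_z_left : left_symmetric r row z.
Proof. by do 2! apply: left_symmetric_mul => //; apply: specht_x_left. Qed.

Lemma specht_z_right : right_alternating r col z.
Proof.
apply/right_alternatingP => // i ci; rewrite rmul_hecke_mul //.
have /right_alternatingP -> // := specht_y_right.
rewrite /specht_z; move: (hecke_mul r x _) => h0; rewrite !hecke_mulE scaler_sumr.
by apply: eq_bigr => w _; rewrite [RHS]scalerA; congr (_ *: _); rewrite [LHS]ffunE.
Qed.

(** Says that x g_w is the sum of the r^len(u) g_{u w} over the Young subgroup: w is shortest in its
    coset, so lengths add up. *)
Lemma op_specht_x w w' : (forall i, row i = row i.+1 -> ~~ descent (w^-1)%g i) ->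
  T w x w' = x (w' * w^-1)%g.
Proof.
have [k] := ubnP (perm_len w); elim: k w w' => // k IH w w' wk rw.
have [i di|nd] := pickP (descent w); last first.
  have -> : w = 1%g by apply: no_descent1 => i; rewrite nd.
  by rewrite hecke_op1 invg1 mulg1.
rewrite (hecke_op_descent (hecke_rmul_module n r0) (memvf _) di) hecke_rmulE.
pose v : 'S_n := (w * simple_refl i)%g; rewrite -/v.
have wE : w = (v * simple_refl i)%g by rewrite /v mul_simple_reflK.
have lw : perm_len w = (perm_len v).+1 := perm_len_descent di.
have rv (a : 'I_n.-1) : row a = row a.+1 -> ~~ descent (v^-1)%g a.
  move=> ra; rewrite /v invMg simple_reflV descent_mull ?rw //.
  apply/eqP => e; have e' : v = (simple_refl a * w)%g.
    by apply: invg_inj; rewrite /v !invMg !simple_reflV e.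
  by have := perm_len_mull (rw _ ra); rewrite -e' lw; lia.
have dv : ~~ descent v i by rewrite /v descent_mulr di.
clearbody v; rewrite !IH //; try by rewrite -ltnS -lw.
have -> : (w' * simple_refl i * v^-1 = w' * w^-1)%g.
  by rewrite wE invMg simple_reflV mulgA.
(* Otherwise v^-1 and w'^-1 send i, and likewise i + 1, to equal rows, but order the two images
   oppositely. Both images of v^-1 then lie in one row, which w = v s_i would reverse. *)
suff main : descent w' i -> (w' * v^-1)%g \notin young_subgroup n lam.
  case: (boolP (descent w' i)) => [/main|_]; last by rewrite mulr0 mul0r subr0.
  by rewrite [x (w' * v^-1)%g]ffunE => /negPf->; rewrite mulr0 subr0.
move=> dw'; apply/negP; rewrite -young_V invMg invgK inE => /forallP hu.
move: dw' (inv_lt dv); rewrite /descent !inv_at_lo !inv_at_hi.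
set a := (v^-1)%g _; set b := (v^-1)%g _ => dw' ab.
have va : v a = Ordinal (strand_lt i) by rewrite permKV.
have vb : v b = Ordinal (strandS_lt i) by rewrite permKV.
have := hu a; have := hu b; rewrite !permM va vb => /eqP hb /eqP ha.
have [e|ne] := eqVneq (row a) (row b).
  have := row_mono row_homo rw ab e; rewrite wE !permM va vb.
  by rewrite !simple_refl_val /= eqxx; case: eqP; rewrite ?eqxx; lia.
have h1 : (row a <= row b)%N by apply/row_homo/ltnW.
have := row_homo (ltnW dw'); move: ha hb ne h1; rewrite -/row => -> ->.
by move=> /eqP; lia.
Qed.

(** As w is shortest in its coset of the column subgroup, i is not a descent of w u^-1 when a letter
    s_i is split off as v = s_i u; so the correction term of [hecke_rmulE] is absent. *)
Lemma op_young v w h : v \in young_subgroup n (conj_part lam) ->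
  (forall i, col i = col i.+1 -> ~~ descent w i) ->
  T v h w = h (w * v^-1)%g.
Proof.
move=> + cw; have [k] := ubnP (perm_len v); elim: k v h => // k IH v h vk vY.
have [i di|nd] := pickP (descent (v^-1)%g); last first.
  have -> : v = 1%g by apply: invg_inj; rewrite invg1; apply: no_descent1 => i; rewrite nd.
  by rewrite hecke_op1 invg1 mulg1.
pose u : 'S_n := (simple_refl i * v)%g.
have vE : v = (simple_refl i * u)%g by rewrite /u mulgA simple_reflK mul1g.
have du : ~~ descent (u^-1)%g i by rewrite /u invMg simple_reflV descent_mulr di.
have ci : col i = col i.+1.
  have := vY; rewrite inE => /forallP hv.
  have := hv (Ordinal (strand_lt i)); have := hv (Ordinal (strandS_lt i)) => /eqP /= h1 /eqP /= h2.
  have := col_homo (leqnSn i); move: di; rewrite descentV => /ltnW/col_homo.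
  by rewrite /col h1 h2; lia.
have uY : u \in young_subgroup n (conj_part lam) by rewrite young_mull.
have lu : (perm_len u < k)%N by have := perm_len_mull du; rewrite -vE; lia.
clearbody u; rewrite {1}vE (hecke_op_mull (hecke_rmul_module n r0)) ?memvf // IH // hecke_rmulE.
have -> : (w * u^-1 * simple_refl i = w * v^-1)%g by rewrite vE invMg simple_reflV mulgA.
suff /negPf-> : ~~ descent (w * u^-1)%g i by rewrite mulr0 mul0r subr0.
rewrite /descent inv_at_lo inv_at_hi invMg invgK !permM -!inv_atE -leqNgt.
apply/ltnW/(col_mono col_homo cw).
  have h1 := inv_lt du; move: h1; rewrite !inv_at_lo !inv_at_hi invgK => ->.
  exact: ltn_ord.
have := uY; rewrite inE => /forallP hu.
by have /eqP := hu (Ordinal (strand_lt i)); have /eqP := hu (Ordinal (strandS_lt i)) => /= h1 h2; rewrite /col h1 h2.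
Qed.

Hypothesis wlP : transverse row col wl.

(** Only the term v = 1 of y contributes: for any other contributing v, the permutation wl v^-1
    wl^-1 would preserve the rows and v the columns, and transversality forces v = 1. *)
Lemma specht_z_coef : z wl = 1.
Proof.
have [rw cw sw] := wlP.
rewrite /specht_z hecke_mul_g hecke_mulE sum_ffunE (bigD1 1%g) //= big1 ?addr0.
  rewrite !ffunE hecke_op1 op_specht_x // mulgV perm_len1 !ffunE perm_len1.
  suff Y1 mu : (1%g : 'S_n) \in young_subgroup n mu by rewrite !Y1 /GRing.scale /= mulr1.
  by rewrite inE; apply/forallP => a; rewrite perm1.
move=> v v1; rewrite !ffunE; case: ifPn => vY; last by rewrite scale0r.
rewrite op_young // op_specht_x // ffunE ifN ?scaler0 //.
apply: contra v1 => vrow; apply/eqP; apply: invg_inj; rewrite invg1.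
apply/permP => a; rewrite perm1.
apply: (can_inj (permK (wl^-1)%g)); apply: sw.
  have := vrow; rewrite inE => /forallP/(_ ((wl^-1)%g a)).
  by rewrite !permM permKV => /eqP.
rewrite !permKV; have := vY; rewrite -young_V inE => /forallP/(_ a)/eqP //.
Qed.

End SpechtGenerator.

(** * Irreducible modules isomorphic to S^lam *)

Section SpechtIsomorphism.
Variables (F : fieldType) (n : nat) (r : F) (lam : seq nat).
Hypotheses (r0 : r != 0) (r2 : r ^+ 2 != -1).
Implicit Types (w : 'S_n) (i j : 'I_n.-1).

Let m : F := r^-1 - r.
Let row := reshape_index lam.
Let col := reshape_index (conj_part lam).

Local Notation H := {ffun 'S_n -> F^o}.
Local Notation R := (hecke_rmul (F := F) (n := n) r).
Local Notation z := (@specht_z F n r lam).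
Local Notation wl := (@specht_w n lam).

Lemma mem_specht w : hecke_op R w z \in specht n r lam.
Proof.
rewrite -hecke_mul_g; apply: memv_span; apply: map_f; exact: mem_enum.
Qed.

Lemma specht_invariant i : (R i @: specht n r lam <= specht n r lam)%VS.
Proof.
rewrite limg_span; apply/span_subvP => _ /mapP[_ /mapP[w _ ->] ->].
rewrite hecke_mul_g (hecke_op_mulr (hecke_rmul_module n r0)) ?memvf //.
by case: ifP => _; rewrite ?memvB ?memvZ ?mem_specht.
Qed.

Lemma specht_module : hecke_module r R (specht n r lam).
Proof.
have [_ quad braid comm] := hecke_rmul_module n r0.
split=> [|i u _|i j u ij _|i j u ij _]; first exact: specht_invariant.
- exact/quad/memvf.
- exact/braid/memvf.
- exact/comm/memvf.
Qed.

Hypothesis wlP : transverse row col wl.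
Hypothesis wl_uniq : forall w, transverse row col w -> w = wl.

Variables (V : vectType F) (rho : 'I_n.-1 -> 'End(V)) (U : {vspace V}).
Hypothesis modU : hecke_module r rho U.
Hypothesis irrU : forall W : {vspace V}, (W <= U)%VS ->
  (forall i, (rho i @: W <= W)%VS) -> W != 0%VS -> W = U.

Variable theta : 'Hom(V, F^o).
Hypothesis theta_sym : forall i u, row i = row i.+1 -> u \in U ->
  theta (rho i u) = r * theta u.
Variables (u0 p : V).
Hypotheses (u0U : u0 \in U) (theta_u0 : theta u0 != 0).
Hypotheses (pU : p \in U) (p0 : p != 0).
Hypothesis p_alt : forall i, col i = col i.+1 -> rho i p = - r^-1 *: p.

(* The group algebra being a symmetric algebra with dual bases g_w and
   g_{w^-1}, every linear form on a module yields a morphism to it. *)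
Definition frobenius_fun (v : V) : H := [ffun w => theta (hecke_op rho (w^-1)%g v)].

Fact frobenius_fun_is_linear : linear frobenius_fun.
Proof. by move=> c u v; apply/ffunP => w; rewrite !ffunE !linearP. Qed.

HB.instance Definition _ :=
  GRing.isLinear.Build F V H _ frobenius_fun frobenius_fun_is_linear.

Let f := linfun frobenius_fun.

Lemma frobeniusE v w : f v w = theta (hecke_op rho (w^-1)%g v).
Proof. by rewrite lfunE /= ffunE. Qed.

Lemma frobenius_rho i u : u \in U -> f (rho i u) = R i (f u).
Proof.
move=> uU; apply/ffunP => w; rewrite hecke_rmulE !frobeniusE invMg simple_reflV.
have [dw|dw] := boolP (descent w i); last first.
  by rewrite -(hecke_op_mull modU) ?invgK // mulr0 mul0r subr0.
have [v vE] : exists v : 'S_n, v = (simple_refl i * w^-1)%g by eexists.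
have wE : (w^-1)%g = (simple_refl i * v)%g by rewrite vE mulgA simple_reflK mul1g.
have dv : ~~ descent (v^-1)%g i.
  by rewrite vE invMg invgK simple_reflV descent_mulr dw.
have ru := hecke_rho_mem modU i uU.
rewrite -vE wE !(hecke_op_mull modU) //.
have -> : rho i (rho i u) = u - m *: rho i u.
  by apply: (canRL (addrK _)); case: modU => _ + _ _; apply.
by rewrite !linearB !linearZ /= mulr1 scalerN.
Qed.

Lemma frobenius_left u : u \in U -> left_symmetric r row (f u).
Proof.
move=> uU i w ri di; rewrite !frobeniusE invMg simple_reflV.
have -> : hecke_op rho (w^-1 * simple_refl i)%g u = rho i (hecke_op rho (w^-1)%g u).
  by rewrite (hecke_op_mulr modU) // (negPf di).
by rewrite theta_sym // (hecke_op_mem modU).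
Qed.

(** The kernel in U is a submodule, and it omits [u0] because f u0 takes the value theta u0 at 1. *)
Lemma frobenius_inj : {in U, forall u, f u = 0 -> u = 0}.
Proof.
move=> u uU fu; pose W := (U :&: lker f)%VS.
have [W0|W0] := eqVneq W 0%VS.
  by apply/eqP; rewrite -memv0 -W0 memv_cap uU memv_ker fu eqxx.
suff WU : W = U.
  move: u0U; rewrite -WU memv_cap memv_ker => /andP[_ /eqP fu0].
  have := congr1 (fun h : H => h 1%g) fu0.
  by rewrite /= frobeniusE invg1 hecke_op1 ffunE => /eqP; rewrite (negPf theta_u0).
apply: irrU => //; first exact: capvSl.
move=> i; apply/subvP => _ /memv_imgP[v + ->].
rewrite !memv_cap !memv_ker => /andP[vU /eqP fv].
by rewrite (hecke_rho_mem modU) //= frobenius_rho // fv linear0.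
Qed.

(** The difference is left symmetric, right alternating and, since z has coefficient 1 at [wl], zero
    there; so [sandwich_eq0] applies. *)
Lemma frobenius_alt : f p = f p wl *: z.
Proof.
apply/eqP; rewrite -subr_eq0; apply/eqP.
apply: (@sandwich_eq0 n row col _ _ F r r0 r2 wl) => //.
- exact: reshape_index_homo.
- exact: reshape_index_homo.
- move=> i w ri di.
  by rewrite !ffunE (frobenius_left pU ri di) (specht_z_left r0 ri di) /= /GRing.scale /=; ring.
- have zr := @specht_z_right F n r lam r0.
  apply/right_alternatingP => // i ci; rewrite linearB linearZ /= -frobenius_rho // p_alt //.
  move/right_alternatingP: zr => -> //.
  by rewrite linearZ /= scalerBr !scalerA mulrC.
- by rewrite !ffunE (specht_z_coef r0 r2 wlP) /GRing.scale /= mulr1 subrr.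
Qed.

(** As f p is a nonzero multiple of z, the ideal z H lies in f(U). Conversely the preimage of z H in
    U is a nonzero submodule, hence all of U. *)
Lemma irreducible_iso_specht : hecke_iso r rho U R (specht n r lam).
Proof.
have fp0 : f p != 0 by apply: contraNneq p0 => /(frobenius_inj pU)->.
have c0 : f p wl != 0 by apply: contraNneq fp0 => e; rewrite frobenius_alt e scale0r.
have zE : z = f ((f p wl)^-1 *: p).
  by apply: (scalerI c0); rewrite linearZ scalerA mulfV // scale1r -frobenius_alt.
have zU : (f p wl)^-1 *: p \in U by apply: memvZ.
have fop w u : u \in U -> f (hecke_op rho w u) = hecke_op R w (f u).
  rewrite /hecke_op; move: (perm_len w) => k uU.
  suff [] : hecke_op_rec rho k w u \in U /\
    f (hecke_op_rec rho k w u) = hecke_op_rec R k w (f u) by [].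
  elim: k w => [|k IH] w /=; first by rewrite !id_lfunE.
  case: pickP => [i _|_]; rewrite ?id_lfunE // !comp_lfunE.
  have [h1 h2] := IH (w * simple_refl i)%g.
  by rewrite (hecke_rho_mem modU) // frobenius_rho // h2.
split; [exact: modU | exact: specht_module | exists f; split].
- move=> u v uU vU e; apply/eqP; rewrite -subr_eq0; apply/eqP.
  by apply: frobenius_inj; rewrite ?memvB // linearB /= e subrr.
- apply/eqP; rewrite eqEsubv; apply/andP; split; last first.
    apply/span_subvP => _ /mapP[w _ ->]; rewrite hecke_mul_g zE -fop //.
    by rewrite memv_img // (hecke_op_mem modU).
  pose W := (U :&: f @^-1: specht n r lam)%VS.
  suff WU : W = U.
    by apply/subvP => _ /memv_imgP[u + ->]; rewrite -WU memv_cap => /andP[_]; rewrite -memv_preim.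
  apply: irrU; first exact: capvSl.
    move=> i; apply/subvP => _ /memv_imgP[v + ->].
    rewrite !memv_cap -!memv_preim => /andP[vU fv].
    rewrite (hecke_rho_mem modU) //= frobenius_rho //.
    exact: (subvP (specht_invariant i)) (memv_img _ fv).
  apply/eqP => W0; move: p0; rewrite -memv0 -W0 memv_cap pU -memv_preim /=.
  move/negP; apply; rewrite frobenius_alt; apply: memvZ.
  by have := mem_specht 1%g; rewrite hecke_op1.
- by move=> i u uU; apply: frobenius_rho.
Qed.

End SpechtIsomorphism.

Lemma reshape_index_nseq1 N k : reshape_index (nseq N 1%N) k = minn k N.
Proof.
elim: N k => [|N IH] k; first by rewrite minn0.
by rewrite /= reshape_index_cons IH; case: ltnP; lia.
Qed.

Lemma increasing_self N (h : nat -> nat) :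
  (forall k, (k.+1 < N)%N -> (h k < h k.+1)%N) ->
  (forall k, (k < N)%N -> (h k < N)%N) ->
  forall k, (k < N)%N -> h k = k.
Proof.
move=> hi hN; have lo k : (k < N)%N -> (k <= h k)%N.
  by elim: k => // k IH kN; have := hi k kN; have := IH (ltnW kN); lia.
have up d k : (d + k < N)%N -> (h k + d <= h (d + k))%N.
  elim: d => [|d IH] dk; first by rewrite addn0.
  by rewrite addSn; have := IH (ltnW dk); have := hi (d + k)%N dk; lia.
move=> k kN; have := lo k kN; have := up (N.-1 - k)%N k; have := hN N.-1.
have -> : (N.-1 - k + k = N.-1)%N by lia.
by lia.
Qed.

(** * Transversality from closed formulas for a shape *)

Section ShapeTransverse.
Variables (n : nat) (lam : seq nat) (row col g : nat -> nat).
Hypothesis rowE : forall k, (k < n)%N -> reshape_index lam k = row k.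
Hypothesis colE : forall k, (k < n)%N -> reshape_index (conj_part lam) k = col k.
Hypothesis gE : forall k, (k < n)%N ->
  flatten_index (conj_part lam) (reshape_offset lam k) (reshape_index lam k) = g k.
Hypothesis g_lt : forall k, (k < n)%N -> (g k < n)%N.
Hypothesis g_inj : forall a b, (a < n)%N -> (b < n)%N -> g a = g b -> a = b.

Local Notation wl := (@specht_w n lam).
Local Notation transv := (transverse (n := n) (reshape_index lam) (reshape_index (conj_part lam))).

Lemma specht_w_val (k : 'I_n) : wl k = g k :> nat.
Proof.
have fE (a : 'I_n) : specht_w_fun n lam a = g a :> nat.
  by rewrite ffunE gE // val_insubd g_lt.
have inj : injectiveb (specht_w_fun n lam).
  by apply/injectiveP => a b e; apply/val_inj/g_inj; rewrite //= -!fE e.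
rewrite -[LHS](_ : nat_of_ord (specht_w_fun n lam k) = _) ?fE //.
by rewrite /specht_w -pvalE -[pval _]/(val _) insubdK.
Qed.

Lemma specht_w_inv c : (c < n)%N -> g (inv_at wl c) = c /\ (inv_at wl c < n)%N.
Proof.
move=> cn; rewrite -[in inv_at wl c](_ : val (Ordinal cn) = c) // inv_atE.
by rewrite -specht_w_val permKV.
Qed.

Lemma specht_w_transverse :
  (forall i, (i.+1 < n)%N -> row i = row i.+1 -> (g i < g i.+1)%N) ->
  (forall i a b, (i.+1 < n)%N -> (a < n)%N -> (b < n)%N -> col i = col i.+1 ->
     g a = i -> g b = i.+1 -> (a < b)%N) ->
  (forall a b, (a < n)%N -> (b < n)%N -> row a = row b -> col (g a) = col (g b) -> a = b) ->
  transv wl.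
Proof.
move=> hr hc hrc; split=> [i|i|a b].
- have i1 := strandS_lt i; have i0 := strand_lt i.
  rewrite !rowE // => ri; rewrite descentV !specht_w_val /= -leqNgt.
  by apply/ltnW/hr.
- have i1 := strandS_lt i; have i0 := strand_lt i.
  rewrite !colE // => ci; rewrite /descent -leqNgt.
  have [e1 e2] := specht_w_inv i0; have [e3 e4] := specht_w_inv i1.
  by apply/ltnW/(hc i).
- rewrite !rowE ?colE // ?specht_w_val => rab cab.
  exact: val_inj (hrc _ _ (ltn_ord a) (ltn_ord b) rab cab).
Qed.

(** N is the length of the first row, hence the number of columns. A transverse w increases along
    this row and meets each column at most once, so entry k goes to column k. What remains, the
    hypothesis on f, is a finite case analysis for each shape. *)
Lemma specht_w_unique (N : nat) :
  (forall k, (k.+1 < N)%N -> row k = row k.+1) -> (N <= n)%N ->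
  (forall k, (k < n)%N -> (col k < N)%N) ->
  (forall f : nat -> nat,
     (forall k, (k < n)%N -> (f k < n)%N) ->
     (forall c, (c < n)%N -> exists2 a, (a < n)%N & f a = c) ->
     (forall a b, (a < n)%N -> (b < n)%N -> f a = f b -> a = b) ->
     (forall k, (k < N)%N -> col (f k) = k) ->
     (forall i, (i.+1 < n)%N -> row i = row i.+1 -> (f i < f i.+1)%N) ->
     (forall a b, (a < n)%N -> (b < n)%N -> (f b = (f a).+1) -> col (f a) = col (f b) ->
        (a < b)%N) ->
     forall k, (k < n)%N -> f k = g k) ->
  forall w, transv w -> w = wl.
Proof.
move=> rN Nn cN uniq_g w [rw cw sw].
pose f := inv_at (w^-1)%g.
have fE (k : nat) (kn : (k < n)%N) : f k = w (Ordinal kn).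
  by rewrite /f -[in LHS](_ : val (Ordinal kn) = k) // inv_atV.
have fr i : (i.+1 < n)%N -> row i = row i.+1 -> (f i < f i.+1)%N.
  move=> i1 ri; have i0 : (i < n.-1)%N by lia.
  have := inv_lt (w := (w^-1)%g) (i := Ordinal i0).
  by apply; apply: rw; rewrite !rowE //=; lia.
have f_lt k : (k < n)%N -> (f k < n)%N by move=> kn; rewrite fE.
apply/permP => k; apply: val_inj; rewrite /= specht_w_val -inv_atV -/f.
apply: uniq_g => //.
- move=> c cn; exists ((w^-1)%g (Ordinal cn)) => //.
  by rewrite /f inv_atV permKV.
- move=> a b an bn; rewrite !fE => /val_inj/perm_inj e.
  by have := congr1 (@nat_of_ord n) e.
- apply: increasing_self => [k0 kN|k0 kN]; last by apply/cN/f_lt; lia.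
  have k1 : (k0 < n)%N by lia.
  have k2 : (k0.+1 < n)%N by lia.
  have ff := fr _ k2 (rN _ kN).
  have := reshape_index_homo (conj_part lam) (ltnW ff); rewrite !colE ?f_lt //.
  rewrite leq_eqVlt => /orP[/eqP e|//].
  have := sw (Ordinal k1) (Ordinal k2); rewrite !rowE // rN // -!fE !colE ?f_lt // e.
  by move=> /(_ erefl erefl) /(congr1 (@nat_of_ord n)) /=; lia.
- move=> a b an bn e ce.
  have fb := f_lt _ bn; have fa : (f a < n.-1)%N by lia.
  have := inv_lt (w := w) (i := Ordinal fa); rewrite /= -e.
  have ia c (cn : (c < n)%N) : inv_at w (f c) = c by rewrite fE inv_at_perm.
  rewrite !ia //; apply; apply: cw; rewrite /= -e !colE //; lia.
Qed.

End ShapeTransverse.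

(** * The shapes (n), (n-1,1), (n-2,2) and (n-2,1,1) *)

Section FourShapes.
Variable n : nat.

Local Notation transv lam :=
  (transverse (n := n) (reshape_index lam) (reshape_index (conj_part lam))).

Lemma conj_part1 : conj_part [:: n] = nseq n 1%N.
Proof.
apply: (@eq_from_nth _ 0%N); rewrite ?size_mkseq /= ?size_nseq // => k kn.
by rewrite nth_mkseq // nth_nseq kn /= kn addn0.
Qed.

Lemma conj_part2 : (3 <= n)%N -> conj_part [:: n - 1; 1]%N = 2%N :: nseq (n - 2) 1%N.
Proof.
move=> n3; apply: (@eq_from_nth _ 0%N); rewrite ?size_mkseq /= ?size_nseq; first lia.
move=> [|k] kn; rewrite nth_mkseq //= ?nth_nseq.
  by lia.
by rewrite ifT; lia.
Qed.

Lemma conj_part3 : (4 <= n)%N -> conj_part [:: n - 2; 2]%N = [:: 2, 2 & nseq (n - 4) 1%N]%N.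
Proof.
move=> n3; apply: (@eq_from_nth _ 0%N); rewrite ?size_mkseq /= ?size_nseq; first lia.
move=> [|[|k]] kn; rewrite nth_mkseq //= ?nth_nseq; try lia.
by rewrite ifT; lia.
Qed.

Lemma conj_part4 : (3 <= n)%N -> conj_part [:: n - 2; 1; 1]%N = (3 :: nseq (n - 3) 1)%N.
Proof.
move=> n3; apply: (@eq_from_nth _ 0%N); rewrite ?size_mkseq /= ?size_nseq; first lia.
move=> [|k] kn; rewrite nth_mkseq //= ?nth_nseq; try lia.
by rewrite ifT; lia.
Qed.

Lemma sumn_take_nseq1 k N : sumn (take k (nseq N 1%N)) = minn k N.
Proof.
by elim: N k => [|N IH] [|k] //=; rewrite IH; lia.
Qed.

Lemma shape1 : (3 <= n)%N -> transv [:: n] (@specht_w n [:: n]) /\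
  forall w, transv [:: n] w -> w = @specht_w n [:: n].
Proof.
move=> n3; have rowE k : (k < n)%N -> reshape_index [:: n] k = (fun _ => 0%N) k.
  by move=> kn; rewrite reshape_index_cons kn.
have colE k : (k < n)%N -> reshape_index (conj_part [:: n]) k = id k.
  by move=> kn; rewrite conj_part1 reshape_index_nseq1 /=; lia.
have gE k : (k < n)%N -> flatten_index (conj_part [:: n]) (reshape_offset [:: n] k)
    (reshape_index [:: n] k) = id k.
  move=> kn; rewrite conj_part1 /flatten_index /reshape_offset rowE //= subn0.
  by rewrite sumn_take_nseq1; lia.
split.
  by apply: (specht_w_transverse rowE colE gE) => //=; lia.
by apply: (@specht_w_unique n _ _ _ _ rowE colE gE _ _ n) => //= f _ _ _ ->.
Qed.

Lemma shape2 : (3 <= n)%N -> transv [:: n - 1; 1]%N (@specht_w n [:: n - 1; 1]%N) /\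
  forall w, transv [:: n - 1; 1]%N w -> w = @specht_w n [:: n - 1; 1]%N.
Proof.
move=> n3; pose row k := nat_of_bool (n - 1 <= k)%N.
(* The cell of n - 1 comes second in the column filling, which shifts 1, ..., n - 2 by one. *)
pose g k := if k == 0%N then 0%N else if k == (n - 1)%N then 1%N else k.+1.
have rowE k : (k < n)%N -> reshape_index [:: n - 1; 1]%N k = row k.
  move=> kn; rewrite reshape_index_cons /row; case: ltnP => h; last by rewrite reshape_index_cons ifT; lia.
  lia.
have colE k : (k < n)%N -> reshape_index (conj_part [:: n - 1; 1]%N) k = k.-1.
  by move=> kn; rewrite conj_part2 // reshape_index_cons reshape_index_nseq1; case: ltnP; lia.
have gE k : (k < n)%N -> flatten_index (conj_part [:: n - 1; 1]%N)
    (reshape_offset [:: n - 1; 1]%N k) (reshape_index [:: n - 1; 1]%N k) = g k.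
  move=> kn; rewrite conj_part2 // /flatten_index /reshape_offset rowE // /row /g.
  case: leqP => h /=; rewrite ?addn0 ?subn0.
    have e : k = (n - 1)%N by lia.
    by rewrite e ?addn0 subnn take0 eqxx ifN //=; lia.
  by case: k kn h => [|k] kn h //=; rewrite sumn_take_nseq1 ifN; lia.
have g_lt k : (k < n)%N -> (g k < n)%N by rewrite /g; do !case: eqP; lia.
have g_inj a b : (a < n)%N -> (b < n)%N -> g a = g b -> a = b.
  by rewrite /g; do !case: eqP; lia.
split.
  apply: (specht_w_transverse rowE colE gE g_lt g_inj) => //=; rewrite /row /g.
  - by move=> i; do !case: eqP; lia.
  - by move=> i a b; do !case: eqP; lia.
  - by move=> a b; do !case: eqP; lia.
apply: (@specht_w_unique n _ _ _ _ rowE colE gE g_lt g_inj (n - 1)%N) => //=; rewrite /row /g; try lia.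
move=> f flt fsurj finj fcol frow fcl k kn.
have mid a : (1 <= a < n - 1)%N -> f a = a.+1 by move=> ha; have := fcol a; lia.
(* By [mid] the values 0 and 1 are left for the entries 0 and n - 1, and they share a column, which
   fixes their order. *)
have [a0 a0n e0] := fsurj 0%N ltac:(lia); have [a1 a1n e1] := fsurj 1%N ltac:(lia).
have := fcl a0 a1 a0n a1n; rewrite e0 e1 => /(_ erefl erefl) lt01.
have := mid a0; have := mid a1; have := mid k; have := fcol 0%N; have := flt k kn.
have [x0|x0] := eqVneq a0 0%N; last by lia.
have [x1|x1] := eqVneq a1 (n - 1)%N; last by lia.
rewrite x0 in e0; rewrite x1 in e1.
case: eqP => [->|k0]; first by rewrite e0.
by case: eqP => [->|k1]; [rewrite e1 | lia].
Qed.

Lemma shape3 : (4 <= n)%N -> transv [:: n - 2; 2]%N (@specht_w n [:: n - 2; 2]%N) /\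
  forall w, transv [:: n - 2; 2]%N w -> w = @specht_w n [:: n - 2; 2]%N.
Proof.
move=> n3; pose row k := nat_of_bool (n - 2 <= k)%N.
pose col k := ((1 < k) + (k - 3))%N.
(* The columns of the row filling are {0, n-2}, {1, n-1}, and then single cells. *)
pose g k := if k == 0%N then 0%N else if k == 1%N then 2%N else
  if k == (n - 2)%N then 1%N else if k == (n - 1)%N then 3%N else k.+2.
have rowE k : (k < n)%N -> reshape_index [:: n - 2; 2]%N k = row k.
  move=> kn; rewrite reshape_index_cons /row; case: ltnP => h; last by rewrite reshape_index_cons ifT; lia.
  lia.
have colE k : (k < n)%N -> reshape_index (conj_part [:: n - 2; 2]%N) k = col k.
  move=> kn; rewrite conj_part3 // reshape_index_cons /col.
  case: ltnP => h; first lia.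
  by rewrite reshape_index_cons reshape_index_nseq1; case: ltnP => h'; lia.
have gE k : (k < n)%N -> flatten_index (conj_part [:: n - 2; 2]%N)
    (reshape_offset [:: n - 2; 2]%N k) (reshape_index [:: n - 2; 2]%N k) = g k.
  move=> kn; rewrite conj_part3 // /flatten_index /reshape_offset rowE // /row /g.
  case: leqP => h /=; rewrite ?addn0 ?subn0.
    have [->|e] : k = (n - 2)%N \/ k = (n - 1)%N by lia.
      by rewrite ?addn0 subnn take0 eqxx !ifN //=; lia.
    rewrite e ?addn0; have -> : (n - 1 - (n - 2) = 1)%N by lia.
    by rewrite eqxx !ifN //=; lia.
  by case: k kn h => [|[|k]] kn h //=; rewrite sumn_take_nseq1 !ifN; lia.
have g_lt k : (k < n)%N -> (g k < n)%N by rewrite /g; do !case: eqP; lia.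
have g_inj a b : (a < n)%N -> (b < n)%N -> g a = g b -> a = b.
  by rewrite /g; do !case: eqP; lia.
split.
  apply: (specht_w_transverse rowE colE gE g_lt g_inj) => //=; rewrite /row /g /col.
  - by move=> i; do !case: eqP; lia.
  - by move=> i a b; do !case: eqP; lia.
  - by move=> a b; do !case: eqP; lia.
apply: (@specht_w_unique n _ _ _ _ rowE colE gE g_lt g_inj (n - 2)%N) => //=; rewrite /row /g /col; try lia.
move=> f flt fsurj finj fcol frow fcl k kn.
have mid a : (2 <= a < n - 2)%N -> f a = a.+2 by move=> ha; have := fcol a; lia.
have [a0 a0n e0] := fsurj 0%N ltac:(lia); have [a1 a1n e1] := fsurj 1%N ltac:(lia).
have [a2 a2n e2] := fsurj 2%N ltac:(lia); have [a3 a3n e3] := fsurj 3%N ltac:(lia).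
have := fcl a0 a1 a0n a1n; rewrite e0 e1 => /(_ erefl erefl) lt01.
have := fcl a2 a3 a2n a3n; rewrite e2 e3 => /(_ erefl erefl) lt23.
have lt := frow (n - 2)%N; have en : (n - 2).+1 = (n - 1)%N by lia.
rewrite en in lt.
have f0 : f 0%N = 0%N \/ f 0%N = 1%N by have := fcol 0%N; lia.
have f1 : f 1%N = 2%N \/ f 1%N = 3%N by have := fcol 1%N; lia.
have n0 : (0 < n)%N by lia. have n1 : (1 < n)%N by lia.
have x0 : a0 = 0%N.
  case: f0 => f0; first by apply: finj; rewrite ?e0.
  by have : a1 = 0%N; [apply: finj; rewrite ?e1 | lia].
have x2 : a2 = 1%N.
  case: f1 => f1; first by apply: finj; rewrite ?e2.
  have a31 : a3 = 1%N by apply: finj; rewrite ?e3.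
  have a20 : a2 = 0%N by lia.
  by move: f0; rewrite -a20; lia.
rewrite x0 in e0; rewrite x2 in e2.
have d1 : (a1 == n - 2)%N || (a1 == n - 1)%N.
  have := mid a1; case: (eqVneq a1 0%N) => [h|?]; first by move: e1; rewrite h; lia.
  by case: (eqVneq a1 1%N) => [h|?]; [move: e1; rewrite h |]; lia.
have d3 : (a3 == n - 2)%N || (a3 == n - 1)%N.
  have := mid a3; case: (eqVneq a3 0%N) => [h|?]; first by move: e3; rewrite h; lia.
  by case: (eqVneq a3 1%N) => [h|?]; [move: e3; rewrite h |]; lia.
have d13 : a1 <> a3 by move=> h; move: e1; rewrite h e3.
have x1 : a1 = (n - 2)%N.
  case/orP: d1 => /eqP h1 //; case/orP: d3 => /eqP h3; last by lia.
  by move: e1 e3 lt; rewrite h1 h3; lia.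
have x3 : a3 = (n - 1)%N by lia.
rewrite x1 in e1; rewrite x3 in e3; have := mid k.
case: eqP => [->|k0]; first by rewrite e0.
case: eqP => [->|k1]; first by rewrite e2.
case: eqP => [->|k2]; first by rewrite e1.
by case: eqP => [->|k3]; [rewrite e3 | lia].
Qed.

Lemma shape4 : (3 <= n)%N -> transv [:: n - 2; 1; 1]%N (@specht_w n [:: n - 2; 1; 1]%N) /\
  forall w, transv [:: n - 2; 1; 1]%N w -> w = @specht_w n [:: n - 2; 1; 1]%N.
Proof.
move=> n3; pose row k := ((n - 2 <= k) + (n - 1 <= k))%N.
pose col k := (k - 2)%N.
pose g k := if k == 0%N then 0%N else
  if k == (n - 2)%N then 1%N else if k == (n - 1)%N then 2%N else k.+2.
have rowE k : (k < n)%N -> reshape_index [:: n - 2; 1; 1]%N k = row k.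
  move=> kn; rewrite reshape_index_cons /row; case: ltnP => h; first lia.
  rewrite reshape_index_cons; case: ltnP => h'; first lia.
  by rewrite reshape_index_cons ifT; lia.
have colE k : (k < n)%N -> reshape_index (conj_part [:: n - 2; 1; 1]%N) k = col k.
  by move=> kn; rewrite conj_part4 // reshape_index_cons reshape_index_nseq1 /col; case: ltnP; lia.
have gE k : (k < n)%N -> flatten_index (conj_part [:: n - 2; 1; 1]%N)
    (reshape_offset [:: n - 2; 1; 1]%N k) (reshape_index [:: n - 2; 1; 1]%N k) = g k.
  move=> kn; rewrite conj_part4 // /flatten_index /reshape_offset rowE // /row /g.
  have [h|[e|e]] : (k < n - 2)%N \/ k = (n - 2)%N \/ k = (n - 1)%N by lia.
  - have -> : (n - 2 <= k)%N = false by lia.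
    have -> : (n - 1 <= k)%N = false by lia.
    rewrite /= ?addn0 ?subn0.
    by case: k kn h => [|k] kn h //=; rewrite sumn_take_nseq1 !ifN; lia.
  - have -> : (n - 2 <= k)%N by lia.
    have -> : (n - 1 <= k)%N = false by lia.
    by rewrite e /= addn0 subnn eqxx ifN //; lia.
  - have -> : (n - 2 <= k)%N by lia.
    have -> : (n - 1 <= k)%N by lia.
    rewrite e /= addn0; have -> : (n - 1 - (n - 2 + 1) = 0)%N by lia.
    by rewrite /= eqxx /= !ifN //; lia.
have g_lt k : (k < n)%N -> (g k < n)%N by rewrite /g; do !case: eqP; lia.
have g_inj a b : (a < n)%N -> (b < n)%N -> g a = g b -> a = b.
  by rewrite /g; do !case: eqP; lia.
split.
  apply: (specht_w_transverse rowE colE gE g_lt g_inj) => //=; rewrite /row /g /col.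
  - by move=> i; do !case: eqP; lia.
  - by move=> i a b; do !case: eqP; lia.
  - by move=> a b; do !case: eqP; lia.
apply: (@specht_w_unique n _ _ _ _ rowE colE gE g_lt g_inj (n - 2)%N) => //=; rewrite /row /g /col; try lia.
move=> f flt fsurj finj fcol frow fcl k kn.
have mid a : (1 <= a < n - 2)%N -> f a = a.+2 by move=> ha; have := fcol a; lia.
have [a0 a0n e0] := fsurj 0%N ltac:(lia); have [a1 a1n e1] := fsurj 1%N ltac:(lia).
have [a2 a2n e2] := fsurj 2%N ltac:(lia).
have := fcl a0 a1 a0n a1n; rewrite e0 e1 => /(_ erefl erefl) lt01.
have := fcl a1 a2 a1n a2n; rewrite e1 e2 => /(_ erefl erefl) lt12.
have f0 : (f 0 < 3)%N by have := fcol 0%N; lia.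
have n0 : (0 < n)%N by lia.
(* The values 0, 1, 2 of the first column can only be taken at 0, n - 2, n - 1, and they are taken
   in increasing order. *)
have o c a : (c < 3)%N -> (a < n)%N -> f a = c -> [|| a == 0, a == n - 2 | a == n - 1]%N.
  by move=> c3 an fa; have := mid a; lia.
have := o _ _ _ a0n e0; have := o _ _ _ a1n e1; have := o _ _ _ a2n e2.
move=> /(_ isT) o2 /(_ isT) o1 /(_ isT) o0.
have x0 : a0 = 0%N by lia.
have x1 : a1 = (n - 2)%N by lia.
have x2 : a2 = (n - 1)%N by lia.
have := mid k.
rewrite x0 in e0; rewrite x1 in e1; rewrite x2 in e2.
case: eqP => [->|k0]; first by rewrite e0.
case: eqP => [->|k1]; first by rewrite e1.
by case: eqP => [->|k2]; [rewrite e2 | lia].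
Qed.

End FourShapes.

(** * The Lawrence-Krammer space and its linear forms *)

Section LKForms.
Variables (F : fieldType) (n : nat) (l r : F).
Hypotheses (l0 : l != 0) (r0 : r != 0).

Let m : F := r^-1 - r.
Let t : F := r ^+ 3 / l.

Local Notation V := (lk_space F n).
Local Notation nu := (@lk_nu F n l r).
Implicit Types (u v : V) (c d : nat -> nat -> F) (i : 'I_n.-1).

(** Linear forms are handled through coefficient functions of two natural numbers: an identity
    between forms becomes one between coefficients, with the position of a and b relative to i as
    cases. *)
Definition lk_pair c v : F := \sum_(p : lk_index n) v p * c (val p).1 (val p).2.

Lemma lk_pairD c u v : lk_pair c (u + v) = lk_pair c u + lk_pair c v.
Proof. by rewrite -big_split; apply: eq_bigr => p _; rewrite ffunE mulrDl. Qed.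

Lemma lk_pairZ c x v : lk_pair c (x *: v) = x * lk_pair c v.
Proof. by rewrite mulr_sumr; apply: eq_bigr => p _; rewrite ffunE mulrA. Qed.

Lemma lk_pairB c u v : lk_pair c (u - v) = lk_pair c u - lk_pair c v.
Proof. by rewrite lk_pairD -scaleN1r lk_pairZ mulN1r. Qed.

Lemma lk_pair0 c : lk_pair c 0 = 0.
Proof. by rewrite -(scale0r (0 : V)) lk_pairZ mul0r. Qed.

Lemma lk_pair_sum c (I : finType) (P : pred I) (f : I -> V) :
  lk_pair c (\sum_(j | P j) f j) = \sum_(j | P j) lk_pair c (f j).
Proof.
by apply: (big_morph (lk_pair c)) => [u v|]; rewrite ?lk_pairD ?lk_pair0.
Qed.

Definition lk_pair_fun c v : F^o := lk_pair c v.

Fact lk_pair_fun_is_linear c : linear (lk_pair_fun c).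
Proof. by move=> x u v; rewrite /lk_pair_fun lk_pairD lk_pairZ. Qed.

HB.instance Definition _ c :=
  GRing.isLinear.Build F V F^o _ (lk_pair_fun c) (lk_pair_fun_is_linear c).

Definition lk_form c : 'Hom(V, F^o) := linfun (lk_pair_fun c).

Lemma lk_formE c v : lk_form c v = lk_pair c v. Proof. by rewrite lfunE. Qed.

Lemma eq_lk_pair c d v : (forall a b, (a < b)%N -> (b < n)%N -> c a b = d a b) ->
  lk_pair c v = lk_pair d v.
Proof. by move=> cd; apply: eq_bigr => -[[a b] ab] _; rewrite /= cd. Qed.

Lemma lk_pairDl c d v :
  lk_pair (fun a b => c a b + d a b) v = lk_pair c v + lk_pair d v.
Proof. by rewrite -big_split; apply: eq_bigr => p _; rewrite mulrDr. Qed.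

Lemma lk_pairZl c x v : lk_pair (fun a b => x * c a b) v = x * lk_pair c v.
Proof. by rewrite mulr_sumr; apply: eq_bigr => p _; rewrite mulrCA. Qed.

Lemma lk_pair_suml (I : finType) (P : pred I) (f : I -> nat -> nat -> F) v :
  lk_pair (fun a b => \sum_(j | P j) f j a b) v = \sum_(j | P j) lk_pair (f j) v.
Proof. by rewrite exchange_big; apply: eq_bigr => p _; rewrite mulr_sumr. Qed.

Definition lk_delta (s k a b : nat) : F := ((a == s) && (b == k))%:R.

Definition lk_co (s k : nat) v := lk_pair (lk_delta s k) v.

Lemma lk_coB s k u v : lk_co s k (u - v) = lk_co s k u - lk_co s k v.
Proof. exact: lk_pairB. Qed.

Lemma lk_coD s k u v : lk_co s k (u + v) = lk_co s k u + lk_co s k v.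
Proof. exact: lk_pairD. Qed.

Lemma lk_coZ s k x v : lk_co s k (x *: v) = x * lk_co s k v.
Proof. exact: lk_pairZ. Qed.

Lemma lk_co_index (p : lk_index n) v : lk_co (val p).1 (val p).2 v = v p.
Proof.
rewrite /lk_co /lk_pair (bigD1 p) //= big1 ?addr0; first by rewrite /lk_delta !eqxx mulr1.
move=> [[a b] ab] ne; rewrite /lk_delta; case: andP => [[/eqP e1 /eqP e2]|]; last by rewrite mulr0.
case/eqP: ne; apply: val_inj => /=; case: p e1 e2 => [[a' b'] ab'] /= e1 e2.
by congr pair; apply: val_inj.
Qed.

Lemma lk_co_eq u v : (forall s k, (s < k < n)%N -> lk_co s k u = lk_co s k v) -> u = v.
Proof.
move=> h; apply/ffunP => p; rewrite -!lk_co_index; apply: h.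
by case: p => [[a b] ab] /=; rewrite ltn_ord andbT.
Qed.

Lemma lk_pair_co c v : lk_pair c v = \sum_(p : lk_index n) lk_co (val p).1 (val p).2 v * c (val p).1 (val p).2.
Proof. by apply: eq_bigr => p _; rewrite lk_co_index. Qed.

Definition lk_vec c : V := [ffun p : lk_index n => c (val p).1 (val p).2].

Lemma lk_co_vec (s k : nat) c : (s < k < n)%N -> lk_co s k (lk_vec c) = c s k.
Proof.
move=> /andP[sk kn]; have sn := ltn_trans sk kn.
pose p : lk_index n := Sub (Ordinal sn, Ordinal kn) sk.
by rewrite -[s]/(nat_of_ord (val p).1) -[k in lk_co _ k]/(nat_of_ord (val p).2) lk_co_index ffunE.
Qed.

Lemma lk_pair_w c (s k : nat) : (s < k < n)%N -> lk_pair c (lk_w F n s k) = c s k.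
Proof.
move=> skn; rewrite /lk_pair.
transitivity (lk_co s k (lk_vec c)); last exact: lk_co_vec.
by apply: eq_bigr => p _; rewrite !ffunE mulrC.
Qed.

(** The transpose of nu_i on coefficient functions. Powers whose exponent is a difference are
    written as quotients, which avoids truncated subtraction, and 1/l as t / r^3. *)
Definition lk_adj (i : nat) c (a b : nat) : F :=
  if (a == i) && (b == i.+1) then t / r ^+ 3 * c i i.+1
  else if b == i then c a i.+1
  else if a == i.+1 then c i b + m * (r ^+ b / r ^+ i.+2) * c i i.+1 - m * c i.+1 b
  else if b == i.+1 then c a i + m * (t / r ^+ 3 * r ^+ a.+1 / r ^+ i) * c i i.+1 - m * c a i.+1
  else if a == i then c i.+1 b
  else r * c a b.

Lemma expr_ratio k j : (j <= k)%N -> r ^+ (k - j) = r ^+ k / r ^+ j.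
Proof.
by move=> jk; rewrite -[in RHS](subnK jk) exprD mulfK // expf_neq0.
Qed.

Lemma lk_pair_nu_w (i : nat) c a b : (i.+1 < n)%N -> (a < b < n)%N ->
  lk_pair c (lk_nu_w n l r i a b) = lk_adj i c a b.
Proof.
move=> i1 /andP[ab bn]; have tE : t / r ^+ 3 = l^-1 by rewrite /t; field; rewrite l0 r0.
rewrite /lk_nu_w /lk_adj.
case: andP => [[/eqP e1 /eqP e2]|h1]; first by rewrite lk_pairZ lk_pair_w ?tE //; lia.
case: (eqVneq b i) => [e|h2]; first by rewrite lk_pair_w //; lia.
case: (eqVneq a i.+1) => [e|h3].
  rewrite lk_pairB lk_pairD !lk_pairZ !lk_pair_w; try lia.
  have -> : (b - i - 2 = b - i.+2)%N by lia.
  by rewrite expr_ratio //; lia.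
case: (eqVneq b i.+1) => [e|h4].
  have ai : (a < i)%N by case: (eqVneq a i) => [e'|]; [case: h1; rewrite e e' !eqxx | lia].
  rewrite lk_pairB lk_pairD !lk_pairZ !lk_pair_w; try lia.
  have -> : (i - a - 1 = i - a.+1)%N by lia.
  rewrite expr_ratio // tE; congr (_ + _ * _ - _); rewrite /m.
  have := expf_neq0 a.+1 r0; have := expf_neq0 i r0.
  by move: (r ^+ a.+1) (r ^+ i) => X Y Y0 X0; field; rewrite r0 l0 X0 Y0.
case: (eqVneq a i) => [e|h5].
  by rewrite lk_pair_w //; case: (eqVneq b i.+1) => [e'|]; [case: h1; rewrite e e' !eqxx | lia].
by rewrite lk_pairZ lk_pair_w ?ab.
Qed.

Lemma lk_pair_nu i c v : lk_pair c (nu i v) = lk_pair (lk_adj i c) v.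
Proof.
rewrite lfunE /= /lk_nu_fun lk_pair_sum; apply: eq_bigr => p _; rewrite lk_pairZ.
rewrite lk_pair_nu_w //; first exact: strandS_lt.
by case: p => [[a b] ab] /=; rewrite ab ltn_ord.
Qed.

(** Chosen so that the coordinate of nu_i v at (i, i + 1) is t/r v_{i,i+1} + m/r R_{i+1}(v), see
    [lk_co_nu_diag]. *)
Definition lk_rowc (j a b : nat) : F :=
  if a == j then r ^+ b / r ^+ j else if b == j then t * r ^+ a / r ^+ j else 0.

Definition lk_row j v := lk_pair (lk_rowc j) v.

Definition lk_defect (i : nat) v : F :=
  (t - r ^+ 2) * (t + 1) * lk_co i i.+1 v
  + (1 - r ^+ 2) * (r * lk_row i v + t / r * lk_row i.+1 v).

Ltac split_eqs := repeat first [case: eqP => [?|?] /=; try (exfalso; lia)].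

Ltac lk_field := subst; rewrite ?exprS ?expr0 /m;
  repeat match goal with |- context [r ^+ ?k] =>
    let X := fresh in let X0 := fresh in have X0 := expf_neq0 k r0;
    move: (r ^+ k) X0 => X X0 end;
  field; repeat (apply/andP; split); done.

Lemma lk_co_nu_diag i v :
  lk_co i i.+1 (nu i v) = t / r * lk_co i i.+1 v + m / r * lk_row i.+1 v.
Proof.
rewrite /lk_co /lk_row lk_pair_nu -!lk_pairZl -lk_pairDl; apply: eq_lk_pair => a b ab bn.
rewrite /lk_adj /lk_rowc /lk_delta !eqxx; split_eqs; lk_field.
Qed.

Lemma lk_co_nu_l i (s : nat) v : (s < i)%N -> lk_co s i (nu i v) = lk_co s i.+1 v.
Proof.
move=> si; rewrite /lk_co lk_pair_nu; apply: eq_lk_pair => a b ab bn.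
rewrite /lk_adj /lk_delta; split_eqs; lk_field.
Qed.

Lemma lk_co_nu_l1 i (s : nat) v : (s < i)%N ->
  lk_co s i.+1 (nu i v) = lk_co s i v - m * lk_co s i.+1 v.
Proof.
move=> si; rewrite /lk_co lk_pair_nu -mulNr -lk_pairZl -lk_pairDl; apply: eq_lk_pair => a b ab bn.
rewrite /lk_adj /lk_delta; split_eqs; lk_field.
Qed.

Lemma lk_co_nu_r i (k : nat) v : (i.+1 < k)%N -> lk_co i k (nu i v) = lk_co i.+1 k v.
Proof.
move=> si; rewrite /lk_co lk_pair_nu; apply: eq_lk_pair => a b ab bn.
rewrite /lk_adj /lk_delta; split_eqs; lk_field.
Qed.

Lemma lk_co_nu_r1 i (k : nat) v : (i.+1 < k)%N ->
  lk_co i.+1 k (nu i v) = lk_co i k v - m * lk_co i.+1 k v.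
Proof.
move=> si; rewrite /lk_co lk_pair_nu -mulNr -lk_pairZl -lk_pairDl; apply: eq_lk_pair => a b ab bn.
rewrite /lk_adj /lk_delta; split_eqs; lk_field.
Qed.

Lemma lk_co_nu_out i (s k : nat) v :
  [&& s != i, s != i.+1, k != i & k != i.+1] ->
  lk_co s k (nu i v) = r * lk_co s k v.
Proof.
move=> /and4P[h1 h2 h3 h4].
rewrite /lk_co lk_pair_nu -lk_pairZl; apply: eq_lk_pair => a b ab bn.
rewrite /lk_adj /lk_delta; split_eqs; lk_field.
Qed.

Lemma lk_row_nu_l i v : lk_row i (nu i v) = lk_row i.+1 v / r.
Proof.
rewrite /lk_row lk_pair_nu [RHS]mulrC -lk_pairZl; apply: eq_lk_pair => a b ab bn.
rewrite /lk_adj /lk_rowc ?eqxx; split_eqs; lk_field.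
Qed.

Lemma lk_row_nu_out i (j : nat) v : j != i -> j != i.+1 -> lk_row j (nu i v) = r * lk_row j v.
Proof.
move=> ji ji1; rewrite /lk_row lk_pair_nu -lk_pairZl; apply: eq_lk_pair => a b ab bn.
rewrite /lk_adj /lk_rowc ?eqxx; split_eqs; lk_field.
Qed.

(** With [lk_row_nu_l] and [lk_row_nu_out]: wherever the defects vanish, nu_i carries rows to
    combinations of rows. *)
Lemma lk_row_nu_r i v :
  lk_row i.+1 (nu i v) = r * lk_row i v - m * lk_row i.+1 v + lk_defect i v / r ^+ 2.
Proof.
transitivity (lk_pair (fun a b => (r + (1 - r ^+ 2) / r) * lk_rowc i a b
  + (- m + (1 - r ^+ 2) * t / r ^+ 3) * lk_rowc i.+1 a b
  + (t - r ^+ 2) * (t + 1) / r ^+ 2 * lk_delta i i.+1 a b) v).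
  rewrite /lk_row lk_pair_nu; apply: eq_lk_pair => a b ab bn.
  rewrite /lk_adj /lk_rowc /lk_delta !eqxx; split_eqs; lk_field.
rewrite 2!lk_pairDl !lk_pairZl /lk_defect /lk_row /lk_co.
by move: (lk_pair _ v) (lk_pair _ v) (lk_pair _ v) => x y z; rewrite /m; field.
Qed.

Lemma lk_nu_quad i v :
  nu i (nu i v) + m *: nu i v - v = (lk_defect i v / r ^+ 4) *: lk_w F n i i.+1.
Proof.
have i1 := strandS_lt i; apply: lk_co_eq => s k /andP[sk kn].
rewrite lk_coB lk_coD !lk_coZ [lk_co s k (lk_w _ _ _ _)]lk_pair_w; last by rewrite ltnSn.
rewrite /lk_delta.
have [e|si] := eqVneq s i; last have [e|si1] := eqVneq s i.+1.
- subst s; have [->|ki] := eqVneq k i.+1.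
    rewrite /= ?eqxx mulr1 !lk_co_nu_diag lk_row_nu_r /lk_defect.
    move: (lk_co _ _ _) (lk_row _ _) (lk_row _ _) => x y z; rewrite /m.
    by field.
  rewrite /= ?eqxx /= ?mulr0.
  have ik : (i.+1 < k)%N by lia.
  rewrite !lk_co_nu_r // lk_co_nu_r1 //.
  by move: (lk_co _ _ _) (lk_co _ _ _) => x y; rewrite /m; ring.
- subst s; rewrite !lk_co_nu_r1 // lk_co_nu_r //.
  rewrite /= ?mulr0 ?lk_co_nu_r1 //.
  by move: (lk_co _ _ _) (lk_co _ _ _) => x y; rewrite /m; ring.
rewrite /= ?mulr0.
have [e|ki] := eqVneq k i; last have [e|ki1] := eqVneq k i.+1.
- subst k; rewrite !lk_co_nu_l // lk_co_nu_l1 //.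
  by move: (lk_co _ _ _) (lk_co _ _ _) => x y; rewrite /m; ring.
- subst k; have si' : (s < i)%N by lia.
  rewrite !lk_co_nu_l1 // lk_co_nu_l //.
  by move: (lk_co _ _ _) (lk_co _ _ _) => x y; rewrite /m; ring.
have out : [&& s != i, s != i.+1, k != i & k != i.+1] by apply/and4P.
rewrite !lk_co_nu_out //.
by move: (lk_co _ _ _) => x; rewrite /m; field.
Qed.
End LKForms.

(** * Braid relations, invariant subspaces and defects *)

Section LKRepresentation.
Variables (F : fieldType) (n : nat) (l r : F).
Hypotheses (l0 : l != 0) (r0 : r != 0).

Let m : F := r^-1 - r.
Let t : F := r ^+ 3 / l.

Local Notation V := (lk_space F n).
Local Notation nu := (@lk_nu F n l r).
Implicit Types (u v : V) (c d : nat -> nat -> F) (i j : 'I_n.-1) (U : {vspace V}).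

Ltac split_eqs := repeat first [case: eqP => [?|?] /=; try (exfalso; lia)].

Ltac lk_field := subst; rewrite ?exprS ?expr0 /m;
  repeat match goal with |- context [r ^+ ?k] =>
    let X := fresh in let X0 := fresh in have X0 := expf_neq0 k r0;
    move: (r ^+ k) X0 => X X0 end;
  field; repeat (apply/andP; split); done.

Lemma lk_adj_braid (i : nat) c a b : (a < b)%N ->
  lk_adj l r i (lk_adj l r i.+1 (lk_adj l r i c)) a b =
  lk_adj l r i.+1 (lk_adj l r i (lk_adj l r i.+1 c)) a b.
Proof.
move=> ab; rewrite /lk_adj -/t -/m.
have -> : (i == i.+1) = false by lia.
have -> : (i.+1 == i) = false by lia.
have -> : (i.+2 == i.+1) = false by lia.
have -> : (i.+1 == i.+2) = false by lia.
have -> : (i.+2 == i) = false by lia.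
have -> : (i == i.+2) = false by lia.
rewrite !eqxx /=.
split_eqs; lk_field.
Qed.

Lemma lk_adj_commute (i j : nat) c a b : (i.+1 < j)%N -> (a < b)%N ->
  lk_adj l r i (lk_adj l r j c) a b = lk_adj l r j (lk_adj l r i c) a b.
Proof.
move=> ij ab; rewrite /lk_adj -/t -/m.
have -> : (i == j) = false by lia.
have -> : (i == j.+1) = false by lia.
have -> : (i.+1 == j) = false by lia.
have -> : (i.+1 == j.+1) = false by lia.
have -> : (j == i) = false by lia.
have -> : (j == i.+1) = false by lia.
have -> : (j.+1 == i) = false by lia.
have -> : (j.+1 == i.+1) = false by lia.
rewrite /=.
split_eqs; lk_field.
Qed.

Lemma lk_nu_braid i j v : j = i.+1 :> nat -> nu i (nu j (nu i v)) = nu j (nu i (nu j v)).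
Proof.
move=> ij; apply: lk_co_eq => s k skn.
rewrite /lk_co 6!(lk_pair_nu l0 r0) ij.
by apply: eq_lk_pair => a b ab _; rewrite lk_adj_braid.
Qed.

Lemma lk_nu_commute i j v : (i.+1 < j)%N -> nu i (nu j v) = nu j (nu i v).
Proof.
move=> ij; apply: lk_co_eq => s k skn; rewrite /lk_co 4!(lk_pair_nu l0 r0).
by apply: eq_lk_pair => a b ab _; rewrite (lk_adj_commute _ ij ab).
Qed.

Let co_nu_diag := @lk_co_nu_diag F n l r l0 r0.
Let co_nu_l := @lk_co_nu_l F n l r l0 r0.
Let co_nu_l1 := @lk_co_nu_l1 F n l r l0 r0.
Let co_nu_r := @lk_co_nu_r F n l r l0 r0.
Let co_nu_r1 := @lk_co_nu_r1 F n l r l0 r0.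
Let co_nu_out := @lk_co_nu_out F n l r l0 r0.

(** All coordinates except the one at (i, i + 1) are recovered directly. Then R_{i+1}(v) reduces to
    its term in that coordinate, whose total coefficient is t / r^3 = 1/l. *)
Lemma lk_nu_inj i v : nu i v = 0 -> v = 0.
Proof.
move=> v0; have z s k : lk_co s k (nu i v) = 0 by rewrite v0 [LHS]lk_pair0.
have z0 s k : lk_co s k (0 : V) = 0 by exact: lk_pair0.
have out s k : (s < k < n)%N -> (s, k) != (val i, i.+1) -> lk_co s k v = 0.
  move=> /andP[sk kn]; rewrite xpair_eqE => ne.
  have [e|si] := eqVneq s i.
    subst s; have ik : (i.+1 < k)%N by move: ne; rewrite eqxx /=; lia.
    by have := z i.+1 k; rewrite co_nu_r1 // -co_nu_r // z mulr0 subr0.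
  have [e|si1] := eqVneq s i.+1; first by subst s; rewrite -co_nu_r // z.
  have [e|ki] := eqVneq k i.
    subst k; have := z s i.+1; rewrite co_nu_l1 // -co_nu_l // z mulr0 subr0 //.
  have [e|ki1] := eqVneq k i.+1; first by subst k; rewrite -co_nu_l ?z //; lia.
  have /eqP := z s k; rewrite co_nu_out ?si ?si1 ?ki ?ki1 //.
  by rewrite mulf_eq0 (negPf r0) => /eqP.
have row0 : lk_row l r i.+1 v = t * r ^+ i / r ^+ i.+1 * lk_co i i.+1 v.
  rewrite /lk_row lk_pair_co [in RHS]/lk_co lk_pair_co mulr_sumr; apply: eq_bigr => p _.
  have [e|ne] := eqVneq (val (val p).1, val (val p).2) (val i, i.+1).
    case: e => -> ->; rewrite /lk_rowc /lk_delta !eqxx -/t /=.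
    by case: eqP => [|_]; [lia | ring].
  by rewrite out ?ltn_ord ?andbT ?mul0r ?mulr0 //; case: (p).
apply: lk_co_eq => s k skn; rewrite z0.
have [[-> ->]|] := eqVneq (s, k) (val i, i.+1); last exact: out.
have := z i i.+1; rewrite co_nu_diag // row0 -/t -/m => h; apply/eqP.
have : (t / r ^+ 3) * lk_co i i.+1 v = 0.
  rewrite -h (exprS r i); have := expf_neq0 i r0; move: (r ^+ i) => X X0.
  by rewrite /m; field; rewrite X0 r0.
have c0 : t / r ^+ 3 != 0 by rewrite !mulf_neq0 ?invr_eq0 ?expf_neq0.
by move/eqP; rewrite mulf_eq0 (negPf c0).
Qed.

Lemma lk_nu_w_eq i (s k : nat) : (s < k < n)%N -> nu i (lk_w F n s k) = lk_nu_w n l r i s k.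
Proof.
move=> /andP[sk kn]; have sn := ltn_trans sk kn.
pose p : lk_index n := Sub (Ordinal sn, Ordinal kn) sk.
exact: (lk_nuE l r i p).
Qed.

(** An injective endomorphism maps a finite-dimensional U onto itself. Membership can thus be pulled
    back along the generators. *)
Lemma invariant_mem U i v : lk_invariant l r U -> (nu i v \in U) = (v \in U).
Proof.
move=> inv; apply/idP/idP => [|vU]; last by apply: (subvP (inv i)); apply: memv_img.
have ker0 : lker (nu i) == 0%VS.
  apply/eqP/vspaceP => u; rewrite memv_ker memv0.
  by apply/eqP/eqP => [/lk_nu_inj//|->]; rewrite linear0.
have /eqP e : (nu i @: U == U)%VS.
  by rewrite eqEdim inv limg_dim_eq ?(eqP ker0) ?capv0 /=.
by rewrite -{1}e => /memv_imgP[u uU /(lker0P ker0) ->].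
Qed.

(** nu_b sends w_{a,b} to w_{a,b+1} and nu_a sends it to w_{a+1,b} when b > a + 1. Going back and
    forth, all basis vectors are linked to w_{0,n-1}. *)
Lemma invariant_w U (s k s' k' : nat) : lk_invariant l r U -> (s < k < n)%N -> (s' < k' < n)%N ->
  lk_w F n s k \in U -> lk_w F n s' k' \in U.
Proof.
move=> inv h h' wU.
have up (a b : nat) : (a < b)%N -> (b.+1 < n)%N -> (lk_w F n a b.+1 \in U) = (lk_w F n a b \in U).
  move=> ab bn; have b1 : (b < n.-1)%N by lia.
  rewrite -[RHS](@invariant_mem _ (Ordinal b1)) // lk_nu_w_eq ?ab /lk_nu_w /= ?eqxx; last lia.
  by rewrite ifN //; lia.
have lo (a b : nat) : (a.+1 < b)%N -> (b < n)%N -> (lk_w F n a.+1 b \in U) = (lk_w F n a b \in U).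
  move=> ab bn; have b1 : (a < n.-1)%N by lia.
  rewrite -[RHS](@invariant_mem _ (Ordinal b1)) // lk_nu_w_eq /lk_nu_w /= ?eqxx; last lia.
  by do 4 (rewrite ifN; last lia).
have ups (a b d : nat) : (a < b)%N -> (b + d < n)%N -> (lk_w F n a (b + d)%N \in U) = (lk_w F n a b \in U).
  elim: d => [|d IH] ab bdn; first by rewrite addn0.
  by rewrite addnS up ?IH //; lia.
have los (a b : nat) : (a < b)%N -> (b < n)%N -> (lk_w F n a b \in U) = (lk_w F n 0 b \in U).
  by elim: a => // a IH ab bn; rewrite lo ?IH //; lia.
have all (a b : nat) : (a < b < n)%N -> (lk_w F n a b \in U) = (lk_w F n 0 n.-1 \in U).
  move=> abn; rewrite -(ups a b (n.-1 - b)%N); try lia.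
  have -> : (b + (n.-1 - b) = n.-1)%N by lia.
  by apply: los; lia.
by rewrite all // -(all s k).
Qed.

Lemma invariant_full U (s k : nat) : lk_invariant l r U -> (s < k < n)%N ->
  lk_w F n s k \in U -> U = fullv.
Proof.
move=> inv skn wU; apply/vspaceP => v; rewrite memvf.
have -> : v = \sum_(p : lk_index n) v p *: lk_w F n (val p).1 (val p).2.
  apply: lk_co_eq => a b abn; rewrite /lk_co lk_pair_sum; apply: eq_bigr => p _.
  rewrite lk_pairZ lk_pair_w //; by case: p => [[x y] xy] /=; rewrite xy ltn_ord.
apply: memv_suml => p _; apply: memvZ; apply: invariant_w wU => //.
by case: p => [[x y] xy] /=; rewrite xy ltn_ord.
Qed.

(** For n >= 3 and r^2 <> 1 the nonzero subspaces of this kind are the proper invariant ones, by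
    [proper_defect_free] and [defect_free_proper]. *)
Definition lk_defect_free U :=
  lk_invariant l r U /\ forall i u, u \in U -> lk_defect l r i u = 0.

Lemma proper_defect_free U : lk_proper_invariant l r U -> lk_defect_free U.
Proof.
case=> inv _ nf; split=> // i u uU; apply: contraNeq nf => d0; apply/eqP.
apply: (@invariant_full _ i i.+1) => //; first by rewrite ltnSn strandS_lt.
have : nu i (nu i u) + m *: nu i u - u \in U.
  by rewrite memvB ?memvD ?memvZ ?invariant_mem.
rewrite lk_nu_quad // => h.
have c0 : lk_defect l r i u / r ^+ 4 != 0 by rewrite mulf_neq0 ?invr_eq0 ?expf_neq0.
by rewrite -[lk_w _ _ _ _]scale1r -(mulVf c0) -scalerA memvZ.
Qed.

Lemma defect_free_module U : lk_defect_free U -> hecke_module r nu U.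
Proof.
case=> inv def; split; [exact: inv|move=> i u uU|move=> i j u ij _|move=> i j u ij _].
- have := lk_nu_quad l0 r0 i u; rewrite def // mul0r scale0r => /eqP.
  by rewrite subr_eq0 => /eqP.
- exact: lk_nu_braid.
- exact: lk_nu_commute.
Qed.

(* lk_defect i (w_{i+1,i+2}) is a nonzero multiple of t. *)
Lemma defect_free_proper U : (3 <= n)%N -> r ^+ 2 != 1 -> lk_defect_free U -> U != 0%VS ->
  lk_proper_invariant l r U.
Proof.
move=> n3 r21 [inv def] U0; split=> //; apply/eqP => Uf.
have i0 : (0 < n.-1)%N by lia.
have := def (Ordinal i0) (lk_w F n 1 2); rewrite Uf memvf => /(_ isT).
rewrite /lk_defect /lk_co /lk_row !lk_pair_w // /lk_delta /lk_rowc /=.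
rewrite !mulr0 !add0r -/t => /eqP; apply/negP.
by rewrite !mulf_neq0 ?invr_eq0 ?expf_neq0 // subr_eq0 eq_sym.
Qed.

End LKRepresentation.

(** * Proper invariant subspaces *)

Section GeometricSums.
Variables (F : fieldType) (n : nat) (r : F).

(** Partial sums are cut out by a condition inside a sum over ['I_n], the form in which [lk_row_sum]
    produces them. *)
Lemma sum_sqr_lt j : (1 - r ^+ 2) * (\sum_(k < n) if (k < j)%N then (r ^+ k) ^+ 2 else 0)
  = 1 - (r ^+ minn j n) ^+ 2.
Proof.
elim: n => [|N IH]; first by rewrite big_ord0 minn0; ring.
rewrite big_ord_recr /= mulrDr IH.
have [h|h] := boolP (N < j)%N.
  have -> : minn j N = N by nat_lia.
  have -> : minn j N.+1 = N.+1 by nat_lia.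
  by rewrite (exprS r N); ring.
have -> : minn j N = j by nat_lia.
have -> : minn j N.+1 = j by nat_lia.
by ring.
Qed.

Lemma sum_sqr_gt j : (j < n)%N ->
  (1 - r ^+ 2) * (\sum_(k < n) if (j < k)%N then (r ^+ k) ^+ 2 else 0)
  = (r ^+ j.+1) ^+ 2 - (r ^+ n) ^+ 2.
Proof.
move=> jn; have [N ->] : exists N, n = (j.+1 + N)%N by exists (n - j.+1)%N; nat_lia.
elim: N => [|N IH].
  by rewrite addn0 big1 ?mulr0 ?subrr // => k _; rewrite ltnNge -ltnS ltn_ord.
rewrite addnS big_ord_recr /= mulrDr IH ifT; last nat_lia.
by rewrite [r ^+ (_ + N).+1]exprS; ring.
Qed.

Hypothesis n3 : (3 <= n)%N.
Hypothesis rn : forall k, (1 <= k <= n)%N -> (r ^+ k) ^+ 2 != 1.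

Lemma sqr_neq1 : r ^+ 2 != 1.
Proof. by have := @rn 1%N; rewrite expr1; apply; nat_lia. Qed.

Lemma sqr_neqN1 : r ^+ 2 != -1.
Proof.
apply/eqP => h; have : (r ^+ 2) ^+ 2 != 1 by apply: rn; nat_lia.
by rewrite h sqrrN expr1n eqxx.
Qed.

Lemma geom_neq0 j : (1 <= j <= n)%N -> \sum_(k < n) (if (k < j)%N then (r ^+ k) ^+ 2 else 0) != 0.
Proof.
move=> jn; have h := sum_sqr_lt j; apply/eqP => e; move: h; rewrite e mulr0 => /esym/eqP.
have -> : minn j n = j by nat_lia.
by rewrite subr_eq0 eq_sym (negPf (rn jn)).
Qed.

End GeometricSums.

(** * Coordinates expressed through the rows *)

Section RowSums.
Variables (F : fieldType) (n : nat) (l r : F).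
Hypotheses (l0 : l != 0) (r0 : r != 0).

Let t : F := r ^+ 3 / l.
Let D : F := (t - r ^+ 2) * (t + 1).

Local Notation V := (lk_space F n).
Local Notation nu := (@lk_nu F n l r).
Local Notation row := (lk_row l r).
Implicit Types (u v : V) (i : 'I_n.-1) (U : {vspace V}) (g : nat -> F).

Let row_nu_l := @lk_row_nu_l F n l r l0 r0.
Let row_nu_out := @lk_row_nu_out F n l r l0 r0.
Let co_nu_l := @lk_co_nu_l F n l r l0 r0.

Lemma lk_rowB j u v : row j (u - v) = row j u - row j v. Proof. exact: lk_pairB. Qed.
Lemma lk_rowD j u v : row j (u + v) = row j u + row j v. Proof. exact: lk_pairD. Qed.
Lemma lk_rowZ j x v : row j (x *: v) = x * row j v. Proof. exact: lk_pairZ. Qed.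
Lemma lk_row0 j : row j (0 : V) = 0. Proof. exact: lk_pair0. Qed.
Lemma lk_co0 s k : lk_co s k (0 : V) = 0. Proof. exact: lk_pair0. Qed.

Lemma lk_row_sum j v : row j v = \sum_(k < n)
  (if (j < k)%N then r ^+ k / r ^+ j * lk_co j k v
   else if (k < j)%N then t * r ^+ k / r ^+ j * lk_co k j v else 0).
Proof.
pose f (k : 'I_n) (a b : nat) : F :=
  if (j < k)%N then r ^+ k / r ^+ j * lk_delta F j k a b
  else if (k < j)%N then t * r ^+ k / r ^+ j * lk_delta F k j a b else 0 * lk_delta F k j a b.
transitivity (\sum_(k < n) lk_pair (f k) v); last first.
  by apply: eq_bigr => k _; rewrite /f; do !case: ifP => _; rewrite lk_pairZl ?mul0r.
rewrite -lk_pair_suml; apply: eq_lk_pair => a b ab bn; rewrite /lk_rowc -/t.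
have an := ltn_trans ab bn.
have [e|aj] := eqVneq a j.
  subst a; rewrite (bigD1 (Ordinal bn)) //= {1}/f ab /lk_delta !eqxx mulr1.
  rewrite big1 ?addr0 // => k; rewrite -val_eqE /= => kb; rewrite /f /lk_delta.
  rewrite (negPf (_ : b != k)) ?andbF ?mulr0; last by rewrite eq_sym.
  case: ifP => // jk; case: ifP => // kj; rewrite ?mulr0 ?mul0r //.
  by rewrite (_ : (j == k) = false) ?mulr0 //; apply/negbTE; nat_lia.
have [e|bj] := eqVneq b j.
  subst b; rewrite (bigD1 (Ordinal an)) //= {1}/f ab ltnNge (ltnW ab) /lk_delta !eqxx mulr1 /=.
  rewrite big1 ?addr0 // => k; rewrite -val_eqE /= => kb; rewrite /f /lk_delta.
  rewrite (negPf (_ : a != k)) /= ?mulr0; last by rewrite eq_sym.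
  case: ifP => // jk; last by case: ifP; rewrite ?mulr0.
  by rewrite (negPf aj) /= mulr0.
rewrite big1 // => k _; rewrite /f /lk_delta (negPf aj) (negPf bj) andbF /=.
by do !case: ifP; rewrite ?mulr0.
Qed.

(** D times the coordinate at (s, k) of a vector with rows g whose defects vanish, see
    [defect_free_co]. *)
Definition refl_co g (s k : nat) : F :=
  - (1 - r ^+ 2) * (r ^+ k / r ^+ s * g s + t * (r ^+ s / r ^+ k) * g k).

(** Inserting [refl_co] into R_j, each g_k with k <> j gets the constant coefficient -(1 - r^2) t,
    and g_j a geometric sum on either side of j. *)
Lemma row_identity g j : (j < n)%N ->
  \sum_(k < n) (if (j < k)%N then r ^+ k / r ^+ j * refl_co g j k
     else if (k < j)%N then t * r ^+ k / r ^+ j * refl_co g k j else 0)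
  = D * g j - ((t ^+ 2 - (r ^+ n) ^+ 2) / (r ^+ j) ^+ 2 * g j
               + (1 - r ^+ 2) * t * \sum_(k < n) g k).
Proof.
move=> jn.
pose e (k : nat) : F := if (j < k)%N then (r ^+ k) ^+ 2 else 0.
pose f (k : nat) : F := if (k < j)%N then (r ^+ k) ^+ 2 else 0.
(* Fills the gap at k = j, so that the constant coefficients multiply the full sum of the g_k. *)
pose d (k : nat) : F := if k == j then (1 - r ^+ 2) * t * g j else 0.
transitivity (\sum_(k < n) (- ((1 - r ^+ 2) * t) * g k + d k
   - g j / (r ^+ j) ^+ 2 * ((1 - r ^+ 2) * e k) - t ^+ 2 * g j / (r ^+ j) ^+ 2 * ((1 - r ^+ 2) * f k))).
  apply: eq_bigr => k _; rewrite /refl_co /d /e /f.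
  have X0 := expf_neq0 k r0; have Y0 := expf_neq0 j r0.
  case: (ltngtP j k) => [jk|kj|jk]; rewrite ?jk //.
  - by field; rewrite X0 Y0.
  - by field; rewrite X0 Y0.
  - by rewrite -jk; field; rewrite Y0.
rewrite !big_split /= -!mulr_sumr !sumrN -!mulr_sumr.
rewrite sum_sqr_lt sum_sqr_gt //.
have -> : \sum_(k < n) d k = (1 - r ^+ 2) * t * g j.
  rewrite (bigD1 (Ordinal jn)) //= /d eqxx big1 ?addr0 // => k.
  by rewrite -val_eqE /= => /negPf->.
have -> : minn j n = j by nat_lia.
have Y0 := expf_neq0 j r0; rewrite [r ^+ j.+1]exprS /D; move: (r ^+ j) Y0 => Y Y0.
by field.
Qed.

Definition row_total v : F := \sum_(j < n) row j v.

Lemma row_of_refl v g x : x != 0 ->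
  (forall s k, (s < k < n)%N -> x * lk_co s k v = refl_co g s k) ->
  forall j, (j < n)%N ->
  x * row j v = D * g j - ((t ^+ 2 - (r ^+ n) ^+ 2) / (r ^+ j) ^+ 2 * g j
               + (1 - r ^+ 2) * t * \sum_(k < n) g k).
Proof.
move=> x0 h j jn; rewrite -row_identity // lk_row_sum mulr_sumr; apply: eq_bigr => k _.
case: ifP => jk; first by rewrite -h ?jk ?ltn_ord //; ring.
by case: ifP => kj; [rewrite -h ?kj ?jn //; ring | rewrite mulr0].
Qed.

Section DefectFree.
Variable U : {vspace V}.
Hypothesis dfU : lk_defect_free l r U.

Let nuU i u : u \in U -> nu i u \in U.
Proof. by move=> uU; rewrite invariant_mem //; case: dfU. Qed.

(** For k = s + 1 this is the vanishing of the defect at s. To pass from k to k + 1, apply the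
    formula to nu_k u, whose coordinate at (s, k) is that of u at (s, k + 1). *)
Lemma defect_free_co u s k : u \in U -> (s < k < n)%N ->
  D * lk_co s k u = refl_co (fun j => row j u) s k.
Proof.
move=> uU /andP[sk]; have [d ->] : exists d, k = (s.+1 + d)%N by exists (k - s.+1)%N; nat_lia.
elim: d u uU => [|d IH] u uU kn.
  rewrite addn0 in kn *; have sn : (s < n.-1)%N by nat_lia.
  case: dfU => _ /(_ (Ordinal sn) u uU) /=; rewrite /lk_defect -/t -/D /= => /eqP.
  rewrite addr_eq0 => /eqP->; rewrite /refl_co (exprS r s).
  by have := expf_neq0 s r0; move: (r ^+ s) => X X0; field; rewrite X0 r0.
have dn : (s.+1 + d < n.-1)%N by nat_lia.
have kn' : (s.+1 + d < n)%N by nat_lia.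
have := IH (nu (Ordinal dn) u) (nuU _ uU) kn'.
have sd : (s < Ordinal dn)%N by rewrite /=; nat_lia.
have cl := co_nu_l u sd; rewrite /= in cl; rewrite cl.
have sl := row_nu_l (Ordinal dn) u; rewrite /= in sl.
rewrite addnS => ->.
rewrite /refl_co sl row_nu_out /=; try nat_lia.
rewrite (exprS r (s.+1 + d)).
have := expf_neq0 s r0; move: (r ^+ s) => X X0.
have := expf_neq0 (s.+1 + d) r0; move: (r ^+ (s.+1 + d)) => Y Y0.
by field; rewrite X0 Y0 r0.
Qed.

Lemma defect_free_row_eq u j : D != 0 -> u \in U -> (j < n)%N ->
  (t ^+ 2 - (r ^+ n) ^+ 2) * row j u = - ((1 - r ^+ 2) * t * (r ^+ j) ^+ 2) * row_total u.
Proof.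
move=> D0 uU jn; have := row_of_refl D0 (fun s k => defect_free_co uU) jn.
move/eqP; rewrite -subr_eq0 => /eqP h; rewrite /row_total.
have Y0 := expf_neq0 j r0; move: h; set S := \sum_(k < n) _; move: (row j u) S => G S.
move: (r ^+ j) Y0 => Y Y0 h; apply/eqP; rewrite -subr_eq0; apply/eqP.
transitivity (Y ^+ 2 * (D * G - (D * G - ((t ^+ 2 - (r ^+ n) ^+ 2) / Y ^+ 2 * G + (1 - r ^+ 2) * t * S)))).
  by field.
by rewrite h mulr0.
Qed.

Lemma defect_free_row_inj u : D != 0 -> u \in U -> (forall j, (j < n)%N -> row j u = 0) -> u = 0.
Proof.
move=> D0 uU ru; apply: lk_co_eq => s k skn; rewrite lk_co0; apply: (mulfI D0).
by rewrite (defect_free_co uU skn) mulr0 /refl_co !ru ?mulr0 ?addr0 ?mulr0 //; nat_lia.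
Qed.

End DefectFree.

End RowSums.

(** * The trivial line and the reflection module *)

Section Reflection.
Variables (F : fieldType) (n : nat) (l r : F).
Hypotheses (l0 : l != 0) (r0 : r != 0) (n3 : (3 <= n)%N).
Hypothesis rn : forall k, (1 <= k <= n)%N -> (r ^+ k) ^+ 2 != 1.

Let m : F := r^-1 - r.
Let t : F := r ^+ 3 / l.
Let D : F := (t - r ^+ 2) * (t + 1).

Local Notation V := (lk_space F n).
Local Notation nu := (@lk_nu F n l r).
Local Notation row := (lk_row l r).
Implicit Types (u v : V) (i : 'I_n.-1) (U W : {vspace V}) (g : nat -> F).

Let row_nu_l := @lk_row_nu_l F n l r l0 r0.
Let row_nu_out := @lk_row_nu_out F n l r l0 r0.
Let row_nu_r := @lk_row_nu_r F n l r l0 r0.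
Let co_nu_diag := @lk_co_nu_diag F n l r l0 r0.
Let co_nu_l := @lk_co_nu_l F n l r l0 r0.
Let co_nu_l1 := @lk_co_nu_l1 F n l r l0 r0.
Let co_nu_r := @lk_co_nu_r F n l r l0 r0.
Let co_nu_r1 := @lk_co_nu_r1 F n l r l0 r0.
Let co_nu_out := @lk_co_nu_out F n l r l0 r0.

Let r21 : 1 - r ^+ 2 != 0.
Proof. by rewrite subr_eq0 eq_sym (sqr_neq1 n3 rn). Qed.

Definition lk_trivial u := forall i, nu i u = r *: u.

(** Every common eigenvector for r is a multiple of this vector ([trivial_vectorE]), which is itself
    one exactly when t = r^{2n}. *)
Definition lk_sym : V := lk_vec n (fun s k => r ^+ s * r ^+ k).

Lemma lk_sym_neq0 : lk_sym != 0.
Proof.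
apply/eqP => h; have := lk_co0 F n 0 1; rewrite -h lk_co_vec; last nat_lia.
by apply/eqP; rewrite mulf_neq0 ?expf_neq0.
Qed.

Lemma trivial_vectorE u : lk_trivial u -> u = (lk_co 0 1 u / r) *: lk_sym.
Proof.
move=> tu; have cu i s k : lk_co s k (nu i u) = r * lk_co s k u by rewrite tu lk_coZ.
apply: lk_co_eq => s k skn; rewrite lk_coZ lk_co_vec //.
have c0 (j : nat) : (0 < j < n)%N -> lk_co 0 j u = r ^+ j * (lk_co 0 1 u / r).
  elim: j => [|[|j] IH] //= jn; first by field.
  have jn1 : (j.+1 < n.-1)%N by nat_lia.
  have sj : (0 < Ordinal jn1)%N by [].
  by have := co_nu_l u sj; rewrite cu IH /=; [move=> <-; rewrite (exprS r j.+1); ring | nat_lia].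
elim: s skn => [|s IH] skn; first by rewrite c0 ?expr0; [ring | nat_lia].
have sn1 : (s < n.-1)%N by nat_lia.
have sk : ((Ordinal sn1).+1 < k)%N by rewrite /=; nat_lia.
have := co_nu_r u sk; rewrite cu /= IH; last nat_lia.
by move=> <-; rewrite (exprS r s); ring.
Qed.

Lemma lk_row_sym j : (j < n)%N ->
  (1 - r ^+ 2) * row j lk_sym = (r ^+ j.+1) ^+ 2 - (r ^+ n) ^+ 2 + t * (1 - (r ^+ j) ^+ 2).
Proof.
move=> jn; rewrite lk_row_sum -/t.
have e : minn j n = j by nat_lia.
have h := sum_sqr_lt n r j; rewrite e in h; rewrite -h -sum_sqr_gt // mulrCA -mulrDr; congr (_ * _).
rewrite mulr_sumr -big_split; apply: eq_bigr => k _ /=.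
have X0 := expf_neq0 k r0; have Y0 := expf_neq0 j r0.
case: (ltngtP j k) => [jk|kj|jk]; rewrite ?mulr0 ?addr0 //.
- by rewrite lk_co_vec ?jk ?ltn_ord //; field.
- by rewrite lk_co_vec ?kj ?jn //; field.
Qed.

Lemma lk_sym_trivial : t = (r ^+ n) ^+ 2 -> lk_trivial lk_sym.
Proof.
move=> tn i; apply: lk_co_eq => s k /andP[sk kn]; rewrite lk_coZ.
have i1 := strandS_lt i.
have [e|si] := eqVneq s i; last have [e|si1] := eqVneq s i.+1.
- subst s; have [e|ki] := eqVneq k i.+1.
    subst k; rewrite co_nu_diag lk_co_vec ?ltnSn //.
    apply: (mulfI r21); rewrite mulrDr [X in _ + X]mulrCA lk_row_sym // -/t -/m -tn.
    have X0 := expf_neq0 i r0; rewrite (exprS r i.+1) (exprS r i); move: (r ^+ i) X0 => X X0.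
    by rewrite /m; field.
  rewrite co_nu_r ?lk_co_vec ?sk ?kn ?(exprS r i) //; first [ring | nat_lia].
- subst s; rewrite co_nu_r1 // !lk_co_vec ?kn ?sk //; last nat_lia.
  by rewrite (exprS r i); field.
have [e|ki] := eqVneq k i; last have [e|ki1] := eqVneq k i.+1.
- subst k; rewrite co_nu_l // !lk_co_vec ?kn ?sk // ?(exprS r i); first [ring | nat_lia].
- subst k; have si' : (s < i)%N by nat_lia.
  rewrite co_nu_l1 // !lk_co_vec ?kn ?sk ?si' //; last nat_lia.
  by rewrite (exprS r i); field.
by rewrite co_nu_out ?si ?si1 ?ki ?ki1 // lk_co_vec ?sk.
Qed.

Lemma trivial_vector_param u : lk_trivial u -> u != 0 -> t = (r ^+ n) ^+ 2.
Proof.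
move=> tu u0; have i0 : (0 < n.-1)%N by nat_lia.
have := co_nu_diag (Ordinal i0) u; rewrite tu lk_coZ /=.
rewrite (trivial_vectorE tu) lk_rowZ lk_coZ.
set c := lk_co 0 1 u / r; have c0 : c != 0.
  by apply: contraNneq u0 => e; rewrite (trivial_vectorE tu) -/c e scale0r.
rewrite lk_co_vec; last nat_lia.
have := @lk_row_sym 1; have -> : (1 < n)%N by nat_lia.
move=> /(_ isT); move: (row 1 lk_sym) (r ^+ n) => G N hG.
rewrite -/t -/m !expr0 !expr1 !mul1r => h; apply/eqP; rewrite -subr_eq0; apply/eqP.
apply: (mulfI c0); rewrite mulr0.
transitivity (r ^+ 2 * (t / r * (c * r) + m / r * (c * G) - r * (c * r))
   - c * ((1 - r ^+ 2) * G - ((r ^+ 2) ^+ 2 - N ^+ 2 + t * (1 - r ^+ 2)))).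
  by rewrite /m; field.
by rewrite -h hG; ring.
Qed.

(** On rows, nu_i is r times the identity plus a map of rank one with values in the line of e_i -
    e_{i+1}: a deformed reflection. *)
Lemma row_nu_defect i v : lk_defect l r i v = 0 -> forall j, row j (nu i v) =
  r * row j v + (row i.+1 v / r - r * row i v) * ((j == i)%:R - (j == i.+1)%:R).
Proof.
move=> d0 j; have [->|ji] := eqVneq j i.
  rewrite row_nu_l (_ : (nat_of_ord i == i.+1) = false) ?subr0 ?mulr1; first by ring.
  by apply/negbTE; nat_lia.
have [->|ji1] := eqVneq j i.+1; first by rewrite row_nu_r d0 /=; field.
by rewrite row_nu_out //=; ring.
Qed.

Definition lk_irreducible U :=
  forall W, lk_invariant l r W -> (W <= U)%VS -> W != 0%VS -> W = U.

(** [Some p] encodes the formula [refl_co] at p, and [None] the vanishing of the sum of the rows. *)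
Definition refl_form (o : option (lk_index n)) (a b : nat) : F :=
  if o is Some p then
    let s := val (val p).1 in let k := val (val p).2 in
    D * lk_delta F s k a b + (1 - r ^+ 2) * (r ^+ k / r ^+ s) * lk_rowc l r s a b
    + (1 - r ^+ 2) * (t * (r ^+ s / r ^+ k)) * lk_rowc l r k a b
  else \sum_(j < n) lk_rowc l r j a b.

Definition lk_refl : {vspace V} := (\bigcap_o lker (lk_form n (refl_form o)))%VS.

Lemma mem_bigcap_lker (I : finType) (f : I -> 'Hom(V, F^o)) v :
  reflect (forall o, f o v = 0) (v \in (\bigcap_o lker (f o))%VS).
Proof.
have main s : (v \in (\bigcap_(o <- s) lker (f o))%VS) = all (fun o => f o v == 0) s.
  elim: s => [|o s IH]; first by rewrite big_nil memvf.
  by rewrite big_cons memv_cap memv_ker IH.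
rewrite main; apply: (iffP allP) => h o; last by move=> _; apply/eqP.
by apply/eqP/h; rewrite mem_index_enum.
Qed.

Lemma mem_refl v : v \in lk_refl <->
  (forall s k, (s < k < n)%N -> D * lk_co s k v = refl_co l r (fun j => row j v) s k)
  /\ row_total l r v = 0.
Proof.
have pE s k : lk_pair (fun a b => D * lk_delta F s k a b
    + (1 - r ^+ 2) * (r ^+ k / r ^+ s) * lk_rowc l r s a b
    + (1 - r ^+ 2) * (t * (r ^+ s / r ^+ k)) * lk_rowc l r k a b) v =
    D * lk_co s k v - refl_co l r (fun j => row j v) s k.
  by rewrite 2!lk_pairDl !lk_pairZl /refl_co -/t /lk_row /lk_co; ring.
split=> [/mem_bigcap_lker h|[h1 h2]].
  split=> [s k /andP[sk kn]|]; last first.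
    by have := h None; rewrite lk_formE /= lk_pair_suml.
  have sn := ltn_trans sk kn.
  have := h (Some (Sub (Ordinal sn, Ordinal kn) sk : lk_index n)).
  by rewrite lk_formE /= pE => /eqP; rewrite subr_eq0 => /eqP.
apply/mem_bigcap_lker => -[p|]; rewrite lk_formE /= ?lk_pair_suml // pE.
by rewrite h1 ?subrr //; case: p => [[a b] ab] /=; rewrite ab ltn_ord.
Qed.

Lemma refl_defect_free : lk_defect_free l r lk_refl.
Proof.
have def i u : u \in lk_refl -> lk_defect l r i u = 0.
  move=> /mem_refl[h _]; have := h i i.+1; rewrite ltnSn strandS_lt => /(_ isT).
  rewrite /lk_defect -/t -/D => ->; rewrite /refl_co -/t (exprS r i).
  by have := expf_neq0 i r0; move: (r ^+ i) => X X0; field; rewrite X0 r0.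
split=> // i; apply/subvP => _ /memv_imgP[v vE ->]; have d0 := def i v vE.
move: vE => /mem_refl[h htot].
have i1 := strandS_lt i; have i0 := strand_lt i.
have rE := row_nu_defect d0.
apply/mem_refl; split; last first.
  (* The rank one part does not change the sum of the rows, as the entries of e_i - e_{i+1} add up
     to 0. *)
  rewrite /row_total; under eq_bigr do rewrite rE.
  rewrite big_split /= -mulr_sumr -[X in r * X]/(row_total l r v) htot mulr0 add0r -mulr_sumr.
  rewrite sumrB (bigD1 (Ordinal i0)) //= eqxx big1 => [|j]; last first.
    by rewrite -val_eqE /= => /negPf->.
  rewrite (bigD1 (Ordinal i1)) //= eqxx big1 => [|j]; last first.
    by rewrite -val_eqE /= => /negPf->.
  by rewrite ?eqxx !addr0 subrr mulr0.
move=> s k /andP[sk kn]; have sn := ltn_trans sk kn.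
have rc s' k' : (s' < k' < n)%N -> D * lk_co s' k' v = refl_co l r (fun j => row j v) s' k' := @h s' k'.
have X0 := expf_neq0 i r0; have S0 := expf_neq0 s r0; have K0 := expf_neq0 k r0.
have ri := row_nu_l i v; have ri1 : row i.+1 (nu i v) = r * row i v - m * row i.+1 v.
  by rewrite row_nu_r d0 mul0r addr0.
have [e|si] := eqVneq s i; last have [e|si1] := eqVneq s i.+1.
- subst s; have [e|ki] := eqVneq k i.+1.
    subst k; rewrite co_nu_diag mulrDr mulrCA rc ?ltnSn // /refl_co ri ri1 -/t -/m.
    by rewrite (exprS r i) /D /m; move: (r ^+ i) X0 => X X0; field; rewrite X0 r0.
  rewrite co_nu_r ?rc; try nat_lia.
  rewrite /refl_co ri (row_nu_out v _ ki) -/t; last by nat_lia.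
  by rewrite (exprS r i); field; rewrite X0 r0 K0.
- subst s; rewrite co_nu_r1 // mulrBr mulrCA !rc ?kn ?sk //; last nat_lia.
  rewrite /refl_co ri1 row_nu_out -/t -/m /m; try nat_lia.
  by rewrite (exprS r i) in S0 *; field; rewrite X0 r0 K0.
have [e|ki] := eqVneq k i; last have [e|ki1] := eqVneq k i.+1.
- subst k; rewrite co_nu_l // rc; last nat_lia.
  rewrite /refl_co ri (row_nu_out v si si1) -/t.
  by rewrite (exprS r i); field; rewrite X0 r0 S0.
- subst k; have si' : (s < i)%N by nat_lia.
  rewrite co_nu_l1 // mulrBr mulrCA !rc; try nat_lia.
  rewrite /refl_co ri1 (row_nu_out v si si1) -/t /m.
  by rewrite (exprS r i); field; rewrite X0 r0 S0.
rewrite co_nu_out ?si ?si1 ?ki ?ki1 // mulrCA rc ?sk //.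
rewrite /refl_co (row_nu_out v si si1) (row_nu_out v ki ki1) -/t.
by field; rewrite K0 S0.
Qed.

Local Notation E := lk_refl.
Let dfE : lk_defect_free l r E. Proof. exact: refl_defect_free. Qed.

Lemma refl_row_nu i u : u \in E -> forall j, row j (nu i u) =
  r * row j u + (row i.+1 u / r - r * row i u) * ((j == i)%:R - (j == i.+1)%:R).
Proof. by case: dfE => _ def /(def i); apply: row_nu_defect. Qed.

Hypothesis D0 : D != 0.

Lemma refl_row_inj u : u \in E -> (forall j, (j < n)%N -> row j u = 0) -> u = 0.
Proof. exact: defect_free_row_inj. Qed.

Definition unit_diff (i j : nat) : F := (j == i)%:R - (j == i.+1)%:R.

Lemma sum_unit_diff i : (i.+1 < n)%N -> \sum_(j < n) unit_diff i j = 0.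
Proof.
move=> i1; have i0 := ltnW i1; rewrite sumrB (bigD1 (Ordinal i0)) //= eqxx big1 => [|j]; last first.
  by rewrite -val_eqE /= => /negPf->.
rewrite (bigD1 (Ordinal i1)) //= eqxx big1 => [|j]; last first.
  by rewrite -val_eqE /= => /negPf->.
by rewrite ?eqxx !addr0 subrr.
Qed.

(** The rows are then proportional to r^{2k}, and their sum, which is 0, is a nonzero multiple of
    R_0 because r^{2n} <> 1. *)
Lemma refl_trivial_eq0 u : u \in E -> (forall i, row i.+1 u / r - r * row i u = 0) -> u = 0.
Proof.
move=> uE h; apply: refl_row_inj => // j jn.
have rj k : (k < n)%N -> row k u = (r ^+ k) ^+ 2 * row 0 u.
  elim: k => [|k IH] kn; first by rewrite expr0 expr1n mul1r.
  have k1 : (k < n.-1)%N by nat_lia.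
  have /eqP := h (Ordinal k1); rewrite subr_eq0 /= => /eqP e.
  have -> : row k.+1 u = row k.+1 u / r * r by field.
  by rewrite e IH; [rewrite (exprS r k); ring | nat_lia].
have /mem_refl[_] := uE; rewrite /row_total.
under eq_bigr => k _ do rewrite (rj k) //.
rewrite -mulr_suml => /eqP; rewrite mulf_eq0 => /orP[|/eqP e]; last by rewrite rj // e mulr0.
have jn1 : (1 <= n <= n)%N by nat_lia.
have h0 := geom_neq0 n3 rn jn1; move=> h1.
move/negP: h0; case; rewrite (eq_bigr (fun k : 'I_n => (r ^+ k) ^+ 2)) // => k _.
by rewrite ltn_ord.
Qed.

(** The rows of nu_i u - r u are proportional to e_i - e_{i+1}. One such nonzero vector in W
    produces its neighbours, hence all of them; they span the rows of sum zero, and rows determine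
    the elements of E. *)
Lemma refl_irreducible : lk_irreducible E.
Proof.
move=> W inv WE W0; have nuW i u : u \in W -> nu i u \in W by move=> uW; rewrite invariant_mem.
have unitW i u : u \in W -> row i.+1 u / r - r * row i u != 0 ->
    exists2 e, e \in W & forall j, row j e = unit_diff i j.
  move=> uW c0; exists ((row i.+1 u / r - r * row i u)^-1 *: (nu i u - r *: u)).
    by rewrite memvZ // memvB ?nuW ?memvZ.
  move=> j; rewrite lk_rowZ lk_rowB lk_rowZ refl_row_nu ?(subvP WE) //.
  by rewrite [r * _ + _]addrC addrK mulKf.
have [i0 [e0 e0W re0]] : exists i, exists2 e, e \in W & forall j, row j e = unit_diff i j.
  have [u uW u0] : exists2 u, u \in W & u != 0.
    by exists (vpick W); rewrite ?memv_pick ?vpick0.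
  have [i ci|nc] := pickP (fun i : 'I_n.-1 => row i.+1 u / r - r * row i u != 0).
    by exists i; apply: unitW ci.
  case/eqP: u0; apply: refl_trivial_eq0; first exact: (subvP WE).
  by move=> i; have := nc i => /negbT; rewrite negbK => /eqP.
have stepU (i : nat) e : (i.+2 < n)%N -> e \in W -> (forall j, row j e = unit_diff i j) ->
    exists2 e', e' \in W & forall j, row j e' = unit_diff i.+1 j.
  move=> i2 eW re; have i1 : (i.+1 < n.-1)%N by nat_lia.
  apply: (unitW (Ordinal i1)) eW _; rewrite /= !re /unit_diff !eqxx.
  have -> : (i.+2 == i) = false by nat_lia.
  have -> : (i.+2 == i.+1) = false by nat_lia.
  have -> : (i.+1 == i) = false by nat_lia.
  by rewrite subr0 mul0r !sub0r mulrN mulr1 opprK.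
have stepD (i : nat) e : (i.+2 < n)%N -> e \in W -> (forall j, row j e = unit_diff i.+1 j) ->
    exists2 e', e' \in W & forall j, row j e' = unit_diff i j.
  move=> i2 eW re; have i1 : (i < n.-1)%N by nat_lia.
  apply: (unitW (Ordinal i1)) eW _; rewrite /= !re /unit_diff !eqxx.
  have -> : (i == i.+1) = false by nat_lia.
  have -> : (i == i.+2) = false by nat_lia.
  have -> : (i.+1 == i.+2) = false by nat_lia.
  by rewrite !subr0 mulr0 subr0 mul1r invr_eq0.
have e00 : exists2 e, e \in W & forall j, row j e = unit_diff 0 j.
  have := ltn_ord i0; move: e0 e0W re0; case: i0 => i /= _.
  elim: i => [|i IH] e eW re i1; first by exists e.
  have i2 : (i.+2 < n)%N by nat_lia.
  by have [e' e'W re'] := stepD i e i2 eW re; apply: (IH e') => //; nat_lia.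
have eA (i : nat) : (i < n.-1)%N -> exists2 e, e \in W & forall j, row j e = unit_diff i j.
  elim: i => [_|i IH i1]; first exact: e00.
  have [e eW re] := IH (ltnW i1).
  by apply: (stepU i e) => //; nat_lia.
apply/eqP; rewrite eqEsubv WE /=; apply/subvP => v vE.
(* Elimination: only the last d rows may be nonzero. For d = 1 the remaining one vanishes because
   the rows add up to 0. *)
suff main d w : w \in E -> (forall j, (j + d < n)%N -> row j w = 0) -> w \in W.
  by apply: (main n v vE) => j; nat_lia.
elim: d w => [|d IH] w wE rw.
  by rewrite (_ : w = 0) ?mem0v //; apply: refl_row_inj => // j jn; apply: rw; rewrite addn0.
have [nd|dn] := leqP n d; first by apply: IH => // j; nat_lia.
case: d IH rw dn => [|d] IH rw dn.
  apply: IH => // j jn; rewrite addn0 in jn; have [jn1|jn1] := ltnP j n.-1; first by apply: rw; nat_lia.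
  have -> : j = n.-1 by nat_lia.
  have n1 : (n.-1 < n)%N by nat_lia.
  have /mem_refl[_] := wE; rewrite /row_total (bigD1 (Ordinal n1)) //= big1 ?addr0 //.
  by move=> k; rewrite -val_eqE /= => kn; apply: rw; have := ltn_ord k; nat_lia.
have [e eW re] := eA (n - d.+2)%N ltac:(nat_lia).
set c := row (n - d.+2) w.
rewrite -[w](subrK (c *: e)) memvD ?memvZ //; apply: IH => [|j jd].
  by rewrite memvB ?memvZ // (subvP WE).
rewrite lk_rowB lk_rowZ re /unit_diff; have [->|jn] := eqVneq j (n - d.+2)%N.
  by rewrite (_ : (n - d.+2 == (n - d.+2).+1)%N = false) ?subr0 ?mulr1 ?subrr //; apply/negbTE; nat_lia.
have -> : (j == (n - d.+2).+1)%N = false by nat_lia.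
by rewrite subrr mulr0 subr0 rw //; nat_lia.
Qed.

End Reflection.

(** * Consecutive entries in a common row or column *)

Section AdjacentCells.
Variable n : nat.
Hypothesis n3 : (3 <= n)%N.

Lemma adjacent_col1 k : (k.+1 < n)%N ->
  reshape_index (conj_part [:: n]) k <> reshape_index (conj_part [:: n]) k.+1.
Proof. by move=> kn; rewrite conj_part1 !reshape_index_nseq1; nat_lia. Qed.

Lemma adjacent_row2 k : (k.+1 < n)%N ->
  reshape_index [:: n - 1; 1]%N k = reshape_index [:: n - 1; 1]%N k.+1 -> (k.+2 < n)%N.
Proof.
move=> kn; rewrite ltn_neqAle kn andbT => h; apply/eqP => e; move: h.
rewrite reshape_index_cons ifT; last nat_lia.
by rewrite reshape_index_cons ifN //; nat_lia.
Qed.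

Lemma adjacent_col2 k : (k.+1 < n)%N ->
  reshape_index (conj_part [:: n - 1; 1]%N) k = reshape_index (conj_part [:: n - 1; 1]%N) k.+1 ->
  k = 0%N.
Proof.
move=> kn; rewrite conj_part2 // 2!reshape_index_cons 2!reshape_index_nseq1.
by case: (ltnP k) => h1; case: (ltnP k.+1) => h2; nat_lia.
Qed.

Lemma adjacent_row3 k : (k.+1 < n)%N ->
  reshape_index [:: n - 2; 2]%N k = reshape_index [:: n - 2; 2]%N k.+1 -> k.+3 <> n.
Proof.
move=> kn h e; move: h; rewrite reshape_index_cons ifT; last nat_lia.
by rewrite reshape_index_cons ifN //; nat_lia.
Qed.

Lemma adjacent_col3 k : (4 <= n)%N -> (k.+1 < n)%N ->
  reshape_index (conj_part [:: n - 2; 2]%N) k = reshape_index (conj_part [:: n - 2; 2]%N) k.+1 ->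
  k = 0%N \/ k = 2%N.
Proof.
move=> n4 kn; rewrite conj_part3 // (reshape_index_cons 2 _ k) (reshape_index_cons 2 _ k.+1).
case: (ltnP k 2) => h1; case: (ltnP k.+1 2) => h2; try nat_lia.
rewrite (reshape_index_cons 2 _ (k - 2)) (reshape_index_cons 2 _ (k.+1 - 2)) 2!reshape_index_nseq1.
by case: (ltnP (k - 2) 2) => h3; case: (ltnP (k.+1 - 2) 2) => h4; nat_lia.
Qed.

Lemma adjacent_row4 k : (k.+1 < n)%N ->
  reshape_index [:: n - 2; 1; 1]%N k = reshape_index [:: n - 2; 1; 1]%N k.+1 -> (k.+3 < n)%N.
Proof.
move=> kn h; rewrite ltnNge; apply/negP => e; move: h.
rewrite reshape_index_cons; case: ltnP => h1.
  by rewrite reshape_index_cons ifN //; nat_lia.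
rewrite [in RHS]reshape_index_cons ifN; last nat_lia.
rewrite [in LHS]reshape_index_cons ifT; last nat_lia.
by rewrite reshape_index_cons ifN //; nat_lia.
Qed.

Lemma adjacent_col4 k : (k.+1 < n)%N ->
  reshape_index (conj_part [:: n - 2; 1; 1]%N) k = reshape_index (conj_part [:: n - 2; 1; 1]%N) k.+1 ->
  (k < 2)%N.
Proof.
move=> kn; rewrite conj_part4 // 2!reshape_index_cons 2!reshape_index_nseq1.
by case: (ltnP k) => h1; case: (ltnP k.+1) => h2; nat_lia.
Qed.

End AdjacentCells.

(** * The line S^(n), and the case D <> 0 *)

Section ReflectionLine.
Variables (F : fieldType) (n : nat) (l r : F).
Hypotheses (l0 : l != 0) (r0 : r != 0) (n3 : (3 <= n)%N).
Hypothesis rn : forall k, (1 <= k <= n)%N -> (r ^+ k) ^+ 2 != 1.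

Let m : F := r^-1 - r.
Let t : F := r ^+ 3 / l.
Let D : F := (t - r ^+ 2) * (t + 1).

Local Notation V := (lk_space F n).
Local Notation nu := (@lk_nu F n l r).
Local Notation row := (lk_row l r).
Implicit Types (u v : V) (i : 'I_n.-1) (U W : {vspace V}) (g : nat -> F).

Let row_nu_out := @lk_row_nu_out F n l r l0 r0.

Let r21 : 1 - r ^+ 2 != 0.
Proof. by rewrite subr_eq0 eq_sym (sqr_neq1 n3 rn). Qed.

Local Notation E := (lk_refl n l r).
Let dfE : lk_defect_free l r E. Proof. exact: refl_defect_free. Qed.
Let r2N1 : r ^+ 2 != -1 := sqr_neqN1 n3 rn.

Lemma line_irreducible u : lk_irreducible l r <[u]>%VS.
Proof.
move=> W _ Wu W0; apply/eqP; rewrite eqEsubv Wu /=.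
have : vpick W \in <[u]>%VS by apply: (subvP Wu); apply: memv_pick.
move=> /vlineP[c e]; have c0 : c != 0.
  by apply: contraNneq W0 => c0; rewrite -vpick0 e c0 scale0r.
by rewrite -memvE -[u]scale1r -(mulVf c0) -scalerA -e memvZ // memv_pick.
Qed.

Lemma quad_defect_free U : lk_invariant l r U ->
  (forall i u, u \in U -> nu i (nu i u) + m *: nu i u = u) -> lk_defect_free l r U.
Proof.
move=> inv quad; split=> // i u uU; have := lk_nu_quad l0 r0 i u.
rewrite quad // subrr => /esym/(congr1 (lk_co i i.+1)); rewrite lk_coZ lk_co0.
rewrite [lk_co _ _ (lk_w _ _ _ _)]lk_pair_w ?ltnSn ?strandS_lt // /lk_delta !eqxx mulr1.
by move/eqP; rewrite mulf_eq0 invr_eq0 expf_eq0 (negPf r0) orbF => /eqP.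
Qed.

Lemma trivial_line_defect_free u : lk_trivial l r u -> lk_defect_free l r <[u]>%VS.
Proof.
move=> tu; apply: quad_defect_free => [i|i _ /vlineP[c ->]].
  by apply/subvP => _ /memv_imgP[_ /vlineP[c ->] ->]; rewrite linearZ /= tu !memvZ ?memv_line.
rewrite !linearZ /= tu !linearZ /= tu !scalerA -scalerDl /m; congr (_ *: _).
by field.
Qed.

Lemma sym_iso : t = (r ^+ n) ^+ 2 -> lk_iso_specht l r <[lk_sym n r]>%VS [:: n].
Proof.
move=> tn; have tr := lk_sym_trivial l0 r0 n3 rn tn.
have [wlP wlu] := shape1 n3.
have s0 : lk_sym n r != 0 by apply: lk_sym_neq0.
(* Both test vectors are the generator of the line. The columns of (n) are single cells, so
   alternation is an empty condition. *)
apply: (@irreducible_iso_specht F n r [:: n] r0 r2N1 wlP wlu _ _ _ _ _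
   (lk_form n (lk_delta F 0 1)) _ (lk_sym n r) (lk_sym n r)); rewrite ?memv_line //.
- by apply: defect_free_module => //; apply: trivial_line_defect_free.
- by move=> W WU inv W0; apply: line_irreducible.
- by move=> i _ _ /vlineP[c ->]; rewrite linearZ /= tr !linearZ /= /GRing.scale /=; ring.
- rewrite lk_formE -[lk_pair _ _]/(lk_co 0 1 _) lk_co_vec; last nat_lia.
  by rewrite mulf_neq0 ?expf_neq0.
- by move=> i h; have := adjacent_col1 n3 (strandS_lt i) h.
Qed.

Section Generic.
Hypothesis D0 : D != 0.

Lemma defect_free_generic U : lk_defect_free l r U -> U != 0%VS ->
  (t ^+ 2 = (r ^+ n) ^+ 2 /\ U = E) \/ (t = (r ^+ n) ^+ 2 /\ U = <[lk_sym n r]>%VS).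
Proof.
move=> dfU U0; have [inv def] := dfU.
have t0 : t != 0 by rewrite !mulf_neq0 ?invr_eq0 ?expf_neq0.
have eqn := fun u j => @defect_free_row_eq F n l r l0 r0 U dfU u j D0.
have [A0|A0] := eqVneq (t ^+ 2) ((r ^+ n) ^+ 2).
  left; split=> //; apply: (refl_irreducible l0 r0 n3 rn D0) => //; apply/subvP => u uU.
  apply/mem_refl; split=> [s k skn|]; first exact: (defect_free_co l0 r0 dfU).
  have := eqn u 0%N uU ltac:(nat_lia); rewrite -/t A0 subrr mul0r => /esym/eqP.
  have c0 : (1 - r ^+ 2) * t * (r ^+ 0) ^+ 2 != 0.
    by apply: mulf_neq0; [apply: mulf_neq0 | rewrite !expf_neq0].
  by rewrite mulf_eq0 oppr_eq0 (negPf c0) /= => /eqP.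
right; have A1 : t ^+ 2 - (r ^+ n) ^+ 2 != 0 by rewrite subr_eq0.
have rowE u j : u \in U -> (j < n)%N -> row j u = (r ^+ j) ^+ 2 * row 0 u.
  move=> uU jn; apply: (mulfI A1); rewrite mulrCA !eqn // ?expr0; last nat_lia.
  by rewrite /t; ring.
(* Rows proportional to r^{2j} are killed by the rank one part of nu_i, so nu_i u - r u has zero
   rows and vanishes. *)
have tr u : u \in U -> lk_trivial l r u.
  move=> uU i; apply/eqP; rewrite -subr_eq0; apply/eqP.
  have i1 := strandS_lt i; have i0 := strand_lt i.
  apply: (defect_free_row_inj l0 r0 dfU D0); first by rewrite memvB ?memvZ ?invariant_mem.
  move=> j jn; rewrite lk_rowB lk_rowZ (row_nu_defect l0 r0 n3 (def i u uU)).
  rewrite (rowE _ i.+1 uU) // (rowE _ i uU) // (exprS r i).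
  have h : r * r ^+ i * (r * r ^+ i) * row 0 u / r - r * ((r ^+ i) ^+ 2 * row 0 u) = 0 by field.
  by rewrite [(r * _) ^+ 2]expr2 h mul0r addr0 subrr.
have p0 : vpick U != 0 by rewrite vpick0.
have tp := tr _ (memv_pick U).
have tn : t = (r ^+ n) ^+ 2 by apply: (trivial_vector_param _ _ _ tp p0).
split=> //; apply/eqP; rewrite eqEsubv; apply/andP; split.
  apply/subvP => u uU; rewrite (trivial_vectorE l0 r0 n3 (tr u uU)).
  by rewrite memvZ ?memv_line.
move: p0 (memv_pick U); rewrite (trivial_vectorE l0 r0 n3 tp); set c := _ / _ => p0 cU.
have c0 : c != 0 by apply: contraNneq p0 => ->; rewrite scale0r.
by rewrite -memvE -[lk_sym n r]scale1r -(mulVf c0) -scalerA memvZ.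
Qed.

Hypothesis tn : t ^+ 2 = (r ^+ n) ^+ 2.

(** For t^2 = r^{2n} and g of sum zero, the corrections in [row_identity] disappear, so the
    coordinates [refl_co] divided by D have rows exactly g. *)
Lemma refl_vec g : \sum_(j < n) g j = 0 ->
  exists2 v, v \in E & forall j, (j < n)%N -> row j v = g j.
Proof.
move=> g0; pose v := D^-1 *: lk_vec n (refl_co l r g).
have cv s k : (s < k < n)%N -> D * lk_co s k v = refl_co l r g s k.
  by move=> skn; rewrite lk_coZ lk_co_vec // mulVKf.
have rv j : (j < n)%N -> row j v = g j.
  move=> jn; apply: (mulfI D0); rewrite (row_of_refl r0 D0 cv jn) -/t -/D.
  by rewrite tn g0 subrr mul0r mul0r mulr0 addr0 subr0.
exists v => //; apply/mem_refl; split=> [s k /andP[sk kn]|].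
  rewrite cv ?sk // /refl_co !rv //; by rewrite ?kn // (ltn_trans sk kn).
by rewrite /row_total -[RHS]g0; apply: eq_bigr => j _; rewrite rv.
Qed.

Lemma refl_unit (i : 'I_n.-1) : exists2 p, p \in E &
  (forall j, (j < n)%N -> row j p = unit_diff F i j) /\ nu i p = - r^-1 *: p.
Proof.
have [p pE rp] := refl_vec (sum_unit_diff F (strandS_lt i)).
exists p => //; split=> //; apply/eqP; rewrite -subr_eq0; apply/eqP.
have [inv def] := dfE.
apply: (@refl_row_inj F n l r) => //; first by rewrite memvB ?memvZ ?invariant_mem.
move=> j jn; rewrite lk_rowB lk_rowZ (row_nu_defect l0 r0 n3 (def i p pE)) !rp ?strandS_lt ?strand_lt //.
have e1 : (i.+1 == i) = false by nat_lia.
have e2 : (nat_of_ord i == i.+1) = false by nat_lia.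
rewrite /unit_diff !eqxx e1 e2 /=.
by field.
Qed.

Lemma refl_neq0 : E != 0%VS.
Proof.
have i0 : (0 < n.-1)%N by nat_lia.
have [p pE [rp _]] := refl_unit (Ordinal i0); apply/eqP => E0.
move: pE; rewrite E0 memv0 => /eqP p0; have := rp 0%N ltac:(nat_lia).
by rewrite p0 lk_row0 /unit_diff /= subr0 => /esym/eqP; rewrite oner_eq0.
Qed.

Lemma refl_iso : lk_iso_specht l r E [:: n - 1; 1]%N.
Proof.
have [wlP wlu] := shape2 n3; have [inv def] := dfE.
have i0 : (0 < n.-1)%N by nat_lia.
have il : (n.-2 < n.-1)%N by nat_lia.
have [p pE [rp ap]] := refl_unit (Ordinal i0).
have [q qE [rq aq]] := refl_unit (Ordinal il).
(* All generators but the last multiply R_{n-1} by r, as the rows of (n-1,1) require. The rows of q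
   are e_{n-2} - e_{n-1}, so R_{n-1}(q) = -1; those of p are e_0 - e_1, so p is alternating for the
   first column. *)
apply: (@irreducible_iso_specht F n r [:: n - 1; 1]%N r0 r2N1 wlP wlu _ _ _ _ _
   (lk_form n (lk_rowc l r n.-1)) _ q p) => //.
- exact: defect_free_module.
- by move=> W WU inv' W0; apply: (refl_irreducible l0 r0 n3 rn D0).
- move=> i u ri uE; rewrite !lk_formE; have := adjacent_row2 n3 (strandS_lt i) ri => h.
  by apply: row_nu_out; nat_lia.
- rewrite lk_formE -[lk_pair _ _]/(row n.-1 q) rq; last nat_lia.
  have e1 : (n.-1 == n.-2) = false by nat_lia.
  have e2 : (n.-1 == n.-2.+1) = true by nat_lia.
  rewrite /unit_diff /= e1 e2.
  by rewrite sub0r oppr_eq0 oner_eq0.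
- apply/eqP => p0; have := rp 0%N ltac:(nat_lia).
  by rewrite p0 lk_row0 /unit_diff /= subr0 => /esym/eqP; rewrite oner_eq0.
- move=> i ci; have := adjacent_col2 n3 (strandS_lt i) ci => h.
  by rewrite (_ : i = Ordinal i0) //; apply: val_inj.
Qed.

End Generic.

End ReflectionLine.

(** * The kernel of the rows and its bilinear form *)

Section RowKernel.
Variables (F : fieldType) (n : nat) (l r : F).
Hypotheses (l0 : l != 0) (r0 : r != 0) (n3 : (3 <= n)%N).
Hypothesis rn : forall k, (1 <= k <= n)%N -> (r ^+ k) ^+ 2 != 1.

Let m : F := r^-1 - r.
Let t : F := r ^+ 3 / l.
Let D : F := (t - r ^+ 2) * (t + 1).

Local Notation V := (lk_space F n).
Local Notation nu := (@lk_nu F n l r).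
Local Notation row := (lk_row l r).
Implicit Types (u v : V) (i : 'I_n.-1) (U W : {vspace V}) (g : nat -> F).

Let co_nu_diag := @lk_co_nu_diag F n l r l0 r0.
Let co_nu_l := @lk_co_nu_l F n l r l0 r0.
Let co_nu_l1 := @lk_co_nu_l1 F n l r l0 r0.
Let co_nu_r := @lk_co_nu_r F n l r l0 r0.
Let co_nu_r1 := @lk_co_nu_r1 F n l r l0 r0.
Let co_nu_out := @lk_co_nu_out F n l r l0 r0.

Definition lk_rowker : {vspace V} := (\bigcap_(j : 'I_n) lker (lk_form n (lk_rowc l r j)))%VS.

Local Notation K := lk_rowker.

Lemma mem_rowker v : v \in K <-> forall j, (j < n)%N -> row j v = 0.
Proof.
split=> [/mem_bigcap_lker h j jn|h].
  by have := h (Ordinal jn); rewrite lk_formE.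
by apply/mem_bigcap_lker => j; rewrite lk_formE; apply: h.
Qed.

(** What remains of [lk_adj] once a multiple of R_{i+1} is split off. Its matrix is symmetric: on K
    the coordinates of nu_i v follow the same rule, see [rowker_co_nu]. *)
Definition lk_loc (i : nat) c (a b : nat) : F :=
  if (a == i) && (b == i.+1) then t / r * c i i.+1
  else if b == i then c a i.+1
  else if a == i.+1 then c i b - m * c i.+1 b
  else if b == i.+1 then c a i - m * c a i.+1
  else if a == i then c i.+1 b
  else r * c a b.

Ltac split_eqs := repeat first [case: eqP => [?|?] /=; try (exfalso; nat_lia)].

Lemma lk_pair_nu_loc i c v :
  lk_pair c (nu i v) = lk_pair (lk_loc i c) v + c i i.+1 * m / r * row i.+1 v.
Proof.
rewrite lk_pair_nu // /lk_row -lk_pairZl -lk_pairDl; apply: eq_lk_pair => a b ab bn.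
rewrite /lk_adj /lk_loc /lk_rowc -/t -/m; split_eqs; subst; rewrite ?exprS ?expr0 /m;
  repeat match goal with |- context [r ^+ ?k] =>
    let X := fresh in let X0 := fresh in have X0 := expf_neq0 k r0;
    move: (r ^+ k) X0 => X X0 end;
  field; repeat (apply/andP; split); done.
Qed.

Hypothesis D0 : D = 0.

Lemma rowker_defect_free : lk_defect_free l r K.
Proof.
have def i v : v \in K -> lk_defect l r i v = 0.
  move=> /mem_rowker h; rewrite /lk_defect -/t -/D D0 !h ?strandS_lt ?strand_lt //.
  by rewrite mul0r !mulr0 addr0 mulr0 addr0.
split=> // i; apply/subvP => _ /memv_imgP[v vK ->]; have d0 := def i v vK.
move: vK => /mem_rowker h; apply/mem_rowker => j jn.
rewrite (row_nu_defect l0 r0 n3 d0) !h ?strandS_lt ?strand_lt //.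
by rewrite mulr0 mul0r subrr mul0r addr0.
Qed.

Let nuK i v : v \in K -> nu i v \in K.
Proof. by move=> vK; rewrite invariant_mem //; case: rowker_defect_free. Qed.

Lemma rowker_pair_nu i c v : v \in K -> lk_pair c (nu i v) = lk_pair (lk_loc i c) v.
Proof.
by move=> /mem_rowker h; rewrite lk_pair_nu_loc h ?strandS_lt // mulr0 addr0.
Qed.

Lemma rowker_co_diag i v : v \in K -> lk_co i i.+1 (nu i v) = t / r * lk_co i i.+1 v.
Proof. by move=> /mem_rowker h; rewrite co_nu_diag h ?strandS_lt // mulr0 addr0. Qed.

Lemma rowker_co_nu i v a b : v \in K -> (a < b)%N ->
  lk_co a b (nu i v) = lk_loc i (fun s k => lk_co s k v) a b.
Proof.
move=> vK ab; rewrite /lk_loc.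
case: andP => [[/eqP-> /eqP->]|h1]; first exact: rowker_co_diag.
case: (eqVneq b i) => [e|h2]; first by rewrite e co_nu_l // -e.
case: (eqVneq a i.+1) => [e|h3]; first by rewrite e co_nu_r1 // -e.
case: (eqVneq b i.+1) => [e|h4].
  rewrite e co_nu_l1 //; case: (eqVneq a i) => [e'|]; last nat_lia.
  by case: h1; rewrite e e' !eqxx.
case: (eqVneq a i) => [e|h5]; first by rewrite e co_nu_r //; nat_lia.
by rewrite co_nu_out // h5 h3 h2 h4.
Qed.

Definition lk_dot u v : F := lk_pair (fun a b => lk_co a b u) v.

Lemma lk_dotE u v : lk_dot u v = \sum_p u p * v p.
Proof. by rewrite /lk_dot /lk_pair; apply: eq_bigr => p _; rewrite lk_co_index mulrC. Qed.

Lemma lk_dotC u v : lk_dot u v = lk_dot v u.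
Proof. by rewrite !lk_dotE; apply: eq_bigr => p _; rewrite mulrC. Qed.

Lemma rowker_dot_nu i u v : u \in K -> v \in K -> lk_dot (nu i u) v = lk_dot u (nu i v).
Proof.
move=> uK vK; rewrite [RHS]/lk_dot rowker_pair_nu //.
by apply: eq_lk_pair => a b ab _; apply: rowker_co_nu.
Qed.

(** Pairing with a basis of W embeds U into the row vectors of length \dim W. Counting dimensions
    makes up for isotropic vectors, which rule out a general orthogonal decomposition. *)
Lemma dot_perp_dim U W : (W <= U)%VS ->
  (forall u, u \in U -> (forall w, w \in W -> lk_dot w u = 0) -> u = 0) -> W = U.
Proof.
move=> WU perp; pose d := \dim W.
pose f u : 'rV[F]_d := \row_j lk_dot (vbasis W)`_j u.
have lf : linear f.
  by move=> c u v; apply/rowP => j; rewrite !mxE [LHS]lk_pairD lk_pairZ.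
pose fL := GRing.isLinear.Build F V 'rV[F]_d _ f lf.
pose g : {linear V -> 'rV[F]_d} := HB.pack f fL.
have ker0 : (U :&: lker (linfun g))%VS = 0%VS.
  apply/eqP; rewrite -subv0; apply/subvP => u; rewrite memv_cap memv_ker lfunE /=.
  move=> /andP[uU /eqP gu]; rewrite memv0; apply/eqP/perp => // w.
  move=> /coord_vbasis->; rewrite lk_dotC /lk_dot lk_pair_sum big1 // => j _.
  rewrite lk_pairZ; have := congr1 (fun M : 'rV[F]_d => M ord0 j) gu.
  by rewrite !mxE -[lk_pair _ _]/(lk_dot u _) lk_dotC => ->; rewrite mulr0.
apply/eqP; rewrite eqEdim WU /=; have := limg_ker_dim (linfun g) U.
rewrite ker0 dimv0 add0n => <-; apply: leq_trans (dimvS (subvf _)) _.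
by rewrite dimvf /dim /= mul1n.
Qed.

Lemma dot_irreducible p : p \in K -> lk_dot p p != 0 ->
  (forall W, lk_invariant l r W -> (W <= K)%VS -> W != 0%VS -> p \in W) ->
  lk_irreducible l r K.
Proof.
move=> pK pp hp W inv WK W0; apply: dot_perp_dim => // u uK hu.
pose P := (K :&: \bigcap_(j : 'I_(\dim W)) lker (lk_form n (fun a b => lk_co a b (vbasis W)`_j)))%VS.
have memP v : v \in P <-> v \in K /\ forall w, w \in W -> lk_dot w v = 0.
  rewrite memv_cap; split=> [/andP[vK /mem_bigcap_lker h]|[vK h]].
    split=> // w /coord_vbasis->; rewrite lk_dotC /lk_dot lk_pair_sum big1 // => j _.
    rewrite lk_pairZ -[lk_pair _ _]/(lk_dot v _) lk_dotC.
    by have := h j; rewrite lk_formE -[lk_pair _ _]/(lk_dot _ v) => ->; rewrite mulr0.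
  rewrite vK; apply/mem_bigcap_lker => j; rewrite lk_formE; apply: h.
  by apply: vbasis_mem; apply: mem_nth; rewrite size_tuple.
apply/eqP; apply: contraT => u0.
have PP : P != 0%VS.
  apply: contraNneq u0 => P0; rewrite -memv0 -P0; exact/memP.
have : p \in P.
  apply: hp => //; last exact: capvSl.
  move=> i; apply/subvP => _ /memv_imgP[v /memP[vK hv] ->]; apply/memP.
  split=> [|w wW]; first exact: nuK.
  have wK : w \in K by apply: (subvP WK).
  by rewrite -(rowker_dot_nu i wK vK) hv // invariant_mem.
by move=> /memP[_ /(_ p (hp W inv WK W0))/eqP]; rewrite (negPf pp).
Qed.

End RowKernel.

(** * Irreducibility of the kernel for t = -1 and t = r^2 *)

Section RowKernelIrreducible.
Variables (F : fieldType) (n : nat) (l r : F).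
Hypotheses (l0 : l != 0) (r0 : r != 0) (n3 : (3 <= n)%N).
Hypothesis rn : forall k, (1 <= k <= n)%N -> (r ^+ k) ^+ 2 != 1.

Let m : F := r^-1 - r.
Let t : F := r ^+ 3 / l.
Let D : F := (t - r ^+ 2) * (t + 1).

Local Notation V := (lk_space F n).
Local Notation nu := (@lk_nu F n l r).
Local Notation row := (lk_row l r).
Implicit Types (u v : V) (i : 'I_n.-1) (U W : {vspace V}) (g : nat -> F).

Let co_nu_l := @lk_co_nu_l F n l r l0 r0.
Let co_nu_l1 := @lk_co_nu_l1 F n l r l0 r0.
Let co_nu_r := @lk_co_nu_r F n l r l0 r0.
Let co_nu_r1 := @lk_co_nu_r1 F n l r l0 r0.
Let co_nu_out := @lk_co_nu_out F n l r l0 r0.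

Let r2N1 : r ^+ 2 != -1 := sqr_neqN1 n3 rn.

Local Notation K := (lk_rowker n l r).

(** Every coordinate of u is the coordinate at (0, 1) of u moved by a product of generators. *)
Lemma invariant_co01_eq0 U : lk_invariant l r U ->
  (forall u, u \in U -> lk_co 0 1 u = 0) -> U = 0%VS.
Proof.
move=> inv h01; have nuU i u : u \in U -> nu i u \in U by rewrite invariant_mem.
have h0 k : (0 < k < n)%N -> forall u, u \in U -> lk_co 0 k u = 0.
  elim: k => [//|[|k] IH] kn u uU; first exact: h01.
  have kn1 : (k.+1 < n.-1)%N by nat_lia.
  have k0 : (0 < Ordinal kn1)%N by [].
  by rewrite -[LHS](co_nu_l u k0) IH ?nuU //; nat_lia.
have h s : forall k, (s < k < n)%N -> forall u, u \in U -> lk_co s k u = 0.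
  elim: s => [|s IH] k kn u uU; first exact: h0.
  have sn1 : (s < n.-1)%N by nat_lia.
  have sk : ((Ordinal sn1).+1 < k)%N by rewrite /=; nat_lia.
  by rewrite -[LHS](co_nu_r u sk) IH ?nuU //=; nat_lia.
apply/eqP; rewrite -subv0; apply/subvP => u uU; rewrite memv0; apply/eqP.
by apply: lk_co_eq => s k skn; rewrite lk_co0 h.
Qed.

(** The same propagation from the opposite corner. The coordinate at (n - 2, n - 1) serves as the
    form theta on K. *)
Lemma invariant_co_last_eq0 U : lk_invariant l r U ->
  (forall u, u \in U -> lk_co n.-2 n.-1 u = 0) -> U = 0%VS.
Proof.
move=> inv hl; have nuU i u : u \in U -> nu i u \in U by rewrite invariant_mem.
have h1 d s : (s + d).+2 = n -> forall u, u \in U -> lk_co s n.-1 u = 0.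
  elim: d s => [|d IH] s sd u uU.
    have -> : s = n.-2 by nat_lia.
    exact: hl.
  have sn1 : (s < n.-1)%N by nat_lia.
  have sk : ((Ordinal sn1).+1 < n.-1)%N by rewrite /=; nat_lia.
  have e : (s.+1 + d).+2 = n by nat_lia.
  have := co_nu_r1 u sk; rewrite /= !(IH _ e) ?nuU // mulr0 subr0 => <- //.
have h2 d k : (k + d).+1 = n -> forall s u, (s < k)%N -> u \in U -> lk_co s k u = 0.
  elim: d k => [|d IH] k kd s u sk uU.
    have -> : k = n.-1 by nat_lia.
    by apply: (h1 (n.-2 - s)%N) => //; nat_lia.
  have kn1 : (k < n.-1)%N by nat_lia.
  have sk' : (s < Ordinal kn1)%N by [].
  have e : (k.+1 + d).+1 = n by nat_lia.
  have sk1 : (s < k.+1)%N by nat_lia.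
  have := co_nu_l1 u sk'; rewrite /= !(IH _ e s) ?nuU // mulr0 subr0 => <- //.
apply/eqP; rewrite -subv0; apply/subvP => u uU; rewrite memv0; apply/eqP.
apply: lk_co_eq => s k /andP[sk kn]; rewrite lk_co0.
by apply: (h2 (n - k.+1)%N) => //; nat_lia.
Qed.

(** This is r (R_1 - R_0) = 0, with the terms in the coordinate at (0, 1) moved to the right. *)
Lemma rowker_sum v : v \in K ->
  \sum_(k < n) (if (1 < k)%N then r ^+ k * (lk_co 1 k v - r * lk_co 0 k v) else 0)
  = (r ^+ 2 - t) * lk_co 0 1 v.
Proof.
move=> /(mem_rowker l r) h; have h0 := h 0%N ltac:(nat_lia); have h1 := h 1%N ltac:(nat_lia).
rewrite lk_row_sum -/t in h0; rewrite lk_row_sum -/t in h1.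
have n1 : (1 < n)%N by nat_lia.
have n0 : (0 < n)%N by nat_lia.
pose A (k : nat) : F := if k == 1%N then r ^+ 2 * lk_co 0 1 v else 0.
pose B (k : nat) : F := if k == 0%N then - t * lk_co 0 1 v else 0.
have SA : \sum_(k < n) A k = r ^+ 2 * lk_co 0 1 v.
  rewrite (bigD1 (Ordinal n1)) //= {1}/A eqxx big1 ?addr0 // => k.
  by rewrite -val_eqE /= /A => /negPf->.
have SB : \sum_(k < n) B k = - t * lk_co 0 1 v.
  rewrite (bigD1 (Ordinal n0)) //= {1}/B eqxx big1 ?addr0 // => k.
  by rewrite -val_eqE /= /B => /negPf->.
have S0 : forall (x : F) (f : nat -> F), \sum_(k < n) f k = 0 -> \sum_(k < n) (x * f k) = 0.
  by move=> x f e; rewrite -mulr_sumr e mulr0.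
pose f1 k := if (1 < k)%N then r ^+ k / r ^+ 1 * lk_co 1 k v
   else if (k < 1)%N then t * r ^+ k / r ^+ 1 * lk_co k 1 v else 0.
pose f0 k := if (0 < k)%N then r ^+ k / r ^+ 0 * lk_co 0 k v
   else if (k < 0)%N then t * r ^+ k / r ^+ 0 * lk_co k 0 v else 0.
transitivity (\sum_(k < n) (r * f1 k + (- r * f0 k + (A k + B k)))).
  apply: eq_bigr => -[k kn] _ /=; rewrite /f1 /f0 /A /B.
  case: k kn => [|[|k]] kn /=; rewrite ?expr0 ?expr1 ?divr1.
  - by field.
  - by ring.
  - by field.
rewrite !big_split /= SA SB (S0 _ f1 h1) (S0 _ f0 h0) !add0r.
by ring.
Qed.

Lemma rowker_last_form : K != 0%VS -> D = 0 -> exists2 u, u \in K & lk_form n (lk_delta F n.-2 n.-1) u != 0.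
Proof.
move=> K0 D0; have [inv _] := rowker_defect_free l0 r0 n3 D0.
case: (boolP [exists j : 'I_(\dim K), lk_co n.-2 n.-1 (vbasis K)`_j != 0]).
  move=> /existsP[j hj]; exists (vbasis K)`_j; last by rewrite lk_formE.
  by apply: vbasis_mem; apply: mem_nth; rewrite size_tuple.
move=> /existsPn h; case/eqP: K0; apply: invariant_co_last_eq0 => // u.
move=> /coord_vbasis->; rewrite /lk_co lk_pair_sum big1 // => j _.
by rewrite lk_pairZ; have := h j; rewrite negbK => /eqP; rewrite /lk_co => ->; rewrite mulr0.
Qed.

(** Multiplied by -1/r by g_0 and g_1 when t = -1. Up to scaling, [alternating01E] forces the
    coefficients. *)
Definition hook_vec : V :=
  lk_w F n 0 1 - r^-1 *: lk_w F n 0 2 + r^-1 ^+ 2 *: lk_w F n 1 2.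

(** Formally the product (e_0 - e_1/r)(e_2 - e_3/r) of two alternating pairs, for the commuting
    generators g_0 and g_2. *)
Definition row2_vec : V :=
  lk_w F n 0 2 - r^-1 *: lk_w F n 0 3 - r^-1 *: lk_w F n 1 2 + r^-1 ^+ 2 *: lk_w F n 1 3.

Lemma lk_coN s k v : lk_co s k (- v) = - lk_co s k v.
Proof. by rewrite -scaleN1r lk_coZ mulN1r. Qed.

Let coE := (lk_coD, lk_coN, lk_coZ).

Lemma lk_co_w s k a b : (a < b < n)%N -> lk_co s k (lk_w F n a b) = lk_delta F s k a b.
Proof. exact: lk_pair_w. Qed.

Fact lk_gen0 : (0 < n.-1)%N. Proof. nat_lia. Qed.
Fact lk_gen1 : (1 < n.-1)%N. Proof. nat_lia. Qed.
Let i0 : 'I_n.-1 := Ordinal lk_gen0.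
Let i1 : 'I_n.-1 := Ordinal lk_gen1.

(** A generator multiplies by r the coordinates away from its two strands, so these vanish, as r <>
    -1/r. The eigenvector equations tie the others together. *)
Lemma alternating01E v : D = 0 -> v \in K -> nu i0 v = - r^-1 *: v -> nu i1 v = - r^-1 *: v ->
  v = lk_co 0 1 v *: hook_vec.
Proof.
move=> D0 vK a0 a1; have c0 s k : lk_co s k (nu i0 v) = - r^-1 * lk_co s k v by rewrite a0 lk_coZ.
have c1 s k : lk_co s k (nu i1 v) = - r^-1 * lk_co s k v by rewrite a1 lk_coZ.
have rr : r + r^-1 != 0.
  apply: contra r2N1 => /eqP e; rewrite -addr_eq0; apply/eqP.
  by transitivity (r * (r + r^-1)); [field | rewrite e mulr0].
have out x : r * x = - r^-1 * x -> x = 0.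
  move=> e; apply: (mulfI rr); rewrite mulr0 mulrDl e; ring.
have out0 s k : (1 < s)%N -> (s < k)%N -> lk_co s k v = 0.
  move=> s1 sk; apply: out; rewrite -c0 co_nu_out //; apply/and4P; split; rewrite /=; nat_lia.
have out1 k : (2 < k)%N -> lk_co 0 k v = 0.
  move=> k2; apply: out; rewrite -c1 co_nu_out //; apply/and4P; split; rewrite /=; nat_lia.
have e1 k : (1 < k)%N -> lk_co 1 k v = - r^-1 * lk_co 0 k v.
  by move=> k1; rewrite -c0; symmetry; apply: (@co_nu_r i0 k v).
have e2 : lk_co 0 2 v = - r^-1 * lk_co 0 1 v.
  by rewrite -c1; symmetry; apply: (@co_nu_l i1 0%N v).
apply: lk_co_eq => s k /andP[sk kn]; rewrite lk_coZ /hook_vec !coE !lk_co_w; try nat_lia.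
rewrite /lk_delta.
case: s sk => [|[|s]] sk /=.
- case: k sk kn => [|[|[|k]]] // sk kn /=; first by ring.
    by rewrite e2; ring.
  by rewrite out1 //; ring.
- case: k sk kn => [|[|[|k]]] // sk kn /=; first by rewrite e1 // e2; field.
  by rewrite e1 // out1 //; ring.
by rewrite out0 //; ring.
Qed.

Lemma lk_row_w j a b : (a < b < n)%N -> row j (lk_w F n a b) = lk_rowc l r j a b.
Proof. exact: lk_pair_w. Qed.

Lemma lk_dot_w u a b : (a < b < n)%N -> lk_dot u (lk_w F n a b) = lk_co a b u.
Proof. by move=> abn; rewrite /lk_dot lk_pair_w. Qed.

Lemma lk_dotZ u x v : lk_dot u (x *: v) = x * lk_dot u v. Proof. exact: lk_pairZ. Qed.
Lemma lk_dotD u v w : lk_dot u (v + w) = lk_dot u v + lk_dot u w. Proof. exact: lk_pairD. Qed.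
Lemma lk_dotN u v : lk_dot u (- v) = - lk_dot u v.
Proof. by rewrite -scaleN1r lk_dotZ mulN1r. Qed.

Let rr : r + r^-1 != 0.
Proof.
apply: contra r2N1 => /eqP e; rewrite -addr_eq0; apply/eqP.
by transitivity (r * (r + r^-1)); [field | rewrite e mulr0].
Qed.

Let s3 : 1 + r ^+ 2 + r ^+ 4 != 0.
Proof.
have : (r ^+ 3) ^+ 2 != 1 by apply: rn; nat_lia.
apply: contra => /eqP e; rewrite -subr_eq0; apply/eqP.
by transitivity ((r ^+ 2 - 1) * (1 + r ^+ 2 + r ^+ 4)); [ring | rewrite e mulr0].
Qed.

Let lVE : l^-1 = t / r ^+ 3.
Proof. by rewrite /t; field; rewrite l0 r0. Qed.

(** On K, nu_0 multiplies the coordinate at (0, 1) by t/r = r, so that of an alternating vector is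
    0. *)
Lemma alternating01_y1 v : t = r ^+ 2 -> v \in K -> nu i0 v = - r^-1 *: v -> nu i1 v = - r^-1 *: v ->
  v = 0.
Proof.
move=> tE vK a0 a1; have D0 : D = 0 by rewrite /D tE subrr mul0r.
rewrite (alternating01E D0 vK a0 a1).
suff -> : lk_co 0 1 v = 0 by rewrite scale0r.
have := rowker_co_diag l0 r0 i0 vK; rewrite a0 lk_coZ /= -/t tE => e.
by apply: (mulfI rr); rewrite mulr0 mulrDl -[r^-1 * _]opprK -mulNr e; field.
Qed.

Lemma co01_mul_eq0 U x : lk_invariant l r U -> x != 0 ->
  (forall u, u \in U -> x * lk_co 0 1 u = 0) -> U = 0%VS.
Proof.
move=> inv x0 h; apply: invariant_co01_eq0 => // u uU.
by apply: (mulfI x0); rewrite h // mulr0.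
Qed.

(* If X_k := a_{1k} - r a_{0k} satisfies X_2 = x, then X_k = r^(k-2) x, as
   nu_k carries X_k to X_{k+1} and multiplies X_2 (and a_{01}) by r. *)
Lemma invariant_diff U (f : V -> F) x : lk_invariant l r U ->
  (forall i u, u \in U -> (x <= i)%N -> f (nu i u) = r * f u) ->
  (2 <= x)%N ->
  (forall u, u \in U -> r ^+ x * (lk_co 1 x u - r * lk_co 0 x u) = (r ^+ x) ^+ 2 * f u) ->
  forall k u, (x <= k < n)%N -> u \in U ->
    r ^+ k * (lk_co 1 k u - r * lk_co 0 k u) = (r ^+ k) ^+ 2 * f u.
Proof.
move=> inv fi x2 h2 k u /andP[xk]; have [d ->] : exists d, k = (x + d)%N by exists (k - x)%N; nat_lia.
elim: d u => [|d IH] u kn uU; first by rewrite addn0 h2.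
have k1 : (x + d < n.-1)%N by nat_lia.
have nuu : nu (Ordinal k1) u \in U by rewrite invariant_mem.
have kn' : (x + d < n)%N by nat_lia.
have := IH (nu (Ordinal k1) u) kn' nuu.
have s0 : (0 < Ordinal k1)%N by rewrite /=; nat_lia.
have s1 : (1 < Ordinal k1)%N by rewrite /=; nat_lia.
have e0 := co_nu_l u s0; have e1 := co_nu_l u s1; rewrite /= in e0 e1.
rewrite e0 e1 fi //=; last nat_lia.
rewrite addnS (exprS r (x + d)) => e.
by rewrite -mulrA e; ring.
Qed.

(** q is -r^3 times the antisymmetrizer sum_w (-1/r)^len(w) g_w of S_3 applied to x1. The hypotheses
    list the g_w x1 in pairs linked by one generator, so that the lemma serves for both
    generators. *)
Lemma antisymmetrizer_eigen (f : 'End(V)) (x1 x2 x3 x4 x5 x6 : V) :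
  f x1 = x2 -> f x2 = x1 - m *: x2 -> f x3 = x4 -> f x4 = x3 - m *: x4 ->
  f x5 = x6 -> f x6 = x5 - m *: x6 ->
  let q := x6 - r *: (x4 + x5) + r ^+ 2 *: (x2 + x3) - r ^+ 3 *: x1 in f q = - r^-1 *: q.
Proof.
move=> e1 e2 e3 e4 e5 e6 q; rewrite /q.
have fD u v : f (u + v) = f u + f v := linearD f u v.
have fN u : f (- u) = - f u := linearN f u.
have fZ c u : f (c *: u) = c *: f u by rewrite linearZ.
rewrite !(fD, fN, fZ) e1 e2 e3 e4 e5 e6.
apply: lk_co_eq => s k _; rewrite !coE; rewrite /m.
move: (lk_co s k x1) (lk_co s k x2) (lk_co s k x3) (lk_co s k x4) (lk_co s k x5) (lk_co s k x6).
by move=> y1 y2 y3 y4 y5 y6; field.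
Qed.

Section Hook.
Hypothesis tN1 : t = -1.

Let D0 : D = 0. Proof. by rewrite /D tN1 addNr mulr0. Qed.

Lemma hook_vec_rowker : hook_vec \in K.
Proof.
apply/mem_rowker => j jn; rewrite /hook_vec lk_rowD lk_rowB !lk_rowZ !lk_row_w; try nat_lia.
rewrite /lk_rowc -/t tN1; by case: j jn => [|[|[|j]]] jn /=; rewrite ?expr0 ?expr1 ?divr1; field; rewrite ?r0.
Qed.

Lemma hook_vec_alt0 : nu i0 hook_vec = - r^-1 *: hook_vec.
Proof.
rewrite /hook_vec !linearD !linearN !linearZ /= !lk_nu_w_eq //; try nat_lia.
rewrite /lk_nu_w /= lVE tN1; apply: lk_co_eq => s k skn; rewrite !coE.
move: (lk_co s k _) (lk_co s k _) (lk_co s k _) => x y z; rewrite expr0; field.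
by rewrite r0.
Qed.

Lemma hook_vec_alt1 : nu i1 hook_vec = - r^-1 *: hook_vec.
Proof.
rewrite /hook_vec !linearD !linearN !linearZ /= !lk_nu_w_eq //; try nat_lia.
rewrite /lk_nu_w /= -[(1 - 0 - 1)%N]/0%N expr0 mulr1 lVE tN1; apply: lk_co_eq => s k skn; rewrite !coE.
move: (lk_co s k _) (lk_co s k _) (lk_co s k _) => x y z; field.
by rewrite r0.
Qed.

Lemma hook_vec_neq0 : hook_vec != 0.
Proof.
apply/eqP => h; have := lk_co0 F n 0 1; rewrite -h /hook_vec !coE !lk_co_w; try nat_lia.
by rewrite /lk_delta /= !mulr0 subr0 addr0 => /eqP; rewrite oner_eq0.
Qed.

Lemma lk_dot_hook u :
  lk_dot u hook_vec = lk_co 0 1 u - r^-1 * lk_co 0 2 u + r^-1 ^+ 2 * lk_co 1 2 u.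
Proof. by rewrite /hook_vec !lk_dotD lk_dotN !lk_dotZ !lk_dot_w //; nat_lia. Qed.

Lemma hook_dot_neq0 : lk_dot hook_vec hook_vec != 0.
Proof.
rewrite lk_dot_hook /hook_vec !coE !lk_co_w; try nat_lia.
rewrite /lk_delta /=; apply: contra s3 => /eqP e; apply/eqP.
rewrite -[RHS](mulr0 (r ^+ 4)) -[in RHS]e; field.
by rewrite r0.
Qed.

(** Orthogonality expresses X_2, and with [invariant_diff] every X_k, through a_{01}; then
    [rowker_sum] becomes (sum_{k<n} r^{2k}) a_{01} = 0. *)
Lemma hook_dot_eq0 U : lk_invariant l r U -> (U <= K)%VS ->
  (forall u, u \in U -> lk_dot u hook_vec = 0) -> U = 0%VS.
Proof.
move=> inv UK h; have c2 u : u \in U ->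
    r ^+ 2 * (lk_co 1 2 u - r * lk_co 0 2 u) = (r ^+ 2) ^+ 2 * (- lk_co 0 1 u).
  move=> uU; have := h u uU; rewrite lk_dot_hook => e.
  apply/eqP; rewrite -subr_eq0; apply/eqP.
  transitivity (r ^+ 4 * (lk_co 0 1 u - r^-1 * lk_co 0 2 u + r^-1 ^+ 2 * lk_co 1 2 u)).
    by field; rewrite r0.
  by rewrite e mulr0.
have fi (i : 'I_n.-1) u : u \in U -> (2 <= i)%N -> - lk_co 0 1 (nu i u) = r * - lk_co 0 1 u.
  move=> uU i2; rewrite co_nu_out ?mulrN //; apply/and4P; split; nat_lia.
have X := @invariant_diff U (fun u => - lk_co 0 1 u) 2 inv fi (leqnn 2) c2.
have h3 : \sum_(k < n) (if (k < n)%N then (r ^+ k) ^+ 2 else 0) != 0.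
  by apply: (geom_neq0 _ rn); nat_lia.
apply: (co01_mul_eq0 inv h3) => u uU.
have := rowker_sum (subvP UK u uU); rewrite tN1 opprK.
have -> : \sum_(k < n) (if (1 < k)%N then r ^+ k * (lk_co 1 k u - r * lk_co 0 k u) else 0)
   = (\sum_(k < n) (if (1 < k)%N then (r ^+ k) ^+ 2 else 0)) * - lk_co 0 1 u.
  rewrite mulr_suml; apply: eq_bigr => k _; case: ifP => k1; last by rewrite mul0r.
  by rewrite X // k1 ltn_ord.
move=> e.
have -> : \sum_(k < n) (if (k < n)%N then (r ^+ k) ^+ 2 else 0) =
   \sum_(k < n) (if (1 < k)%N then (r ^+ k) ^+ 2 else 0) + (r ^+ 2 + 1).
  have n1 : (1 < n)%N by nat_lia.
  have n0 : (0 < n)%N by nat_lia.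
  rewrite (bigD1 (Ordinal n0)) //= (bigD1 (Ordinal n1)) //= [X in _ = X + _](bigD1 (Ordinal n0)) //=.
  rewrite [X in _ = _ + X + _](bigD1 (Ordinal n1)) //= n0 n1 expr0 expr1 expr1n.
  rewrite (eq_bigr (fun k : 'I_n => if (1 < k)%N then (r ^+ k) ^+ 2 else 0)); first by ring.
  move=> k; rewrite -!val_eqE /= ltn_ord => /andP[k0 k1]; rewrite ifT //; nat_lia.
by rewrite mulrDl -e; ring.
Qed.

(** Antisymmetrizing an element of W not orthogonal to [hook_vec] gives a multiple q of [hook_vec]
    in W. By self-adjointness q is not orthogonal to [hook_vec] either, so it is nonzero. *)
Lemma rowker_irreducible_hook : lk_irreducible l r K.
Proof.
have dfK := rowker_defect_free l0 r0 n3 D0.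
have [_ quad braid _] := defect_free_module l0 r0 dfK.
apply: (dot_irreducible l0 r0 n3 D0 hook_vec_rowker hook_dot_neq0) => W inv WK W0.
have nuW i u : u \in W -> nu i u \in W by rewrite invariant_mem.
have [u uW du] : exists2 u, u \in W & lk_dot u hook_vec != 0.
  case: (boolP [exists j : 'I_(\dim W), lk_dot (vbasis W)`_j hook_vec != 0]).
    move=> /existsP[j hj]; exists (vbasis W)`_j => //.
    by apply: vbasis_mem; apply: mem_nth; rewrite size_tuple.
  move=> /existsPn h; case/eqP: W0; apply: hook_dot_eq0 => // u.
  move=> /coord_vbasis->; rewrite lk_dotC /lk_dot lk_pair_sum big1 // => j _.
  rewrite lk_pairZ -[lk_pair _ _]/(lk_dot hook_vec _) lk_dotC.
  by have := h j; rewrite negbK => /eqP->; rewrite mulr0.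
have uK := subvP WK u uW.
pose a := nu i0; pose b := nu i1.
have aK x : x \in K -> a x \in K by move=> xK; rewrite invariant_mem //; case: dfK.
have bK x : x \in K -> b x \in K by move=> xK; rewrite invariant_mem //; case: dfK.
have aa x : x \in K -> a (a x) = x - m *: a x by move=> xK; apply: (canRL (addrK _)); apply: quad.
have bb x : x \in K -> b (b x) = x - m *: b x by move=> xK; apply: (canRL (addrK _)); apply: quad.
have aba x : x \in K -> b (a (b x)) = a (b (a x)) by move=> xK; symmetry; apply: braid.
have auK := aK u uK; have buK := bK u uK; have bauK := bK _ auK; have abuK := aK _ buK.
pose q := a (b (a u)) - r *: (a (b u) + b (a u)) + r ^+ 2 *: (a u + b u) - r ^+ 3 *: u.
have qW : q \in W.
  by rewrite memvB ?memvZ // memvD ?memvB ?memvZ ?memvD ?nuW.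
have qa : a q = - r^-1 *: q.
  apply: (@antisymmetrizer_eigen a u (a u) (b u) (a (b u)) (b (a u)) (a (b (a u)))) => //;
    [exact: aa uK | exact: aa buK | exact: aa bauK].
have qb : b q = - r^-1 *: q.
  rewrite /q [a (b u) + _]addrC [a u + _]addrC.
  apply: (@antisymmetrizer_eigen b u (b u) (a u) (b (a u)) (a (b u)) (a (b (a u)))) => //.
  - exact: bb uK.
  - exact: bb auK.
  - exact: aba uK.
  - by rewrite -(aba _ uK) (bb _ abuK).
have qE := alternating01E D0 (subvP WK q qW) qa qb.
have sym x i : x \in K -> lk_dot (nu i x) hook_vec = lk_dot x (nu i hook_vec).
  by move=> xK; apply: rowker_dot_nu => //; apply: hook_vec_rowker.
(* The factor is -r^3 times the Poincare polynomial sum_w r^(-2 len(w)) of S_3. *)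
have dq : lk_dot q hook_vec = - (r + r^-1) * (1 + r ^+ 2 + r ^+ 4) / r ^+ 2 * lk_dot u hook_vec.
  have sa x : x \in K -> lk_dot (a x) hook_vec = - r^-1 * lk_dot x hook_vec.
    by move=> xK; rewrite sym // hook_vec_alt0 lk_dotZ.
  have sb x : x \in K -> lk_dot (b x) hook_vec = - r^-1 * lk_dot x hook_vec.
    by move=> xK; rewrite sym // hook_vec_alt1 lk_dotZ.
  have ex h : lk_dot h q = lk_dot h (a (b (a u))) - r * (lk_dot h (a (b u)) + lk_dot h (b (a u)))
      + r ^+ 2 * (lk_dot h (a u) + lk_dot h (b u)) - r ^+ 3 * lk_dot h u.
    by rewrite /q !(lk_dotD, lk_dotN, lk_dotZ).
  rewrite lk_dotC ex ![lk_dot hook_vec _]lk_dotC.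
  rewrite (sa _ bauK) (sb _ auK) (sa _ buK) (sa _ uK) (sb _ uK).
  by move: (lk_dot _ _) => x; field.
have c0 : lk_co 0 1 q != 0.
  apply: contraNneq du => e; move: dq; rewrite qE e scale0r lk_dotC [LHS]lk_pair0 => /esym/eqP.
  by rewrite !mulf_eq0 oppr_eq0 (negPf rr) (negPf s3) invr_eq0 expf_eq0 (negPf r0).
by rewrite -[hook_vec]scale1r -(mulVf c0) -scalerA -qE memvZ.
Qed.

End Hook.

Lemma exists_form_neq0 U (f : 'Hom(V, F^o)) : ~ (forall u, u \in U -> f u = 0) ->
  exists2 u, u \in U & f u != 0.
Proof.
move=> h; case: (boolP [exists j : 'I_(\dim U), f (vbasis U)`_j != 0]).
  move=> /existsP[j hj]; exists (vbasis U)`_j => //.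
  by apply: vbasis_mem; apply: mem_nth; rewrite size_tuple.
move=> /existsPn h0; case: h => u /coord_vbasis->; rewrite linear_sum big1 // => j _.
by rewrite linearZ /=; have := h0 j; rewrite negbK => /eqP->; rewrite scaler0.
Qed.

Lemma sum_gt_neq0 j : (j.+1 < n)%N ->
  \sum_(k < n) (if (j < k)%N then (r ^+ k) ^+ 2 else 0) != 0.
Proof.
move=> jn; have jn' : (j < n)%N by nat_lia.
have h := sum_sqr_gt r jn'; apply/eqP => e; move: h; rewrite e mulr0 => /esym/eqP.
have [d dE] : exists d, n = (j.+1 + d)%N by exists (n - j.+1)%N; nat_lia.
have dn : (1 <= d <= n)%N by nat_lia.
have := rn dn; rewrite [in r ^+ n]dE exprD exprMn subr_eq0 => d1 /eqP e1.
case/eqP: d1; apply: (mulfI (expf_neq0 2 (expf_neq0 j.+1 r0))).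
by rewrite mulr1 -e1.
Qed.

Section TwoRows.
Hypotheses (n4 : (4 <= n)%N) (tE : t = r ^+ 2).

Fact lk_gen2 : (2 < n.-1)%N. Proof. nat_lia. Qed.
Local Notation i2 := (Ordinal lk_gen2).

Let D0 : D = 0. Proof. by rewrite /D tE subrr mul0r. Qed.

Local Notation p := row2_vec.

Lemma alternating02E v : v \in K -> nu i0 v = - r^-1 *: v -> nu i2 v = - r^-1 *: v ->
  v = lk_co 0 2 v *: p.
Proof.
move=> vK a0 a2; have c0 s k : lk_co s k (nu i0 v) = - r^-1 * lk_co s k v by rewrite a0 lk_coZ.
have c2 s k : lk_co s k (nu i2 v) = - r^-1 * lk_co s k v by rewrite a2 lk_coZ.
have out x : r * x = - r^-1 * x -> x = 0.
  move=> e; apply: (mulfI rr); rewrite mulr0 mulrDl e; ring.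
have out0 s k : (1 < s)%N -> (s < k)%N -> lk_co s k v = 0.
  move=> s1 sk; apply: out; rewrite -c0 co_nu_out //; apply/and4P; split; rewrite /=; nat_lia.
have out2 s k : (s < 2)%N -> (s < k)%N -> k != 2%N -> k != 3%N -> lk_co s k v = 0.
  move=> s2 sk k2 k3; apply: out; rewrite -c2 co_nu_out //; apply/and4P; split; rewrite /=; nat_lia.
have e1 k : (1 < k)%N -> lk_co 1 k v = - r^-1 * lk_co 0 k v.
  by move=> k1; rewrite -c0; symmetry; apply: (@co_nu_r i0 k v).
have e3 : lk_co 0 3 v = - r^-1 * lk_co 0 2 v.
  by rewrite -c2; symmetry; apply: (@co_nu_l i2 0%N v).
apply: lk_co_eq => s k /andP[sk kn]; rewrite lk_coZ /row2_vec !coE !lk_co_w; try nat_lia.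
rewrite /lk_delta.
case: s sk => [|[|s]] sk /=.
- case: k sk kn => [|[|[|[|k]]]] // sk kn /=; first by rewrite out2 //; ring.
  + by ring.
  + by rewrite e3; ring.
  + by rewrite out2 //; ring.
- case: k sk kn => [|[|[|[|k]]]] // sk kn /=; first by rewrite e1 //; ring.
  + by rewrite e1 // e3; ring.
  + by rewrite out2 //; ring.
by rewrite out0 //; ring.
Qed.

Lemma row2_vec_rowker : p \in K.
Proof.
apply/mem_rowker => j jn; rewrite /row2_vec lk_rowD !lk_rowB !lk_rowZ !lk_row_w; try nat_lia.
rewrite /lk_rowc -/t tE.
by case: j jn => [|[|[|[|j]]]] jn /=; rewrite ?expr0 ?expr1 ?divr1; field; rewrite ?r0.
Qed.

Lemma row2_vec_alt0 : nu i0 p = - r^-1 *: p.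
Proof.
rewrite /row2_vec !linearD !linearN !linearZ /= !lk_nu_w_eq //; try nat_lia.
rewrite /lk_nu_w /= -[(2 - 0 - 2)%N]/0%N -[(3 - 0 - 2)%N]/1%N expr0 expr1 mulr1.
apply: lk_co_eq => s k skn; rewrite !coE.
move: (lk_co s k _) (lk_co s k _) (lk_co s k _) (lk_co s k _) (lk_co s k _) => x y z u w; field.
by rewrite r0.
Qed.

Lemma row2_vec_alt2 : nu i2 p = - r^-1 *: p.
Proof.
rewrite /row2_vec !linearD !linearN !linearZ /= !lk_nu_w_eq //; try nat_lia.
rewrite /lk_nu_w /= -[(2 - 0 - 1)%N]/1%N -[(2 - 1 - 1)%N]/0%N expr0 expr1 mulr1 invfM lVE tE.
apply: lk_co_eq => s k skn; rewrite !coE.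
move: (lk_co s k _) (lk_co s k _) (lk_co s k _) (lk_co s k _) (lk_co s k _) => x y z u w; field.
by rewrite r0.
Qed.

Lemma row2_vec_neq0 : p != 0.
Proof.
apply/eqP => h; have := lk_co0 F n 0 2; rewrite -h /row2_vec !coE !lk_co_w; try nat_lia.
by rewrite /lk_delta /= !mulr0 !subr0 addr0 => /eqP; rewrite oner_eq0.
Qed.

Lemma lk_dot_row2 u : lk_dot u p =
  lk_co 0 2 u - r^-1 * lk_co 0 3 u - r^-1 * lk_co 1 2 u + r^-1 ^+ 2 * lk_co 1 3 u.
Proof. by rewrite /row2_vec !lk_dotD !lk_dotN !lk_dotZ !lk_dot_w //; nat_lia. Qed.

Lemma row2_dot_neq0 : lk_dot p p != 0.
Proof.
rewrite lk_dot_row2 /row2_vec !coE !lk_co_w; try nat_lia.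
rewrite /lk_delta /=; have := expf_neq0 2 rr; apply: contra => /eqP e; apply/eqP.
rewrite -[RHS](mulr0 (r ^+ 2)) -[in RHS]e; field.
by rewrite r0.
Qed.

(** Orthogonality expresses X_k, k >= 3, through X_2, and for t = r^2 the right side of [rowker_sum]
    is 0, so X_2 = 0. Applied to nu_1 u this gives a_{02} = r a_{01}, hence a_{0k} = r^(k-1) a_{01},
    and R_0 = 0 leaves a_{01} = 0. *)
Lemma row2_dot_eq0 U : lk_invariant l r U -> (U <= K)%VS ->
  (forall u, u \in U -> lk_dot u p = 0) -> U = 0%VS.
Proof.
move=> inv UK h; have nuU i u : u \in U -> nu i u \in U by rewrite invariant_mem.
(* Normalized so that r^k X_k = r^{2k} f also holds at k = 2. *)
pose f u : F := r^-1 ^+ 2 * (lk_co 1 2 u - r * lk_co 0 2 u).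
have c3 u : u \in U -> r ^+ 3 * (lk_co 1 3 u - r * lk_co 0 3 u) = (r ^+ 3) ^+ 2 * f u.
  move=> uU; have := h u uU; rewrite lk_dot_row2 => e.
  apply/eqP; rewrite -subr_eq0; apply/eqP.
  transitivity (r ^+ 5 * (lk_co 0 2 u - r^-1 * lk_co 0 3 u - r^-1 * lk_co 1 2 u + r^-1 ^+ 2 * lk_co 1 3 u)).
    by rewrite /f; field; rewrite r0.
  by rewrite e mulr0.
have fi (i : 'I_n.-1) u : u \in U -> (3 <= i)%N -> f (nu i u) = r * f u.
  move=> uU i3; rewrite /f !co_nu_out; first by ring.
    by apply/and4P; split; nat_lia.
  by apply/and4P; split; nat_lia.
have X k u : (3 <= k < n)%N -> u \in U ->
    r ^+ k * (lk_co 1 k u - r * lk_co 0 k u) = (r ^+ k) ^+ 2 * f u.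
  by move=> kn uU; apply: (@invariant_diff U f 3).
have X2 u : u \in U -> lk_co 1 2 u - r * lk_co 0 2 u = 0.
  move=> uU; have := rowker_sum (subvP UK u uU); rewrite -/t tE subrr mul0r.
  have -> : \sum_(k < n) (if (1 < k)%N then r ^+ k * (lk_co 1 k u - r * lk_co 0 k u) else 0)
     = (\sum_(k < n) (if (1 < k)%N then (r ^+ k) ^+ 2 else 0)) * f u.
    rewrite mulr_suml; apply: eq_bigr => k _; case: ifP => k1; last by rewrite mul0r.
    have [e|k2] := eqVneq (nat_of_ord k) 2%N; first by rewrite e /f; field; rewrite r0.
    by rewrite X // ltn_ord; nat_lia.
  move/eqP; rewrite mulf_eq0 (negPf (sum_gt_neq0 _)); last nat_lia.
  by rewrite /= mulf_eq0 expf_eq0 invr_eq0 (negPf r0) /= => /eqP.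
have a2 u : u \in U -> lk_co 0 2 u = r * lk_co 0 1 u.
  move=> uU; have := X2 _ (nuU i1 u uU).
  have -> : lk_co 1 2 (nu i1 u) = r * lk_co 1 2 u.
    have := rowker_co_diag l0 r0 i1 (subvP UK u uU); rewrite /= -/t tE => ->.
    by field.
  have -> : lk_co 0 2 (nu i1 u) = lk_co 0 1 u - m * lk_co 0 2 u by apply: (@co_nu_l1 i1 0%N u).
  have /eqP := X2 u uU; rewrite subr_eq0 => /eqP->; rewrite /m => e.
  apply/eqP; rewrite -subr_eq0 -[X in _ == X]e; apply/eqP; by field.
have ak k u : (1 <= k < n)%N -> u \in U -> r * lk_co 0 k u = r ^+ k * lk_co 0 1 u.
  elim: k u => [//|[|[|k]] IH] u kn uU; first by rewrite expr1.
    by rewrite a2 //; ring.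
  have k1 : (k.+2 < n.-1)%N by nat_lia.
  have s0 : (0 < Ordinal k1)%N by [].
  have e0 := co_nu_l u s0; rewrite /= in e0.
  rewrite -e0 (IH (nu (Ordinal k1) u)) ?nuU //; last nat_lia.
  by rewrite co_nu_out // (exprS r k.+2); ring.
apply: invariant_co01_eq0 => // u uU.
have /mem_rowker/(_ 0%N ltac:(nat_lia)) := subvP UK u uU; rewrite lk_row_sum => e.
have n0 : (1 < n)%N by nat_lia.
apply: (mulfI (sum_gt_neq0 n0)); rewrite mulr0.
transitivity (r * \sum_(k < n) (if (0 < k)%N then r ^+ k / r ^+ 0 * lk_co 0 k u
   else if (k < 0)%N then r ^+ 3 / l * r ^+ k / r ^+ 0 * lk_co k 0 u else 0)); last by rewrite e mulr0.
rewrite mulr_suml mulr_sumr; apply: eq_bigr => k _; case: ifP => k0; last by rewrite mul0r mulr0.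
by rewrite expr0 divr1 mulrCA (ak k u) ?k0 ?ltn_ord //; ring.
Qed.

Lemma rowker_irreducible_row2 : lk_irreducible l r K.
Proof.
have dfK := rowker_defect_free l0 r0 n3 D0.
have [_ quad _ comm] := defect_free_module l0 r0 dfK.
apply: (dot_irreducible l0 r0 n3 D0 row2_vec_rowker row2_dot_neq0) => W inv WK W0.
have nuW i u : u \in W -> nu i u \in W by rewrite invariant_mem.
have [u uW du] : exists2 u, u \in W & lk_dot u p != 0.
  have [|u uW] := @exists_form_neq0 W (lk_form n (fun a b => lk_co a b p)).
    move=> h; case/eqP: W0; apply: row2_dot_eq0 => // u /h.
    by rewrite lk_formE -[lk_pair _ _]/(lk_dot p u) lk_dotC.
  by rewrite lk_formE -[lk_pair _ _]/(lk_dot p u) lk_dotC; exists u.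
have uK := subvP WK u uW.
pose a := nu i0; pose b := nu i2.
have aK x : x \in K -> a x \in K by move=> xK; rewrite invariant_mem //; case: dfK.
have bK x : x \in K -> b x \in K by move=> xK; rewrite invariant_mem //; case: dfK.
have aa x : x \in K -> a (a x) = x - m *: a x by move=> xK; apply: (canRL (addrK _)); apply: quad.
have bb x : x \in K -> b (b x) = x - m *: b x by move=> xK; apply: (canRL (addrK _)); apply: quad.
have ab x : x \in K -> a (b x) = b (a x) by move=> xK; apply: comm.
have auK := aK u uK; have buK := bK u uK.
(* r^2 times the antisymmetrizer (1 - g_0/r)(1 - g_2/r). *)
pose q := b (a u) - r *: (a u + b u) + r ^+ 2 *: u.
have qW : q \in W.
  by rewrite memvD ?memvB ?memvZ ?memvD ?nuW.
have eig (f : 'End(V)) (x1 x2 x3 x4 : V) : f x1 = x2 -> f x2 = x1 - m *: x2 -> f x3 = x4 ->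
    f x4 = x3 - m *: x4 -> let q' := x4 - r *: (x2 + x3) + r ^+ 2 *: x1 in f q' = - r^-1 *: q'.
  move=> e1 e2 e3 e4 q'; rewrite /q'.
  have fD x y : f (x + y) = f x + f y := linearD f x y.
  have fN x : f (- x) = - f x := linearN f x.
  have fZ c x : f (c *: x) = c *: f x by rewrite linearZ.
  rewrite !(fD, fN, fZ) e1 e2 e3 e4.
  apply: lk_co_eq => s k _; rewrite !coE /m.
  move: (lk_co s k x1) (lk_co s k x2) (lk_co s k x3) (lk_co s k x4).
  by move=> y1 y2 y3 y4; field.
have qa : a q = - r^-1 *: q.
  apply: (@eig a u (a u) (b u) (b (a u))) => //; first exact: aa uK.
    exact: ab uK.
  by rewrite -(ab _ uK) (aa _ buK).
have qb : b q = - r^-1 *: q.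
  rewrite /q [a u + _]addrC.
  apply: (@eig b u (b u) (a u) (b (a u))) => //; first exact: bb uK.
  exact: bb auK.
have qE := alternating02E (subvP WK q qW) qa qb.
have sym x i : x \in K -> lk_dot (nu i x) p = lk_dot x (nu i p).
  by move=> xK; apply: rowker_dot_nu => //; apply: row2_vec_rowker.
have dq : lk_dot q p = (r + r^-1) ^+ 2 * lk_dot u p.
  have sa x : x \in K -> lk_dot (a x) p = - r^-1 * lk_dot x p.
    by move=> xK; rewrite sym // row2_vec_alt0 lk_dotZ.
  have sb x : x \in K -> lk_dot (b x) p = - r^-1 * lk_dot x p.
    by move=> xK; rewrite sym // row2_vec_alt2 lk_dotZ.
  have ex h : lk_dot h q = lk_dot h (b (a u)) - r * (lk_dot h (a u) + lk_dot h (b u)) + r ^+ 2 * lk_dot h u.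
    by rewrite /q !(lk_dotD, lk_dotN, lk_dotZ).
  rewrite lk_dotC ex ![lk_dot p _]lk_dotC (sb _ auK) (sa _ uK) (sb _ uK).
  by move: (lk_dot _ _) => x; field.
have c0 : lk_co 0 2 q != 0.
  apply: contraNneq du => e; move: dq; rewrite qE e scale0r lk_dotC [LHS]lk_pair0 => /esym/eqP.
  by rewrite mulf_eq0 expf_eq0 (negPf rr).
by rewrite -[p]scale1r -(mulVf c0) -scalerA -qE memvZ.
Qed.

Lemma rowker_iso_row2 : lk_iso_specht l r K [:: n - 2; 2]%N.
Proof.
have [wlP wlu] := shape3 n4; have dfK := rowker_defect_free l0 r0 n3 D0.
have K0 : K != 0%VS.
  by apply: contraNneq row2_vec_neq0 => K0; rewrite -memv0 -K0 row2_vec_rowker.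
have [u uK hu] := rowker_last_form K0 D0.
(* Every generator of the row subgroup multiplies the coordinate at (n - 2, n - 1) by r: g_{n-2}
   because t/r = r, and the others because they avoid both strands, g_{n-3} being excluded by the
   shape. *)
apply: (@irreducible_iso_specht F n r [:: n - 2; 2]%N r0 r2N1 wlP wlu _ _ _ _ _
   (lk_form n (lk_delta F n.-2 n.-1)) _ u p) => //.
- exact: defect_free_module.
- by move=> W WU inv' W0; apply: rowker_irreducible_row2.
- move=> i v ri vK; rewrite !lk_formE; have h := adjacent_row3 n3 (strandS_lt i) ri.
  have [e|ne] := eqVneq (nat_of_ord i) n.-2.
    have := rowker_co_diag l0 r0 i vK; rewrite -/t tE e; have -> : n.-2.+1 = n.-1 by nat_lia.
    by rewrite /lk_co => ->; field.
  by apply: co_nu_out; have := ltn_ord i; move=> ?; apply/and4P; split; nat_lia.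
- exact: row2_vec_rowker.
- exact: row2_vec_neq0.
- move=> i ci; have [h|h] := adjacent_col3 n3 n4 (strandS_lt i) ci.
    by rewrite (_ : i = i0) ?row2_vec_alt0 //; apply: val_inj.
  by rewrite (_ : i = i2) ?row2_vec_alt2 //; apply: val_inj.
Qed.

End TwoRows.

Lemma rowker_iso_hook : t = -1 -> lk_iso_specht l r K [:: n - 2; 1; 1]%N.
Proof.
move=> tN1; have D0 : D = 0 by rewrite /D tN1 addNr mulr0.
have [wlP wlu] := shape4 n3; have dfK := rowker_defect_free l0 r0 n3 D0.
have hK : hook_vec \in K by apply: hook_vec_rowker.
have h0 : hook_vec != 0 by apply: hook_vec_neq0.
have K0 : K != 0%VS by apply: contraNneq h0 => K0; rewrite -memv0 -K0.
have [u uK hu] := rowker_last_form K0 D0.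
(* The shape excludes both g_{n-3} and g_{n-2}; the other generators avoid the strands n - 2 and n -
   1. *)
apply: (@irreducible_iso_specht F n r [:: n - 2; 1; 1]%N r0 r2N1 wlP wlu _ _ _ _ _
   (lk_form n (lk_delta F n.-2 n.-1)) _ u (hook_vec)) => //.
- exact: defect_free_module.
- by move=> W WU inv' W0; apply: rowker_irreducible_hook.
- move=> i v ri vK; rewrite !lk_formE; have h := adjacent_row4 n3 (strandS_lt i) ri.
  by apply: co_nu_out; apply/and4P; split; nat_lia.
- move=> i ci; have h := adjacent_col4 n3 (strandS_lt i) ci.
  have [e|e] : nat_of_ord i = 0%N \/ nat_of_ord i = 1%N by nat_lia.
    by rewrite (_ : i = i0) ?hook_vec_alt0 //; apply: val_inj.
  by rewrite (_ : i = i1) ?hook_vec_alt1 //; apply: val_inj.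
Qed.

(** R_0 / r^2 + R_1 - R_2 is (r + 1/r) a_{01}, and the other two coordinates follow. This accounts
    for the condition n >= 4. *)
Lemma rowker3_eq0 : t = r ^+ 2 -> n = 3%N -> K = 0%VS.
Proof.
move=> tE e3; apply/eqP; rewrite -subv0; apply/subvP => v vK; rewrite memv0; apply/eqP.
have /mem_rowker h := vK.
pose f j k : F := if (j < k)%N then r ^+ k / r ^+ j * lk_co j k v
   else if (k < j)%N then t * r ^+ k / r ^+ j * lk_co k j v else 0.
have sum3 (g : nat -> F) : \sum_(k < n) g k = g 0%N + g 1%N + g 2%N.
  by rewrite -(big_mkord xpredT g) e3 !big_nat_recr //= big_geq // add0r.
have R j : (j < n)%N -> f j 0%N + f j 1%N + f j 2%N = 0.
  by move=> jn; rewrite -(h j jn) lk_row_sum -/t -(sum3 (f j)).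
have R0 := R 0%N ltac:(nat_lia); have R1 := R 1%N ltac:(nat_lia); have R2 := R 2%N ltac:(nat_lia).
move: R0 R1 R2; rewrite /f tE /= expr0 expr1 !divr1 !add0r !addr0 => R0 R1 R2.
have a01 : lk_co 0 1 v = 0.
  apply: (mulfI rr); rewrite mulr0.
  transitivity (r^-1 ^+ 2 * (r * lk_co 0 1 v + r ^+ 2 * lk_co 0 2 v)
    - (r ^+ 2 * 1 / r ^+ 2 * lk_co 0 2 v + r ^+ 2 * r / r ^+ 2 * lk_co 1 2 v)
    + (r ^+ 2 * 1 / r * lk_co 0 1 v + r ^+ 2 / r * lk_co 1 2 v)).
    by field; rewrite r0.
  by rewrite R0 R1 R2; ring.
have a12 : lk_co 1 2 v = 0.
  by apply: (mulfI r0); rewrite mulr0 -[RHS]R1 a01; field; rewrite r0.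
have a02 : lk_co 0 2 v = 0 by rewrite -R2 a12; field; rewrite r0.
apply: lk_co_eq => s k /andP[sk kn]; rewrite lk_co0.
have k3 : (k < 3)%N by nat_lia.
by case: s k sk k3 {kn} => [|[|s]] [|[|[|k]]].
Qed.

End RowKernelIrreducible.

(** * The list of proper invariant subspaces *)

Section Classification.
Variables (F : fieldType) (n : nat) (l r : F).
Hypotheses (l0 : l != 0) (r0 : r != 0) (n3 : (3 <= n)%N).
Hypothesis rn : forall k, (1 <= k <= n)%N -> (r ^+ k) ^+ 2 != 1.

Let t : F := r ^+ 3 / l.
Let D : F := (t - r ^+ 2) * (t + 1).

Local Notation V := (lk_space F n).
Local Notation nu := (@lk_nu F n l r).
Local Notation row := (lk_row l r).
Implicit Types (u v : V) (i : 'I_n.-1) (U W : {vspace V}) (g : nat -> F).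

Let row_nu_l := @lk_row_nu_l F n l r l0 r0.
Let row_nu_out := @lk_row_nu_out F n l r l0 r0.

Let r21 : 1 - r ^+ 2 != 0.
Proof. by rewrite subr_eq0 eq_sym (sqr_neq1 n3 rn). Qed.

Let r2N1 : r ^+ 2 != -1 := sqr_neqN1 n3 rn.

Local Notation K := (lk_rowker n l r).
Local Notation E := (lk_refl n l r).
Local Notation T := <[lk_sym n r]>%VS.
Local Notation i0 := (Ordinal (lk_gen0 n3)).

Let rr : r + r^-1 != 0.
Proof.
apply: contra r2N1 => /eqP e; rewrite -addr_eq0; apply/eqP.
by transitivity (r * (r + r^-1)); [field | rewrite e mulr0].
Qed.

Lemma expr_ratio_neq1 a b : (a < b <= n)%N -> (r ^+ b) ^+ 2 != (r ^+ a) ^+ 2.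
Proof.
move=> ab; have [d dE] : exists d, b = (a + d)%N by exists (b - a)%N; nat_lia.
have dn : (1 <= d <= n)%N by nat_lia.
rewrite dE exprD exprMn -[X in _ != X]mulr1; apply: contra (rn dn) => /eqP e; apply/eqP.
exact: (mulfI (expf_neq0 2 (expf_neq0 a r0))).
Qed.

Lemma refl_param_generic : t ^+ 2 = (r ^+ n) ^+ 2 -> D != 0.
Proof.
move=> tn; rewrite /D mulf_eq0 negb_or subr_eq0 addr_eq0; apply/andP; split; apply/eqP => e.
  have h : (2 < n <= n)%N by nat_lia.
  by have := expr_ratio_neq1 h; rewrite -tn e eqxx.
have h : (1 <= n <= n)%N by nat_lia.
by have := rn h; rewrite -tn e sqrrN expr1n eqxx.
Qed.

(** The defects give R_{j+1} = - R_j, so R_2 = R_0. Under nu_0 the former is multiplied by r and the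
    latter becomes R_1 / r = - R_0 / r; hence (r + 1/r) R_0 = 0. *)
Lemma defect_free_y1 U : t = r ^+ 2 -> lk_defect_free l r U -> (U <= K)%VS.
Proof.
move=> tE [inv def]; have nuU i u : u \in U -> nu i u \in U by rewrite invariant_mem.
have rS u j : u \in U -> (j.+1 < n)%N -> row j.+1 u = - row j u.
  move=> uU jn; have j1 : (j < n.-1)%N by nat_lia.
  have := def (Ordinal j1) u uU; rewrite /lk_defect -/t tE subrr !mul0r add0r /= => /eqP.
  rewrite mulf_eq0 (negPf r21) /= => /eqP e.
  apply: (mulfI r0); apply/eqP; rewrite -subr_eq0; apply/eqP; rewrite -[RHS]e.
  by field.
have r00 u : u \in U -> row 0 u = 0.
  move=> uU; have u'U := nuU i0 u uU.
  have h1 : (1 < n)%N by nat_lia. have h2 : (2 < n)%N by nat_lia.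
  have e := row_nu_out u (isT : 2%N != i0) (isT : 2%N != i0.+1).
  have e' := row_nu_l i0 u; rewrite /= in e e'.
  rewrite (rS _ 1%N u'U h2) (rS _ 0%N u'U h1) e' (rS _ 1%N uU h2) (rS _ 0%N uU h1) !opprK in e.
  by apply: (mulfI rr); rewrite mulr0 mulrDl -e; field; rewrite r0.
apply/subvP => u uU; apply/mem_rowker => j; elim: j => [|j IH] jn; first exact: r00.
by rewrite rS // IH ?oppr0 //; nat_lia.
Qed.

Section MinusOne.
Hypothesis tN1 : t = -1.

Lemma defect_free_ym_row U u j : lk_defect_free l r U -> u \in U -> (j < n)%N ->
  row j u = (r ^+ j) ^+ 2 * row 0 u.
Proof.
move=> [inv def] uU; elim: j => [|j IH] jn; first by rewrite expr0 expr1n mul1r.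
have j1 : (j < n.-1)%N by nat_lia.
have := def (Ordinal j1) u uU; rewrite /lk_defect -/t tN1 addNr mulr0 mul0r add0r /= => /eqP.
rewrite mulf_eq0 (negPf r21) /= => /eqP e.
have -> : row j.+1 u = r ^+ 2 * row j u.
  apply: (mulfI (invr_neq0 r0)); apply/eqP; rewrite -subr_eq0; apply/eqP.
  transitivity (- (r * row j u + -1 / r * row j.+1 u)); first by field.
  by rewrite e oppr0.
by rewrite IH ?(exprS r j); [ring | nat_lia].
Qed.

(** The coordinate v_{ab} enters with r^(a+b) through R_a and with t r^(a+b) through R_b. *)
Lemma row_relation v : \sum_(j < n) (r ^+ j) ^+ 2 * row j v = 0.
Proof.
under eq_bigr do rewrite -lk_pairZl; rewrite -lk_pair_suml.
rewrite (@eq_lk_pair F n _ (fun _ _ => 0)); first by rewrite /lk_pair big1 // => p _; rewrite mulr0.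
move=> a b ab bn; have an := ltn_trans ab bn.
rewrite (bigD1 (Ordinal an)) //= (bigD1 (Ordinal bn)) /=; last by rewrite -val_eqE /=; nat_lia.
have e1 : (b == a) = false by apply/negbTE; nat_lia.
have e2 : (a == b) = false by apply/negbTE; nat_lia.
rewrite big1 => [|j]; last first.
  rewrite -!val_eqE /= => /andP[ja jb]; rewrite /lk_rowc eq_sym (negPf ja) eq_sym (negPf jb).
  by rewrite mulr0.
rewrite /lk_rowc !eqxx e2 -/t tN1 addr0.
have := expf_neq0 a r0; have := expf_neq0 b r0; move: (r ^+ a) (r ^+ b) => X Y Y0 X0.
by field; rewrite X0 Y0.
Qed.

Lemma defect_free_ym U : lk_defect_free l r U -> (r ^+ n) ^+ 2 != -1 -> (U <= K)%VS.
Proof.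
move=> dfU nN1; apply/subvP => u uU; apply/mem_rowker => j jn.
rewrite (defect_free_ym_row dfU uU jn).
have := row_relation u; under eq_bigr => k _ do rewrite (defect_free_ym_row dfU uU (ltn_ord k)) mulrA.
rewrite -mulr_suml => /eqP; rewrite mulf_eq0 => /orP[|/eqP->]; last by rewrite mulr0.
(* With r^2 in place of r: the factor of R_0 is the sum of the r^{4k}, nonzero as r^{4n} <> 1. *)
have h := sum_sqr_lt n (r ^+ 2) n; rewrite minnn in h => /eqP e.
move: h; rewrite (eq_bigr (fun k : 'I_n => (r ^+ k) ^+ 2 * (r ^+ k) ^+ 2)); last first.
  by move=> k _; rewrite ltn_ord [(r ^+ 2) ^+ k]exprAC -[RHS]expr2.
rewrite e mulr0 => /esym/eqP; rewrite subr_eq0 eq_sym [(r ^+ 2) ^+ n]exprAC sqrf_eq1.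
have h : (1 <= n <= n)%N by nat_lia.
by rewrite (negPf (rn h)) (negPf nN1).
Qed.

Section Degenerate.
Hypothesis nN1 : (r ^+ n) ^+ 2 = -1.

Lemma degenerate_row_sym j : (j < n)%N -> (1 - r ^+ 2) * row j (lk_sym n r) = (r ^+ j) ^+ 2 * (r ^+ 2 + 1).
Proof.
move=> jn; have h : (1 - r ^+ 2) * row j (lk_sym n r) =
    (r ^+ j.+1) ^+ 2 - (r ^+ n) ^+ 2 + t * (1 - (r ^+ j) ^+ 2) by apply: lk_row_sym.
by rewrite h tN1 nN1 (exprS r j); ring.
Qed.

Lemma degenerate_row0_sym : row 0 (lk_sym n r) != 0.
Proof.
have n0 : (0 < n)%N by nat_lia.
have := degenerate_row_sym n0; rewrite expr0 expr1n mul1r => e.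
apply: contra r2N1 => /eqP h; rewrite -addr_eq0 -e h mulr0 eqxx //.
Qed.

Lemma degenerate_sub_rowker U u : lk_defect_free l r U -> u \in U ->
  u - (row 0 u / row 0 (lk_sym n r)) *: lk_sym n r \in K.
Proof.
move=> dfU uU; apply/mem_rowker => j jn; rewrite lk_rowB lk_rowZ (defect_free_ym_row dfU uU jn).
have n0 : (0 < n)%N by nat_lia.
have s0 := degenerate_row0_sym.
have e0 := degenerate_row_sym n0; have e1 := degenerate_row_sym jn.
rewrite expr0 expr1n mul1r in e0.
have -> : row j (lk_sym n r) = (r ^+ j) ^+ 2 * row 0 (lk_sym n r).
  by apply: (mulfI r21); rewrite mulrCA e0 e1.
by move: (row 0 (lk_sym n r)) s0 => s s0; field.
Qed.

Lemma lk_sym_nu i : nu i (lk_sym n r) = r *: lk_sym n r.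
Proof. by apply: lk_sym_trivial => //; rewrite -/t tN1 nN1. Qed.

Lemma rowker_trivial_eq0 v : v \in K -> lk_trivial l r v -> v = 0.
Proof.
move=> vK tv; rewrite (trivial_vectorE l0 r0 n3 tv); set c := _ / r.
have /mem_rowker/(_ 0%N ltac:(nat_lia)) := vK.
rewrite {1}(trivial_vectorE l0 r0 n3 tv) -/c lk_rowZ => /eqP.
by rewrite mulf_eq0 (negPf degenerate_row0_sym) orbF => /eqP->; rewrite scale0r.
Qed.

(** If U meets K nontrivially, it contains K and is K or K + T. Otherwise the component k in K of
    any v in U has nu_i k - r k = nu_i v - r v in the zero intersection, so k is a common
    eigenvector for r in K, hence 0, and U = T. *)
Lemma degenerate_cases U : lk_defect_free l r U -> U != 0%VS ->
  [\/ U = T, U = K | U = (K + T)%VS].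
Proof.
move=> dfU U0; have [inv def] := dfU.
have D0 : D = 0 by rewrite /D tN1 addNr mulr0.
have [invK _] := rowker_defect_free l0 r0 n3 D0.
have nuU i u : u \in U -> nu i u \in U by rewrite invariant_mem.
have irr := rowker_irreducible_hook l0 r0 n3 rn tN1.
have UKT : (U <= K + T)%VS.
  apply/subvP => u uU; rewrite -[u](subrK ((row 0 u / row 0 (lk_sym n r)) *: lk_sym n r)).
  by apply: memv_add; [apply: (degenerate_sub_rowker dfU) | rewrite memvZ ?memv_line].
have [UK|UK] := boolP (U <= K)%VS; first by apply: Or32; apply: irr.
have [u uU uK] : exists2 u, u \in U & u \notin K.
  have [j hj] : exists j : 'I_(\dim U), (vbasis U)`_j \notin K.
    apply/existsP; apply: contraR UK => /existsPn h; apply/subvP => u /coord_vbasis->.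
    by apply: memv_suml => j _; rewrite memvZ //; have := h j; rewrite negbK.
  by exists (vbasis U)`_j => //; apply: vbasis_mem; apply: mem_nth; rewrite size_tuple.
have dec v : v \in U -> exists2 k, k \in K & exists c, v = k + c *: lk_sym n r.
  move=> vU; exists (v - (row 0 v / row 0 (lk_sym n r)) *: lk_sym n r).
    exact: (degenerate_sub_rowker dfU).
  by exists (row 0 v / row 0 (lk_sym n r)); rewrite subrK.
have [W0|W0] := eqVneq (U :&: K)%VS 0%VS; last first.
  have WK : (U :&: K)%VS = K.
    apply: irr => //; last exact: capvSr.
    move=> i; apply/subvP => _ /memv_imgP[v + ->].
    by rewrite !memv_cap => /andP[vU vK]; rewrite nuU //= invariant_mem.
  have KU : (K <= U)%VS by rewrite -WK capvSl.
  apply: Or33; apply/eqP; rewrite eqEsubv UKT subv_add KU /= -memvE.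
  have [k kK [c e]] := dec u uU.
  have c0 : c != 0 by apply: contraNneq uK => c0; rewrite e c0 scale0r addr0.
  have : u - k \in U by rewrite memvB // (subvP KU).
  by rewrite e addrC addKr => h; rewrite -[lk_sym n r]scale1r -(mulVf c0) -scalerA memvZ.
have kill v k c : v \in U -> k \in K -> v = k + c *: lk_sym n r -> k = 0.
  move=> vU kK e; apply: rowker_trivial_eq0 => // i; apply/eqP; rewrite -subr_eq0 -memv0 -W0.
  rewrite memv_cap; apply/andP; split; last by rewrite memvB ?memvZ ?invariant_mem.
  have -> : nu i k - r *: k = nu i v - r *: v.
    have e1 : nu i v = nu i k + (r * c) *: lk_sym n r.
      by rewrite e linearD linearZ /= lk_sym_nu scalerA mulrC.
    by rewrite e1 e scalerDr scalerA opprD addrACA subrr addr0.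
  by rewrite memvB ?memvZ ?nuU.
apply: Or31; apply/eqP; rewrite eqEsubv; apply/andP; split.
  apply/subvP => v vU; have [k kK [c e]] := dec v vU.
  by rewrite e (kill v k c vU kK e) add0r memvZ ?memv_line.
rewrite -memvE; have [k kK [c e]] := dec u uU.
have c0 : c != 0 by apply: contraNneq uK => c0; rewrite e c0 scale0r addr0.
have e' : u = c *: lk_sym n r by rewrite e (kill u k c uU kK e) add0r.
by rewrite -[lk_sym n r]scale1r -(mulVf c0) -scalerA -e' memvZ.
Qed.

End Degenerate.

End MinusOne.

Lemma proper_cases U : lk_proper_invariant l r U ->
  [\/ [/\ t = -1, (r ^+ n) ^+ 2 = -1 & U = (K + T)%VS] |
   [\/ t = (r ^+ n) ^+ 2 /\ U = T, t ^+ 2 = (r ^+ n) ^+ 2 /\ U = E,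
     [/\ (4 <= n)%N, t = r ^+ 2 & U = K] | t = -1 /\ U = K]].
Proof.
move=> prU; have dfU := proper_defect_free l0 r0 prU; have [inv U0 _] := prU.
have [D0|D0] := eqVneq D 0; last first.
  have [[h1 h2]|[h1 h2]] := defect_free_generic l0 r0 n3 rn D0 dfU U0.
    by right; apply: Or42.
  by right; apply: Or41.
have /eqP := D0; rewrite mulf_eq0 subr_eq0 addr_eq0 => /orP[/eqP tE|/eqP tN1].
  have UK := defect_free_y1 tE dfU; right; apply: Or43.
  have n4 : (4 <= n)%N.
    rewrite ltn_neqAle n3 andbT; apply/eqP => e3.
    have K0 : K = 0%VS by apply: rowker3_eq0.
    by case/eqP: U0; apply/eqP; rewrite -subv0 -K0.
  by split=> //; apply: rowker_irreducible_row2.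
have [nN1|nN1] := eqVneq ((r ^+ n) ^+ 2) (-1).
  have [h|h|h] := degenerate_cases tN1 nN1 dfU U0; last by left.
    by right; apply: Or41; rewrite tN1 nN1.
  by right; apply: Or44.
right; apply: Or44; split=> //.
by apply: rowker_irreducible_hook => //; apply: defect_free_ym.
Qed.

End Classification.

(** * Distinguishing the four modules *)

Section Alternation.
Variables (F : fieldType) (n : nat) (r : F).

(** An isomorphism invariant: whether the subalgebra generated by the g_i, i in J, has its
    alternating character in U. *)
Definition hecke_alt (V : vectType F) (rho : 'I_n.-1 -> 'End(V)) (U : {vspace V}) (J : pred nat) :=
  exists v, [/\ v \in U, v != 0 & forall i : 'I_n.-1, J i -> rho i v = - r^-1 *: v].

Lemma sub_hecke_alt (V : vectType F) (rho : 'I_n.-1 -> 'End(V)) (U : {vspace V}) (J J' : pred nat) :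
  {subset J' <= J} -> hecke_alt rho U J -> hecke_alt rho U J'.
Proof. by move=> JJ [v [vU v0 h]]; exists v; split=> // i /JJ; apply: h. Qed.

Lemma hecke_iso_alt (V1 V2 : vectType F) (rho1 : 'I_n.-1 -> 'End(V1)) (rho2 : 'I_n.-1 -> 'End(V2))
  (U1 : {vspace V1}) (U2 : {vspace V2}) (J : pred nat) :
  hecke_iso r rho1 U1 rho2 U2 -> hecke_alt rho1 U1 J <-> hecke_alt rho2 U2 J.
Proof.
case=> [[inv1 _ _ _] _ [f [finj fU fnu]]]; split=> [[v [vU v0 h]]|[w [wU w0 h]]].
  exists (f v); split; first by rewrite -fU memv_img.
    by apply: contraNneq v0 => e; apply/eqP/finj; rewrite ?mem0v // e linear0.
  by move=> i Ji; rewrite -fnu // h // linearZ.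
have : w \in (f @: U1)%VS by rewrite fU.
move=> /memv_imgP[v vU e]; exists v; split=> //.
  by apply: contraNneq w0 => v0; rewrite e v0 linear0.
move=> i Ji; apply: finj; rewrite ?memvZ //.
  by apply: (subvP (inv1 i)); apply: memv_img.
by rewrite fnu // linearZ /= -e h.
Qed.

End Alternation.

(** * Alternating vectors in T, E and K *)

Section ModelAlternation.
Variables (F : fieldType) (n : nat) (l r : F).
Hypotheses (l0 : l != 0) (r0 : r != 0) (n3 : (3 <= n)%N).
Hypothesis rn : forall k, (1 <= k <= n)%N -> (r ^+ k) ^+ 2 != 1.

Let t : F := r ^+ 3 / l.
Let D : F := (t - r ^+ 2) * (t + 1).

Local Notation V := (lk_space F n).
Local Notation nu := (@lk_nu F n l r).
Local Notation row := (lk_row l r).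
Implicit Types (u v : V) (i : 'I_n.-1) (U W : {vspace V}) (g : nat -> F).

Let row_nu_out := @lk_row_nu_out F n l r l0 r0.

Let r2N1 : r ^+ 2 != -1 := sqr_neqN1 n3 rn.

Local Notation K := (lk_rowker n l r).
Local Notation E := (lk_refl n l r).
Local Notation T := <[lk_sym n r]>%VS.
Local Notation i0 := (Ordinal (lk_gen0 n3)).
Local Notation i1 := (Ordinal (lk_gen1 n3)).

Let rr : r + r^-1 != 0.
Proof.
apply: contra r2N1 => /eqP e; rewrite -addr_eq0; apply/eqP.
by transitivity (r * (r + r^-1)); [field | rewrite e mulr0].
Qed.

Lemma sym_not_alt : t = (r ^+ n) ^+ 2 -> ~ hecke_alt r nu T (pred1 0%N).
Proof.
move=> tn [v [/vlineP[c ->] v0 h]]; have := h i0 (eqxx _).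
rewrite linearZ /= lk_sym_trivial // => e; case/eqP: v0.
apply: (scalerI rr); rewrite scaler0 scalerDl -[X in _ + X]opprK -scaleNr -e.
by rewrite scalerA mulrC -scalerA subrr.
Qed.

Section ReflAlt.
Hypothesis tn : t ^+ 2 = (r ^+ n) ^+ 2.

Let D0 : D != 0 := refl_param_generic r0 n3 rn tn.

Lemma refl_alt : hecke_alt r nu E (pred1 0%N).
Proof.
have [p pE [rp ap]] := refl_unit l0 r0 n3 D0 tn i0.
exists p; split=> //; last by move=> i /eqP i0E; rewrite (_ : i = i0) //; apply: val_inj.
apply/eqP => p0; have := rp 0%N ltac:(nat_lia).
by rewrite p0 lk_row0 /unit_diff /= subr0 => /esym/eqP; rewrite oner_eq0.
Qed.

Lemma refl_alt_row i (j : nat) v : v \in E -> nu i v = - r^-1 *: v -> j != i -> j != i.+1 -> row j v = 0.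
Proof.
move=> vE e ji ji1; have := row_nu_out v ji ji1; rewrite e lk_rowZ => e'.
by apply: (mulfI rr); rewrite mulr0 mulrDl -e'; ring.
Qed.

(** A vector of E alternating for g_i has no rows but i and i + 1. If b <> a + 1, no row is left; if
    b = a + 1, only R_{a+1} is, and the formula for R_a(nu_a v) kills it. *)
Lemma refl_not_alt_pair (a b : nat) : a != b -> (a < n.-1)%N -> (b < n.-1)%N -> a != b.+1 ->
  ~ hecke_alt r nu E (pred2 a b).
Proof.
move=> ab an bn ab1 [v [vE v0 h]].
have ha : nu (Ordinal an) v = - r^-1 *: v by apply: h; rewrite /= eqxx.
have hb : nu (Ordinal bn) v = - r^-1 *: v by apply: h; rewrite /= eqxx orbT.
case/eqP: v0; have ra := fun j => @refl_alt_row (Ordinal an) j v vE ha.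
have rb := fun j => @refl_alt_row (Ordinal bn) j v vE hb.
have ra0 : row a v = 0 by apply: rb.
have [j1|j1] := boolP ((a.+1 != b) && (a.+1 != b.+1)).
  have z j : (j < n)%N -> row j v = 0.
    move=> jn; have [->//|ja] := eqVneq j a.
    have [->|ja1] := eqVneq j a.+1; first by case/andP: j1 => h1 h2; apply: rb.
    exact: ra.
  by apply: (@refl_row_inj F n l r) z.
have := row_nu_defect l0 r0 n3 (proj2 (refl_defect_free l0 r0 n3) (Ordinal an) v vE) a.
rewrite ha lk_rowZ ra0 !mulr0 add0r subr0 /= eqxx (_ : (a == a.+1) = false); last by apply/negbTE; nat_lia.
rewrite subr0 mulr1 => /esym/eqP; rewrite mulf_eq0 invr_eq0 (negPf r0) orbF => /eqP ra1.
apply: (@refl_row_inj F n l r) => // j jn.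
have [->//|ja] := eqVneq j a; have [->//|ja1] := eqVneq j a.+1; exact: ra.
Qed.

End ReflAlt.

Lemma rowker_alt_row2 : (4 <= n)%N -> t = r ^+ 2 -> hecke_alt r nu K (pred2 0 2)%N.
Proof.
move=> n4 tE; exists (row2_vec n r); split; first exact: row2_vec_rowker.
  exact: row2_vec_neq0.
move=> i /orP[/eqP h|/eqP h].
  by rewrite (_ : i = i0) ?row2_vec_alt0 //; apply: val_inj.
by rewrite (_ : i = Ordinal (lk_gen2 n3 n4)) ?row2_vec_alt2 //; apply: val_inj.
Qed.

Lemma rowker_not_alt_row2 : t = r ^+ 2 -> ~ hecke_alt r nu K (pred2 0 1)%N.
Proof.
move=> tE [v [vK v0 h]]; case/eqP: v0.
by apply: (@alternating01_y1 F n l r) => //; apply: h; rewrite /= ?eqxx ?orbT.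
Qed.

Lemma rowker_alt_hook : t = -1 -> hecke_alt r nu K (pred2 0 1)%N.
Proof.
move=> tE; exists (hook_vec n r); split; first exact: hook_vec_rowker.
  exact: hook_vec_neq0.
move=> i /orP[/eqP h|/eqP h].
  by rewrite (_ : i = i0) ?hook_vec_alt0 //; apply: val_inj.
by rewrite (_ : i = i1) ?hook_vec_alt1 //; apply: val_inj.
Qed.

End ModelAlternation.

(** * Which module arises for which parameter *)

Section Arises.
Variables (F : fieldType) (n : nat) (r : F).
Hypotheses (r0 : r != 0) (n3 : (3 <= n)%N).
Hypothesis rn : forall k, (1 <= k <= n)%N -> (r ^+ k) ^+ 2 != 1.

Local Notation S lam := (specht n r lam).
Local Notation salt lam J := (hecke_alt r (@hecke_rmul F n r) (S lam) J).

(** With r fixed, l is free: each of the four Specht modules gets a model over the same F in which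
    its alternating vectors are known. *)
Lemma exists_param x : x != 0 -> exists2 l : F, l != 0 & r ^+ 3 / l = x.
Proof.
move=> x0; exists (r ^+ 3 / x); first by rewrite mulf_neq0 ?expf_neq0 ?invr_eq0.
by field; rewrite r0 x0.
Qed.

Lemma specht1_not_alt : ~ salt [:: n] (pred1 0%N).
Proof.
have [l l0 tE] := exists_param (expf_neq0 2 (expf_neq0 n r0)).
move=> /(hecke_iso_alt _ (sym_iso l0 r0 n3 rn tE)); exact: sym_not_alt.
Qed.

Let refl_param : exists2 l : F, l != 0 & (r ^+ 3 / l) ^+ 2 = (r ^+ n) ^+ 2.
Proof. by have [l l0 tE] := exists_param (expf_neq0 n r0); exists l; rewrite ?tE. Qed.

Lemma specht2_alt : salt [:: n - 1; 1]%N (pred1 0%N).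
Proof.
have [l l0 tE] := refl_param; have D0 := refl_param_generic r0 n3 rn tE.
exact/(hecke_iso_alt _ (refl_iso l0 r0 n3 rn D0 tE))/refl_alt.
Qed.

Lemma specht2_not_alt (a b : nat) : a != b -> (a < n.-1)%N -> (b < n.-1)%N -> a != b.+1 ->
  ~ salt [:: n - 1; 1]%N (pred2 a b).
Proof.
move=> h1 h2 h3 h4; have [l l0 tE] := refl_param; have D0 := refl_param_generic r0 n3 rn tE.
move=> /(hecke_iso_alt _ (refl_iso l0 r0 n3 rn D0 tE)); exact: refl_not_alt_pair.
Qed.

Section FourStrands.
Hypothesis n4 : (4 <= n)%N.

Lemma specht3_alt : salt [:: n - 2; 2]%N (pred2 0 2)%N.
Proof.
have [l l0 tE] := exists_param (expf_neq0 2 r0).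
exact/(hecke_iso_alt _ (rowker_iso_row2 l0 r0 n3 rn n4 tE))/rowker_alt_row2.
Qed.

Lemma specht3_not_alt : ~ salt [:: n - 2; 2]%N (pred2 0 1)%N.
Proof.
have [l l0 tE] := exists_param (expf_neq0 2 r0).
move=> /(hecke_iso_alt _ (rowker_iso_row2 l0 r0 n3 rn n4 tE)); exact: rowker_not_alt_row2.
Qed.

End FourStrands.

Lemma specht4_alt : salt [:: n - 2; 1; 1]%N (pred2 0 1)%N.
Proof.
have N1 : (-1 : F) != 0 by rewrite oppr_eq0 oner_eq0.
have [l l0 tE] := exists_param N1.
exact/(hecke_iso_alt _ (rowker_iso_hook l0 r0 n3 rn tE))/rowker_alt_hook.
Qed.

Variable l : F.
Hypothesis l0 : l != 0.
Let t : F := r ^+ 3 / l.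
Local Notation nu := (@lk_nu F n l r).

Let r21 : r ^+ 2 != 1 := sqr_neq1 n3 rn.

Let alt0 (V : vectType F) rho (U : {vspace V}) b : hecke_alt r rho U (pred2 0%N b) ->
  hecke_alt (n := n) r rho U (pred1 0%N).
Proof. by apply: sub_hecke_alt => i /eqP->; rewrite inE eqxx. Qed.

(* The generators of index 0, of index 0 and 1, and (for n >= 4) of index 0
   and 2 have a common eigenvector for -1/r in the following cases only:
   (n) none; (n-1,1) the first; (n-2,2) the first and third; (n-2,1,1) the
   first and second at least. *)
Lemma proper_alt_cases U : lk_proper_invariant l r U ->
  [\/ t = (r ^+ n) ^+ 2 /\ ~ hecke_alt r nu U (pred1 0%N),
     [/\ t ^+ 2 = (r ^+ n) ^+ 2, hecke_alt r nu U (pred1 0%N), ~ hecke_alt r nu U (pred2 0 1)%N &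
      (4 <= n)%N -> ~ hecke_alt r nu U (pred2 0 2)%N],
     [/\ (4 <= n)%N, t = r ^+ 2, hecke_alt r nu U (pred2 0 2)%N & ~ hecke_alt r nu U (pred2 0 1)%N]
   | t = -1 /\ hecke_alt r nu U (pred2 0 1)%N].
Proof.
move=> /(proper_cases l0 r0 n3 rn)[[tE _ ->]|[[tE ->]|[tE ->]|[n4 tE ->]|[tE ->]]].
- apply: Or44; split=> //; have [v [vK v0 h]] := rowker_alt_hook l0 r0 n3 tE.
  by exists v; split=> //; apply: (subvP (addvSl _ _)).
- by apply: Or41; split=> //; apply: sym_not_alt.
- apply: Or42; split=> //; first exact: refl_alt.
    by apply: refl_not_alt_pair => //; nat_lia.
  by move=> n4; apply: refl_not_alt_pair => //; nat_lia.
- apply: Or43; split=> //; first exact: rowker_alt_row2.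
  exact: rowker_not_alt_row2.
- by apply: Or44; split=> //; apply: rowker_alt_hook.
Qed.

Lemma arises1 : lk_contains_specht n l r [:: n] <-> t = (r ^+ n) ^+ 2.
Proof.
split=> [[U [prU iso]]|tE]; last first.
  exists <[lk_sym n r]>%VS; split; last exact: sym_iso.
  apply: defect_free_proper => //.
    by apply: trivial_line_defect_free => //; apply: lk_sym_trivial.
  by rewrite -subv0 -memvE memv0 lk_sym_neq0.
have no h := specht1_not_alt ((hecke_iso_alt _ iso).1 h).
by case: (proper_alt_cases prU) => [[]//|[_ /no]|[_ _ /alt0/no]|[_ /alt0/no]].
Qed.

Lemma arises2 : lk_contains_specht n l r [:: n - 1; 1]%N <-> t ^+ 2 = (r ^+ n) ^+ 2.
Proof.
split=> [[U [prU iso]]|tE]; last first.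
  have D0 := refl_param_generic r0 n3 rn tE.
  exists (lk_refl n l r); split; last exact: refl_iso.
  apply: defect_free_proper => //; first exact: refl_defect_free.
  exact: refl_neq0.
have a0 := (hecke_iso_alt _ iso).2 specht2_alt.
have no a b := fun h1 h2 h3 h4 h => @specht2_not_alt a b h1 h2 h3 h4 ((hecke_iso_alt (pred2 a b) iso).1 h).
case: (proper_alt_cases prU) => [[_ /(_ a0)]|[]|[n4 _ /no h]|[_ /no h]] //.
  by exfalso; apply: h; nat_lia.
by exfalso; apply: h; nat_lia.
Qed.

Lemma arises3 : (4 <= n)%N -> lk_contains_specht n l r [:: n - 2; 2]%N <-> t = r ^+ 2.
Proof.
move=> n4; split=> [[U [prU iso]]|tE]; last first.
  exists (lk_rowker n l r); split; last exact: rowker_iso_row2.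
  apply: defect_free_proper => //.
    by apply: rowker_defect_free => //; rewrite -/t tE subrr mul0r.
  have v0 : row2_vec n r != 0 by apply: row2_vec_neq0.
  apply: contraNneq v0 => K0; rewrite -memv0 -K0; exact: row2_vec_rowker.
have a0 := (hecke_iso_alt _ iso).2 (specht3_alt n4).
have no h := specht3_not_alt n4 ((hecke_iso_alt _ iso).1 h).
by case: (proper_alt_cases prU) => [[_ /(_ (alt0 a0))]|[_ _ _ /(_ n4 a0)]|[]|[_ /no]].
Qed.

Lemma arises4 : lk_contains_specht n l r [:: n - 2; 1; 1]%N <-> t = -1.
Proof.
split=> [[U [prU iso]]|tE]; last first.
  exists (lk_rowker n l r); split; last exact: rowker_iso_hook.
  apply: defect_free_proper => //.
    by apply: rowker_defect_free => //; rewrite -/t tE addNr mulr0.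
  have v0 : hook_vec n r != 0 by apply: hook_vec_neq0.
  apply: contraNneq v0 => K0; rewrite -memv0 -K0; exact: hook_vec_rowker.
have a0 := (hecke_iso_alt _ iso).2 specht4_alt.
by case: (proper_alt_cases prU) => [[_ /(_ (alt0 a0))]|[_ _ /(_ a0)]|[_ _ _ /(_ a0)]|[]].
Qed.

(** The four parameter conditions exclude each other, except t = r^{2n} and t = -1, which together
    are the excluded case. So only one candidate remains. *)
Lemma proper_unique_iso : ~ (t = -1 /\ (r ^+ n) ^+ 2 = -1) -> lk_reducible n l r ->
  (exists! U : {vspace lk_space F n}, lk_proper_invariant l r U) /\
  (forall U : {vspace lk_space F n}, lk_proper_invariant l r U ->
     [\/ lk_iso_specht l r U [:: n], lk_iso_specht l r U [:: n - 1; 1]%N,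
        (4 <= n)%N /\ lk_iso_specht l r U [:: n - 2; 2]%N | lk_iso_specht l r U [:: n - 2; 1; 1]%N]).
Proof.
move=> nd [U prU].
have N0 : (r ^+ n) ^+ 2 != 0 by rewrite !expf_neq0.
have N1 : (r ^+ n) ^+ 2 != 1 by apply: rn; nat_lia.
have cases := proper_cases l0 r0 n3 rn.
have c12 : t = (r ^+ n) ^+ 2 -> t ^+ 2 = (r ^+ n) ^+ 2 -> False.
  move=> ->; rewrite expr2 => /eqP; rewrite -subr_eq0 -{3}[(r ^+ n) ^+ 2]mulr1 -mulrBr.
  by rewrite mulf_eq0 (negPf N0) subr_eq0 (negPf N1).
have c23 : t ^+ 2 = (r ^+ n) ^+ 2 -> t = r ^+ 2 -> False.
  by move=> /(refl_param_generic r0 n3 rn)/eqP h tE; apply: h; rewrite -/t tE subrr mul0r.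
have c24 : t ^+ 2 = (r ^+ n) ^+ 2 -> t = -1 -> False.
  by move=> /(refl_param_generic r0 n3 rn)/eqP h tE; apply: h; rewrite -/t tE addNr mulr0.
have c13 : t = (r ^+ n) ^+ 2 -> t = r ^+ 2 -> False.
  move=> e1 e2; have h : (1 < n <= n)%N by nat_lia.
  have /eqP : (r ^+ n) ^+ 2 != (r ^+ 1) ^+ 2 by apply: expr_ratio_neq1 h.
  by rewrite expr1 -e1.
have c34 : t = r ^+ 2 -> t = -1 -> False.
  by move=> -> /eqP; rewrite (negPf (sqr_neqN1 n3 rn)).
have c14 : t = (r ^+ n) ^+ 2 -> t = -1 -> False.
  by move=> e e'; apply: nd; rewrite -e.
split.
  exists U; split=> // W prW.
  have := cases U prU; have := cases W prW.
  case=> [[e1 e2 _]|]; first by case: nd.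
  move=> cW [[e1 e2 _]|]; first by case: nd.
  by case: cW => [[e ->]|[e ->]|[_ e ->]|[e ->]]; case=> [[e' ->]|[e' ->]|[_ e' ->]|[e' ->]] //;
    exfalso; eauto.
move=> W /cases[[e1 e2 _]|]; first by case: nd.
case=> [[tE ->]|[tE ->]|[n4 tE ->]|[tE ->]].
- by apply: Or41; apply: sym_iso.
- apply: Or42; exact: (refl_iso l0 r0 n3 rn (refl_param_generic r0 n3 rn tE) tE).
- by apply: Or43; split=> //; apply: rowker_iso_row2.
- by apply: Or44; apply: rowker_iso_hook.
Qed.

End Arises.

(** * Direct sums of Hecke modules *)

Section DirectSum.
Variables (F : fieldType) (n : nat) (r : F).

Lemma hecke_iso_dsum (V V1 V2 : vectType F) (rho : 'I_n.-1 -> 'End(V))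
  (rho1 : 'I_n.-1 -> 'End(V1)) (rho2 : 'I_n.-1 -> 'End(V2)) (U1 U2 : {vspace V})
  (W1 : {vspace V1}) (W2 : {vspace V2}) :
  (U1 :&: U2 = 0)%VS -> hecke_iso r rho U1 rho1 W1 -> hecke_iso r rho U2 rho2 W2 ->
  hecke_iso r rho (U1 + U2)%VS (dsum_act rho1 rho2) (dsum_sub W1 W2).
Proof.
move=> U12 [[invU1 qU1 bU1 cU1] [inv1 q1 b1 c1] [f1 [inj1 im1 nu1]]].
move=> [[invU2 qU2 bU2 cU2] [inv2 q2 b2 c2] [f2 [inj2 im2 nu2]]].
have U21 : (U2 :&: U1 = 0)%VS by rewrite capvC.
pose p1 := daddv_pi U1 U2; pose p2 := daddv_pi U2 U1.
have p1U u : p1 u \in U1 by apply: memv_pi.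
have p2U u : p2 u \in U2 by apply: memv_pi.
have rU1 i u : u \in U1 -> rho i u \in U1 by move=> uU; apply: (subvP (invU1 i)); apply: memv_img.
have rU2 i u : u \in U2 -> rho i u \in U2 by move=> uU; apply: (subvP (invU2 i)); apply: memv_img.
have p12 u : u \in U2 -> p1 u = 0.
  move=> uU; have := daddv_pi_add U12 (subvP (addvSr U1 U2) u uU).
  by rewrite (daddv_pi_id U21 uU) => /(canRL (addrK _)); rewrite subrr.
have p21 u : u \in U1 -> p2 u = 0.
  move=> uU; have := daddv_pi_add U12 (subvP (addvSl U1 U2) u uU).
  by rewrite (daddv_pi_id U12 uU) => /(canRL (addKr _)); rewrite addNr.
have p11 u : u \in U1 -> p1 u = u by apply: daddv_pi_id.
have p22 u : u \in U2 -> p2 u = u by apply: daddv_pi_id.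
clearbody p1 p2.
have dec u : u \in (U1 + U2)%VS -> exists x y, [/\ x \in U1, y \in U2 & u = x + y].
  by move=> /memv_addP[x xU [y yU e]]; exists x, y.
have actE i x : dsum_act rho1 rho2 i x = (rho1 i x.1, rho2 i x.2) by rewrite lfunE.
split.
- split=> [i|i u|i j u ij|i j u ij].
  + by rewrite limgD addvS.
  + move=> /dec[x [y [xU yU ->]]]; rewrite !(linearD (rho _)) scalerDr addrACA qU1 // qU2 //.
  + by move=> /dec[x [y [xU yU ->]]]; rewrite !linearD /= (bU1 i j) // (bU2 i j).
  + by move=> /dec[x [y [xU yU ->]]]; rewrite !linearD /= (cU1 i j) // (cU2 i j).
- split=> [i|i u|i j u ij|i j u ij].
  + apply/subvP => _ /memv_imgP[u + ->]; rewrite actE !mem_dsum_sub /= => /andP[h1 h2].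
    by rewrite (subvP (inv1 i)) ?(subvP (inv2 i)) ?memv_img.
  + rewrite mem_dsum_sub !actE => /andP[h1 h2]; rewrite [u in RHS]surjective_pairing.
    by congr (_, _); rewrite /= ?q1 ?q2.
  + by rewrite mem_dsum_sub !actE => /andP[h1 h2] /=; rewrite (b1 i j) // (b2 i j).
  + by rewrite mem_dsum_sub !actE => /andP[h1 h2] /=; rewrite (c1 i j) // (c2 i j).
pose f u : V1 * V2 := (f1 (p1 u), f2 (p2 u)).
have lf : linear f by move=> c u v; rewrite /f !linearP.
pose fL := GRing.isLinear.Build F V (V1 * V2)%type _ f lf.
pose g : {linear V -> (V1 * V2)%type} := HB.pack f fL.
have gE x y : x \in U1 -> y \in U2 -> linfun g (x + y) = (f1 x, f2 y).
  move=> xU yU; rewrite lfunE /= /f.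
  have -> : p1 (x + y) = x by rewrite linearD /= p11 // p12 // addr0.
  by have -> : p2 (x + y) = y by rewrite linearD /= p21 // p22 // add0r.
exists (linfun g); split.
- move=> u v /dec[x [y [xU yU ->]]] /dec[x' [y' [xU' yU' ->]]].
  by rewrite !gE // => -[/inj1-> // /inj2-> //].
- apply/vspaceP => -[a b]; rewrite mem_dsum_sub /= -im1 -im2.
  apply/memv_imgP/andP => [[u /dec[x [y [xU yU ->]]] e]|[/memv_imgP[x xU ->] /memv_imgP[y yU ->]]].
    by move: e; rewrite gE // => -[-> ->]; rewrite !memv_img.
  by exists (x + y); rewrite ?gE ?memv_add.
move=> i u /dec[x [y [xU yU ->]]]; rewrite linearD actE !gE ?rU1 ?rU2 //=.
by rewrite nu1 // nu2.
Qed.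

End DirectSum.

(** * The exceptional case t = -1, r^{2n} = -1 *)

Section DegenerateCase.
Variables (F : fieldType) (n : nat) (l r : F).
Hypotheses (l0 : l != 0) (r0 : r != 0) (n3 : (3 <= n)%N).
Hypothesis rn : forall k, (1 <= k <= n)%N -> (r ^+ k) ^+ 2 != 1.
Hypotheses (tN1 : r ^+ 3 / l = -1) (nN1 : (r ^+ n) ^+ 2 = -1).

Local Notation K := (lk_rowker n l r).
Local Notation T := <[lk_sym n r]>%VS.

Lemma rowker_cap_sym : (T :&: K = 0)%VS.
Proof.
apply/eqP; rewrite -subv0; apply/subvP => u; rewrite memv_cap => /andP[/vlineP[c ->]].
have n0 : (0 < n)%N by nat_lia.
move=> /mem_rowker/(_ 0%N n0)/eqP; rewrite lk_rowZ mulf_eq0.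
by rewrite (negPf (degenerate_row0_sym r0 n3 rn tN1 nN1)) orbF => /eqP->; rewrite scale0r mem0v.
Qed.

Lemma degenerate_classification : exists U1 U2 U3 : {vspace lk_space F n},
  [/\ uniq [:: U1; U2; U3],
      forall U : {vspace lk_space F n}, lk_proper_invariant l r U <-> [\/ U = U1, U = U2 | U = U3],
      lk_iso_specht l r U1 [:: n],
      lk_iso_specht l r U2 [:: n - 2; 1; 1]%N
    & lk_iso_specht2 l r U3 [:: n] [:: n - 2; 1; 1]%N].
Proof.
have isoT : lk_iso_specht l r T [:: n] by apply: sym_iso; rewrite // tN1 nN1.
have isoK : lk_iso_specht l r K [:: n - 2; 1; 1]%N by apply: rowker_iso_hook.
have trT : lk_trivial l r (lk_sym n r) by apply: lk_sym_trivial; rewrite // tN1 nN1.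
have dfT : lk_defect_free l r T by apply: trivial_line_defect_free.
have dfK : lk_defect_free l r K by apply: rowker_defect_free; rewrite // tN1 addNr mulr0.
have s0 : lk_sym n r != 0.
  by apply: contraNneq (degenerate_row0_sym r0 n3 rn tN1 nN1) => ->; rewrite lk_row0.
have T0 : T != 0%VS by apply: contraNneq s0 => e; rewrite -memv0 -e memv_line.
have K0 : K != 0%VS.
  have h0 : hook_vec n r != 0 by apply: hook_vec_neq0.
  apply: contraNneq h0 => K0; rewrite -memv0 -K0.
  exact: hook_vec_rowker.
have dfKT : lk_defect_free l r (T + K)%VS.
  have [[invT dT] [invK dK]] := (dfT, dfK); split=> [i|i _ /memv_addP[u uT [v vK ->]]].
    by rewrite limgD addvS.
  transitivity (lk_defect l r i u + lk_defect l r i v); last by rewrite dT // dK // addr0.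
  by rewrite /lk_defect lk_coD !lk_rowD; ring.
have disj := rowker_cap_sym.
have r21 : r ^+ 2 != 1 by apply: (sqr_neq1 n3 rn).
exists T, K, (T + K)%VS; split=> //.
- rewrite /= !inE !andbT negb_or; apply/andP; split; [apply/andP; split|].
  + by apply: contraNneq T0 => e; rewrite -subv0 -disj -e capvv.
  + apply: contraNneq K0 => e; rewrite -subv0 -disj e subv_cap subvv andbT; exact: addvSr.
  + apply: contraNneq T0 => e; rewrite -subv0 -disj subv_cap subvv e; exact: addvSl.
- move=> U; split=> [prU|h].
    have [_ U0 _] := prU; have dfU := proper_defect_free l0 r0 prU.
    by rewrite addvC; apply: degenerate_cases.
  apply: defect_free_proper => //; case: h => -> //.
  by apply: contraNneq T0 => e; rewrite -subv0 -e addvSl.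
- exact: hecke_iso_dsum.
Qed.

End DegenerateCase.

Theorem mainTheorem1 (R : realType) (n : nat) (t q r : R[i])
    (hn : (3 <= n)%N) (ht : t != 0) (hq : q != 0)
    (hqk : forall k : nat, (1 <= k <= n)%N -> q ^+ k != 1)
    (hr : r != 0) (hqr : q = 1 / r ^+ 2) :
  let F := adjoin_rat_type (r ^+ 3 / t) r in
  let l : F := adjoin_gen1 (r ^+ 3 / t) r in
  let r' : F := adjoin_gen2 (r ^+ 3 / t) r in
  let proper := @lk_proper_invariant F n l r' in
  let isoS := @lk_iso_specht F n l r' in
  let isoS2 := @lk_iso_specht2 F n l r' in
  let arises := @lk_contains_specht F n l r' in
  let lam1 := [:: n] in
  let lam2 := [:: n - 1; 1]%N in
  let lam3 := [:: n - 2; 2]%N in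
  let lam4 := [:: n - 2; 1; 1]%N in
  (~ (t = -1 /\ q ^+ n = -1) ->
     (lk_reducible n l r' ->
        (exists! U : {vspace lk_space F n}, proper U) /\
        (forall U : {vspace lk_space F n}, proper U ->
           [\/ isoS U lam1, isoS U lam2, (4 <= n)%N /\ isoS U lam3
             | isoS U lam4])) /\
     [/\ arises lam1 <-> t = 1 / q ^+ n,
         arises lam2 <->
           (t = 1 / sqrtC q ^+ n \/ t = - (1 / sqrtC q ^+ n)),
         (4 <= n)%N -> (arises lam3 <-> t = 1 / q)
       & arises lam4 <-> t = -1]) /\
  (t = -1 /\ q ^+ n = -1 ->
     exists U1 U2 U3 : {vspace lk_space F n},
       [/\ uniq [:: U1; U2; U3],
           forall U : {vspace lk_space F n},
             proper U <-> [\/ U = U1, U = U2 | U = U3],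
           isoS U1 lam1,
           isoS U2 lam4
         & isoS2 U3 lam1 lam4]).
Proof.
move=> F l r' proper isoS isoS2 arises lam1 lam2 lam3 lam4.
(* Parameter conditions in F are transported to the complex numbers along this injective morphism,
   where q^k is the inverse of r^{2k}. *)
pose v : {rmorphism F -> R[i]} := val.
have vinj : injective v by apply: fmorph_inj.
have vl : v l = r ^+ 3 / t by [].
have vr : v r' = r by [].
have l0 : l != 0 by rewrite -(fmorph_eq0 v) vl mulf_neq0 ?invr_eq0 ?expf_neq0.
have r0 : r' != 0 by rewrite -(fmorph_eq0 v) vr.
have vt : v (r' ^+ 3 / l) = t.
  by rewrite rmorphM fmorphV rmorphXn vl vr; field; rewrite ht hr.
have vN1 : v (-1) = -1 by rewrite rmorphN rmorph1.
have vn k : v ((r' ^+ k) ^+ 2) = (r ^+ k) ^+ 2 by rewrite !rmorphXn vr.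
have qE k : q ^+ k = ((r ^+ k) ^+ 2)^-1 by rewrite hqr div1r exprVn -!exprM mulnC.
have rn k : (1 <= k <= n)%N -> (r' ^+ k) ^+ 2 != 1.
  move=> /hqk; apply: contraNneq => /(congr1 v); rewrite vn rmorph1 qE => ->.
  by rewrite invr1.
have vE x y : x = y <-> v x = v y by split=> [->|/vinj].
have tN1 : r' ^+ 3 / l = -1 <-> t = -1 by rewrite vE vt vN1.
have nN1 : (r' ^+ n) ^+ 2 = -1 <-> q ^+ n = -1.
  rewrite vE vn vN1 qE; split=> [->|h]; first by rewrite invrN1.
  by rewrite -[LHS]invrK h invrN1.
split=> [nd|[/tN1 h1 /nN1 h2]]; last exact: degenerate_classification.
split.
  by apply: proper_unique_iso => // -[/tN1 h1 /nN1 h2]; apply: nd.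
split.
- by rewrite /arises arises1 // vE vt vn qE div1r invrK.
- rewrite /arises arises2 // vE rmorphXn vt vn.
  (* Both signs occur in the condition on t, so the root selected by [sqrtC] does not matter. *)
  have -> : (r ^+ n) ^+ 2 = (1 / sqrtC q ^+ n) ^+ 2.
    by rewrite div1r exprVn [(sqrtC q ^+ n) ^+ 2]exprAC sqrtCK qE invrK.
  split=> [/eqP|]; last by case=> ->; rewrite ?sqrrN.
  by rewrite eqf_sqr => /orP[/eqP|/eqP]; [left|right].
- move=> n4; rewrite /arises arises3 // vE vt rmorphXn vr.
  by rewrite -[q]expr1 qE expr1 div1r invrK.
- by rewrite /arises arises4.
Qed.
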